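(* Let $(\mathcal{A},H,D,\theta)$ be a unital twisted spectral triple. (1) If $(\mathcal{A},H,D,\theta)$ is regular, then there exist an algebra of differential operators and an algebra of pseudodifferential operators adapted to it. (2) Conversely, if there exists an algebra of differential operators $\mathrm{DO}^\bullet$ adapted to $(\mathcal{A},H,D,\theta)$, with $\theta$ diagonalizable (meaning that $\mathrm{DO}$ is the direct sum of its $\theta$-eigenspaces), then $(\mathcal{A},H,D,\theta)$ is regular.
   Context: A twisting of an algebra $\mathcal{A}$ is a linear automorphism $\theta:\mathcal{A}\to\mathcal{A}$ (not necessarily an algebra automorphism). The twisted commutator is $[x,y]_\theta=xy-\theta(y)x$. A (unital) twisted spectral triple $(\mathcal{A},H,D,\theta)$ consists of a Hilbert space $H$, a unital $*$-algebra $\mathcal{A}$ represented as bounded operators on $H$ with a twisting $\theta$, and an unbounded self-adjoint operator $D$ on $H$ such that $D$ has compact resolvent and $[D,a]_\theta$ is densely defined and bounded for all $a\in\mathcal{A}$. It is regular if $\theta$ can be extended to a $*$-algebra $\mathcal{B}\subseteq\mathbb{L}(H)$ of bounded operators containing both $\mathcal{A}$ and $[D,\mathcal{A}]_\theta$, such that the twisted derivation $\delta_\theta=[|D|,\cdot\,]_\theta$ preserves $\mathcal{B}$. Notation: $\Delta=D^2+1$; $H^\infty=\bigcap_{n\in\mathbb{N}}\mathrm{Dom}(\Delta^n)$; for $s\in\mathbb{R}$, $H^s$ is the completion of $H^\infty$ in the norm $\|v\|_s=\|\Delta^{s/2}v\|$; $\mathrm{Op}^t$ ($t\in\mathbb{R}$)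 is the set of operators on $H^\infty$ that extend to bounded operators $H^{s+t}\to H^s$ for every $s\in\mathbb{R}$. An algebra of differential operators adapted to $(\mathcal{A},H,D,\theta)$ is an $\mathbb{N}$-filtered algebra $\mathrm{DO}^\bullet$ of operators on $H^\infty$ which contains both $\mathcal{A}$ and $[D,\mathcal{A}]_\theta$ in $\mathrm{DO}^0$, is equipped with an extension of the twisting $\theta$, and satisfies: (i) (elliptic estimates) for every $X\in\mathrm{DO}^n$ there is $C>0$ such that $\|Xv\|_H\le C\|\Delta^{n/2}v\|_H$ for all $v\in H^\infty$; (ii) $[\Delta,\mathrm{DO}^n]_{\theta^2}\subseteq\mathrm{DO}^{n+1}$ for all $n$. An algebra of pseudodifferential operators adapted to $(\mathcal{A},H,D,\theta)$ is an $\mathbb{R}$-filtered subalgebra $\Psi^\bullet$ of $\mathrm{Op}^\bullet$ containing both $\mathcal{A}$ and $[D,\mathcal{A}]_\theta$ in $\Psi^0$, equipped with a $1$-parameter group $(\Theta^z)_{z\in\mathbb{C}}$ of twistings, and satisfying: (i) $\theta(a)-\Theta^1(a)\in\Psi^{-1}$ for all $a\in\mathcal{A}$; (ii) $\Delta^z\Psi^\bullet\subseteq\Psi^\bullet$ and $\Psi^\bullet\Delta^z\subseteq\Psi^\bullet$ for all $z\in\mathbb{C}$; (iii) $[\Delta^{z/2},\Psi^s]_{\Theta^z}\subseteq\Psi^{\mathrm{Re}(z)+s-1}$ for all $z\in\mathbb{C}$, $s\in\mathbb{R}$.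
   Formalization: In part (2) it is additionally assumed that θ on DO has no negative real eigenvalue, since the claim fails otherwise (D e_n = n e_n, g e_n = e_{-n}, θ(g) = -g); the twistings of DO and Ψ are taken to preserve the filtration. *)

(* Defs.v *)
From HB Require Import structures.
From mathcomp Require Import all_boot all_order all_algebra.
From mathcomp Require Import sesquilinear.
From mathcomp Require Import all_classical all_reals all_analysis.
From mathcomp Require Import complex.

Set Implicit Arguments.
Unset Strict Implicit.
Unset Printing Implicit Defensive.

Import Order.TTheory GRing.Theory Num.Theory ComplexField.
Import numFieldNormedType.Exports.

Local Open Scope classical_set_scope.
Local Open Scope complex_scope.
Local Open Scope ring_scope.

(* The inner product is linear in its first argument. *)
Record hilbertSpace (R : realType) := HilbertSpace {
  hilbert_sort :> completeNormedModType R[i] ;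
  inner : {dot hilbert_sort for Num.conj} ;
  innerE : forall v : hilbert_sort, `|v| ^+ 2 = inner v v
}.

Section LinearAlgebra.
Context (K : fieldType) (M : lmodType K).

Definition subspace (S : set M) : Prop :=
  S 0 /\ forall (a : K) x y, S x -> S y -> S (a *: x + y).

Definition linear_on (S : set M) (f : M -> M) : Prop :=
  forall (a : K) x y, S x -> S y -> f (a *: x + y) = a *: f x + f y.

(* f need not respect products; its values outside S are irrelevant. *)
Definition twisting (S : set M) (f : M -> M) : Prop :=
  linear_on S f /\ set_bij S S f.

Definition eigenspace_in (S : set M) (f : M -> M) (mu : K) : set M :=
  [set x | S x /\ f x = mu *: x].

(* S is the direct sum of the eigenspaces of f in S: their sum is S (first
   clause) and is direct (second clause). *)
Definition diagonalizable_on (S : set M) (f : M -> M) : Prop :=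
  (forall x, S x -> exists (s : seq K) (y : K -> M),
      [/\ uniq s, forall mu, mu \in s -> eigenspace_in S f mu (y mu)
        & x = \sum_(mu <- s) y mu]) /\
  (forall (s : seq K) (y : K -> M), uniq s ->
      (forall mu, mu \in s -> eigenspace_in S f mu (y mu)) ->
      \sum_(mu <- s) y mu = 0 -> forall mu, mu \in s -> y mu = 0).

End LinearAlgebra.

(* Imposed next to diagonalizability in the converse direction, because the
   twist enters the order condition on [Delta, .]_(theta^2) only through its
   square, which does not see its sign. If D e_n = n e_n (n in Z), g e_n =
   e_(-n), A = DO^n = C + C g and theta is the identity on C and -1 on C g, then
   [D, A]_theta = 0 and [Delta, DO]_(theta^2) = 0 with theta diagonalizable,
   whereas [|D|, g]_theta = 2 |D| g is unbounded. Below, mu < 0 means that the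
   complex number mu is a negative real. *)
Definition no_negative_eigenvalue (K : numFieldType) (M : lmodType K)
    (S : set M) (f : M -> M) : Prop :=
  forall mu x, eigenspace_in S f mu x -> x <> 0 -> ~~ (mu < 0).

(* A filtered algebra of linear operators on V, with index monoid I (nat or R);
   the algebra itself is the union of the F i. *)
Section Filtered.
Context (K : fieldType) (V : lmodType K) (I : nmodType) (leI : rel I).

Definition filt_union (F : I -> set (V -> V)) : set (V -> V) :=
  [set X | exists i, F i X].

Record filtered_algebra (F : I -> set (V -> V)) : Prop := FilteredAlgebra {
  filt_linear : forall i X, F i X -> linear X ;
  filt_subspace : forall i, subspace (F i) ;
  filt_le : forall i j, leI i j -> F i `<=` F j ;
  filt_mul : forall i j X Y, F i X -> F j Y -> F (i + j) (X \o Y)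
}.

(* A twisting of a filtered algebra is a linear automorphism respecting the
   filtration. *)
Definition filtered_twisting (F : I -> set (V -> V))
    (f : (V -> V) -> (V -> V)) : Prop :=
  twisting (filt_union F) f /\ forall i, set_bij (F i) (F i) f.

Definition twisted_comm (f : (V -> V) -> (V -> V)) (X Y : V -> V) : V -> V :=
  (X \o Y) - (f Y \o X).

End Filtered.

Section Operators.
Context (R : realType) (H : hilbertSpace R).

Definition bounded_operator (T : H -> H) : Prop :=
  linear T /\ exists c : R, forall v, `|T v| <= c%:C * `|v|.

Definition compact_operator (T : H -> H) : Prop :=
  bounded_operator T /\ compact (closure (T @` [set v | `|v| <= 1])).

Definition adjoint_of (T S : H -> H) : Prop :=
  forall v w, inner H (T v) w = inner H v (S w).

Record star_algebra_of_operators (B : set (H -> H)) : Prop :=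
  StarAlgebraOfOperators {
  sao_bounded : forall T, B T -> bounded_operator T ;
  sao_subspace : subspace B ;
  sao_mul : forall S T, B S -> B T -> B (S \o T) ;
  sao_adj : forall T, B T -> exists2 S, B S & adjoint_of T S
}.

(* Partially defined operators; values outside the domain are irrelevant. *)
Record partial_operator := PartialOperator {
  dom : set H ;
  app :> H -> H
}.

Definition pid : partial_operator := PartialOperator setT id.

Definition padd (S T : partial_operator) : partial_operator :=
  PartialOperator (dom S `&` dom T) (fun v => S v + T v).

Definition pcomp (S T : partial_operator) : partial_operator :=
  PartialOperator [set v | dom T v /\ dom S (T v)] (fun v => S (T v)).

Definition ppow (T : partial_operator) (n : nat) : partial_operator :=
  iter n (fun S => pcomp S T) pid.

Definition linear_operator (T : partial_operator) : Prop :=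
  subspace (dom T) /\ linear_on (dom T) T.

(* T = T^* as partially defined operators, T being densely defined *)
Definition self_adjoint (T : partial_operator) : Prop :=
  dense (dom T) /\
  forall v w, (dom T v /\ T v = w) <->
              (forall u, dom T u -> inner H (T u) v = inner H u w).

Definition has_compact_resolvent (T : partial_operator) : Prop :=
  exists (z : R[i]) (K : H -> H), [/\ compact_operator K,
    forall v, dom T (K v) /\ T (K v) - z *: K v = v
  & forall v, dom T v -> K (T v - z *: v) = v].

(* w = f(T) v, for T self-adjoint with compact resolvent: H is then the Hilbert
   sum of the eigenspaces of T, and f(T) acts on the t-eigenspace as f t, so
   that w = f(T) v iff w and f t *: v have the same components along every
   t-eigenvector. *)
Definition is_fcalc (T : partial_operator) (f : R -> R[i]) (v w : H) : Prop :=
  forall (t : R) e, dom T e -> T e = t%:C *: e ->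
    inner H w e = f t * inner H v e.

Definition fcalc (T : partial_operator) (f : R -> R[i]) : partial_operator :=
  PartialOperator [set v | exists w, is_fcalc T f v w]
                  (fun v => xget 0 [set w | is_fcalc T f v w]).

Definition absop (T : partial_operator) : partial_operator :=
  fcalc T (fun t => `|t|%:C).

(* t ^ z for t > 0 *)
Definition cpow (t : R) (z : R[i]) : R[i] :=
  (expR (complex.Re z * ln t))%:C * (cos (complex.Im z * ln t) +i* sin (complex.Im z * ln t)).

Definition powop (T : partial_operator) (z : R[i]) : partial_operator :=
  fcalc T (fun t => cpow t z).

(* c is the bounded extension of T x - y T, where x is required to preserve the
   (dense) domain of T; with y = theta x this says c = [T, x]_theta. Asking only
   that {v in dom T | x v in dom T} be dense would be too weak: with T1, T2 two
   self-adjoint extensions of one symmetric operator (Dirichlet and Neumann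
   Laplacians), the swap of the two summands would commute with T1 + T2. *)
Definition is_twisted_commutator (T : partial_operator) (x y c : H -> H) :
    Prop :=
  bounded_operator c /\
  forall v, dom T v -> dom T (x v) /\ T (x v) - y (T v) = c v.

End Operators.

Section Involution.
Context (R : realType) (A : algType R[i]).

Record is_star (star : A -> A) : Prop := IsStar {
  star_linear : forall (c : R[i]) a b,
    star (c *: a + b) = Num.conj c *: star a + star b ;
  star_mul : forall a b, star (a * b) = star b * star a ;
  star_involutive : involutive star
}.

End Involution.

Record twistedSpectralTriple (R : realType) := TwistedSpectralTriple {
  tst_H : hilbertSpace R ;
  tst_A : algType R[i] ;
  tst_star : tst_A -> tst_A ;
  tst_theta : tst_A -> tst_A ;
  tst_rep : tst_A -> (tst_H -> tst_H) ;
  tst_D : partial_operator tst_H ;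
  tst_starP : is_star tst_star ;
  tst_thetaP : twisting setT tst_theta ;
  tst_rep_bounded : forall a, bounded_operator (tst_rep a) ;
  tst_rep_linear : linear tst_rep ;
  tst_rep_mul : forall a b, tst_rep (a * b) = tst_rep a \o tst_rep b ;
  tst_rep_one : tst_rep 1 = id ;
  tst_rep_star : forall a, adjoint_of (tst_rep a) (tst_rep (tst_star a)) ;
  tst_D_linear : linear_operator tst_D ;
  tst_D_self_adjoint : self_adjoint tst_D ;
  tst_D_compact_resolvent : has_compact_resolvent tst_D ;
  tst_D_commutator : forall a, exists c,
    is_twisted_commutator tst_D (tst_rep a) (tst_rep (tst_theta a)) c
}.

Section SmoothVectors.
Context (R : realType) (T : twistedSpectralTriple R).

Definition Delta : partial_operator (tst_H T) :=
  padd (pcomp (tst_D T) (tst_D T)) (pid (tst_H T)).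

Definition smooth : {pred tst_H T} :=
  fun v => `[< forall n, dom (ppow Delta n) v >].

Lemma linear_pcomp (S S' : partial_operator (tst_H T)) :
  linear_operator S -> linear_operator S' -> linear_operator (pcomp S S').
Proof.
move=> [[s0 sD] sL] [[s'0 s'D] s'L].
have S'0 : S' 0 = 0.
  by have := s'L 1 0 0 s'0 s'0; rewrite !scale1r addr0 => /eqP;
     rewrite -subr_eq0 opprD addrA subrr sub0r oppr_eq0 => /eqP.
split; [split|] => /=.
- by rewrite S'0.
- move=> a x y [x1 x2] [y1 y2]; split; first exact: s'D.
  by rewrite s'L//; exact: sD.
- by move=> a x y [x1 x2] [y1 y2] /=; rewrite s'L// sL.
Qed.

Lemma linear_padd (S S' : partial_operator (tst_H T)) :
  linear_operator S -> linear_operator S' -> linear_operator (padd S S').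
Proof.
move=> [[s0 sD] sL] [[s'0 s'D] s'L]; split; [split|] => /=.
- by [].
- by move=> a x y [x1 x2] [y1 y2]; split; [exact: sD|exact: s'D].
- move=> a x y [x1 x2] [y1 y2] /=; rewrite sL// s'L// scalerDr.
  by rewrite addrACA.
Qed.

Lemma linear_pid : linear_operator (pid (tst_H T)).
Proof. by []. Qed.

Lemma linear_Delta_pow n : linear_operator (ppow Delta n).
Proof.
elim: n => [|n IHn]; first exact: linear_pid.
apply: linear_pcomp => //; apply: linear_padd; last exact: linear_pid.
by apply: linear_pcomp; exact: tst_D_linear.
Qed.

Lemma smooth_submod_closed : submod_closed smooth.
Proof.
split.
  by apply/asboolP => n; have [[]] := linear_Delta_pow n.
move=> a x y /asboolP xs /asboolP ys; apply/asboolP => n.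
by have [[_ h] _] := linear_Delta_pow n; exact: h.
Qed.

HB.instance Definition _ := GRing.isSubmodClosed.Build _ _ smooth
  smooth_submod_closed.

(* H^oo, as a complex vector space *)
Record Hinf := MkHinf { hval : tst_H T ; _ : hval \in smooth }.

HB.instance Definition _ := [isSub for hval].
HB.instance Definition _ := [Choice of Hinf by <:].
HB.instance Definition _ := [SubChoice_isSubLmodule of Hinf by <:].

(* The restriction to H^oo of an operator preserving it. *)
Definition restr (S : partial_operator (tst_H T)) : Hinf -> Hinf :=
  fun v => insubd 0 (S (val v)).

(* Delta ^ z as an operator on H^oo *)
Definition Delta_pow (z : R[i]) : Hinf -> Hinf := restr (powop Delta z).

Definition sobolev_norm (s : R) (v : Hinf) : R[i] :=
  `|powop Delta (s / 2)%:C (val v)|.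

End SmoothVectors.

Section Calculi.
Context (R : realType) (T : twistedSpectralTriple R).

Let H := tst_H T.
Local Notation V := (Hinf T).

(* [D, A]_theta *)
Definition D_commutators : set (H -> H) :=
  [set c | exists a, is_twisted_commutator (tst_D T)
                       (tst_rep a) (tst_rep (tst_theta a)) c].

Definition regular : Prop :=
  exists (B : set (H -> H)) (thetaB : (H -> H) -> (H -> H)),
  [/\ star_algebra_of_operators B,
      range (@tst_rep R T) `<=` B,
      D_commutators `<=` B,
      twisting B thetaB /\
        forall a, thetaB (tst_rep a) = tst_rep (tst_theta a)
    & forall b, B b -> exists2 c, B c &
        is_twisted_commutator (absop (tst_D T)) b (thetaB b) c].

Definition is_restriction (S : H -> H) (X : V -> V) : Prop :=
  forall v, hval (X v) = S (hval v).

Definition contains_restrictions (E : set (V -> V)) (S : set (H -> H)) : Prop :=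
  forall U, S U -> exists2 X, E X & is_restriction U X.

Record diffop_algebra (DO : nat -> set (V -> V))
    (theta : (V -> V) -> (V -> V)) : Prop := DiffopAlgebra {
  do_filtered : filtered_algebra leq DO ;
  do_algebra : contains_restrictions (DO 0%N) (range (@tst_rep R T)) ;
  do_commutators : contains_restrictions (DO 0%N) D_commutators ;
  do_twisting : filtered_twisting DO theta ;
  do_extends : forall a X Y, is_restriction (tst_rep a) X ->
    is_restriction (tst_rep (tst_theta a)) Y -> theta X = Y ;
  do_elliptic : forall n X, DO n X -> exists2 c : R, 0 < c &
    forall v, `|hval (X v)| <= c%:C * sobolev_norm n%:R v ;
  do_Delta : forall n X, DO n X ->
    DO n.+1 (twisted_comm (theta \o theta) (restr (Delta T)) X)
}.

(* Extending to a bounded operator between the completions H^(s+t) and H^s of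
   H^oo means being bounded on H^oo for the corresponding norms. *)
Definition Op (t : R) : set (V -> V) :=
  [set X | linear X /\ forall s : R, exists c : R, forall v,
     sobolev_norm s (X v) <= c%:C * sobolev_norm (s + t) v].

Record psido_algebra (Psi : R -> set (V -> V))
    (Theta : R[i] -> (V -> V) -> (V -> V)) : Prop := PsidoAlgebra {
  psi_filtered : filtered_algebra <=%R Psi ;
  psi_Op : forall t, Psi t `<=` Op t ;
  psi_algebra : contains_restrictions (Psi 0) (range (@tst_rep R T)) ;
  psi_commutators : contains_restrictions (Psi 0) D_commutators ;
  psi_twisting : forall z, filtered_twisting Psi (Theta z) ;
  psi_group0 : forall X, filt_union Psi X -> Theta 0 X = X ;
  psi_groupD : forall z w X, filt_union Psi X ->
    Theta (z + w) X = Theta z (Theta w X) ;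
  psi_theta : forall a X Y, is_restriction (tst_rep a) X ->
    is_restriction (tst_rep (tst_theta a)) Y -> Psi (-1) (Y - Theta 1 X) ;
  psi_Delta_left : forall z X, filt_union Psi X ->
    filt_union Psi (Delta_pow z \o X) ;
  psi_Delta_right : forall z X, filt_union Psi X ->
    filt_union Psi (X \o Delta_pow z) ;
  psi_Delta_comm : forall z s X, Psi s X ->
    Psi (complex.Re z + s - 1) (twisted_comm (Theta z) (Delta_pow (z / 2)) X)
}.

End Calculi.

(* Main.v *)
Require Import Defs.
From mathcomp Require Import all_boot all_order all_algebra.
From mathcomp Require Import sesquilinear.
From mathcomp Require Import all_classical all_reals all_analysis.
From mathcomp Require Import complex ring lra.

(* Write L z for (1 + D^2)^(z/2) and Op^t for the operators of order t on the
   smooth vectors, and say that the order condition holds when A and [D, A]_theta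
   act by operators of order 0 and theta a - L 1 a L(-1) has order -1.

   The order condition implies everything else. Psi^t = Op^t with
   Theta^z = L z (.) L(-z) is a pseudodifferential algebra. A linear complement
   argument extends theta from A to all operators without changing it modulo
   Op^(-1), bijectively on every Op^t with t >= -1; this makes DO^n = Op^n an
   algebra of differential operators, and Op^0, closed up in the bounded operators
   of H, a *-algebra witnessing regularity.

   A regular triple satisfies it: |D| b = theta(b) |D| + delta(b) bounds b on the
   integral Sobolev spaces, the adjoint on the negative ones, and Heinz
   interpolation fills in the other exponents.

   For a diagonalizable DO, elliptic estimates and Delta X = theta^2(X) Delta + Y
   bound X on even Sobolev exponents of both signs. An eigenvector X, of eigenvalue
   mu, gives Z = L 1 X - mu X L 1 with L 1 Z + mu Z L 1 = Y of order 1, and such a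
   Sylvester equation forces Z to have order 0 unless mu is negative. *)

Set Implicit Arguments.
Unset Strict Implicit.
Unset Printing Implicit Defensive.

Import Order.TTheory GRing.Theory Num.Theory ComplexField.
Import Normc numFieldNormedType.Exports Defs.

Local Open Scope classical_set_scope.
Local Open Scope complex_scope.
Local Open Scope ring_scope.


(** * Hilbert spaces *)

(** The hypothesis on a differential algebra involves theta^2 and Delta, the order condition theta
    and a square root of Delta. Diagonalizability reduces this extraction of a root to scalars: on
    an eigenvector X the twisted commutator is L 2 X - mu^2 X L 2, a difference of squares. Its
    factors are X -> L 1 X - mu X L 1 and Z -> L 1 Z + mu Z L 1. Between eigenvectors of L 1 with
    eigenvalues s, t > 0 the latter multiplies by s + mu t, and |s + mu t|^2 = (s - |mu| t)^2 + 2
    (|mu| + Re mu) s t. This is the origin of the constant [2 * (normc mu + complex.Re mu)], which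
    vanishes exactly when mu is a real number <= 0. Entrywise division by s + mu t does not by
    itself control operator norms, hence the argument with a near-maximal vector. The calculus of
    [D] is phrased through components along eigenvectors, so their completeness has to come first;
    afterwards a domain question is the existence of a vector with prescribed components. *)

Section ComplexModulus.
Context (R : realType).
Implicit Types (z w : R[i]) (x : R).

Lemma normcE z : `|z| = (normc z)%:C. Proof. by []. Qed.

Lemma normc_ge0 z : 0 <= normc z.
Proof. by have := normr_ge0 z; rewrite normcE ler0c. Qed.

Lemma normc_real x : normc x%:C = `|x|.
Proof. by rewrite /normc /= expr0n /= addr0 sqrtr_sqr. Qed.

Lemma normc_conj z : normc z^* = normc z.
Proof. by case: z => a b; rewrite /normc /= sqrrN. Qed.

Lemma normc_sqr z : z * z^* = (normc z ^+ 2)%:C.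
Proof.
case: z => a b; rewrite /normc sqr_sqrtr ?addr_ge0 ?sqr_ge0//.
by apply/eqP; rewrite eq_complex /=; apply/andP; split; apply/eqP; ring.
Qed.

Lemma Re_le_normc z : complex.Re z <= normc z.
Proof.
case: z => a b; rewrite /normc /=; apply: (le_trans (ler_norm a)).
by rewrite -sqrtr_sqr ler_wsqrtr// lerDl sqr_ge0.
Qed.

Lemma conjR x : x%:C^* = x%:C.
Proof. exact: conjc_real. Qed.

Lemma conjcMr z x : (z * x%:C)^* = z^* * x%:C.
Proof. by case: z => a b; apply/eqP; rewrite eq_complex /= !mulr0; apply/andP; split; apply/eqP; ring. Qed.

Lemma conjcM z w : (z * w)^* = z^* * w^*.
Proof. by case: z w => a b [c d]; apply/eqP; rewrite eq_complex /=; apply/andP; split; apply/eqP; ring. Qed.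

Lemma conjcD z w : (z + w)^* = z^* + w^*.
Proof. by case: z w => a b [c d]; apply/eqP; rewrite eq_complex /=; apply/andP; split; apply/eqP; ring. Qed.

Lemma invcR x : (x%:C)^-1 = (x^-1)%:C.
Proof. by rewrite fmorphV. Qed.

End ComplexModulus.

Section HilbertBasics.
Context (R : realType) (H : hilbertSpace R).
Implicit Types (u v w : H) (a : R[i]).

(** The norm of a module over [R[i]] takes values in [R[i]]; its real part lives where [lra] and the
    order of [R] apply. *)
Definition nrm v : R := complex.Re `|v|.
Local Notation ip := (inner H).

Lemma nrmE v : `|v| = (nrm v)%:C.
Proof. by have := ger0_Im (normr_ge0 v); rewrite /nrm; case: `|v| => a b /= ->. Qed.

Lemma nrm_ge0 v : 0 <= nrm v.
Proof. by have := normr_ge0 v; rewrite nrmE ler0c. Qed.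

Lemma nrmD u v : nrm (u + v) <= nrm u + nrm v.
Proof. by have := ler_normD u v; rewrite !nrmE -rmorphD lecR. Qed.

Lemma nrmZ a v : nrm (a *: v) = normc a * nrm v.
Proof. by have := normrZ a v; rewrite !nrmE normcE -rmorphM; exact: complexI. Qed.

Lemma nrmN v : nrm (- v) = nrm v.
Proof. by rewrite /nrm normrN. Qed.

Lemma nrmB u v : nrm (u - v) = nrm (v - u).
Proof. by rewrite -nrmN opprB. Qed.

Lemma nrm0 : nrm 0 = 0 :> R.
Proof. by rewrite /nrm normr0. Qed.

Lemma nrm_eq0 v : nrm v = 0 -> v = 0.
Proof. by move=> h; apply/eqP; rewrite -normr_eq0 nrmE h. Qed.

Lemma ipC u v : ip u v = (ip v u)^*.
Proof. by rewrite hermC expr0 mul1r. Qed.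

Lemma ip_nrm v : ip v v = (nrm v ^+ 2)%:C.
Proof. by rewrite -innerE nrmE rmorphXn. Qed.

Lemma ipDl u v w : ip (u + v) w = ip u w + ip v w.
Proof. exact: linearDl. Qed.

Lemma ipDr u v w : ip u (v + w) = ip u v + ip u w.
Proof. exact: linearDr. Qed.

Lemma ipNl u v : ip (- u) v = - ip u v.
Proof. exact: linearNl. Qed.

Lemma ipNr u v : ip u (- v) = - ip u v.
Proof. exact: linearNr. Qed.

Lemma ipBl u v w : ip (u - v) w = ip u w - ip v w.
Proof. by rewrite ipDl ipNl. Qed.

Lemma ipBr u v w : ip u (v - w) = ip u v - ip u w.
Proof. by rewrite ipDr ipNr. Qed.

Lemma ipZl a u v : ip (a *: u) v = a * ip u v.
Proof. exact: linearZl_LR. Qed.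

Lemma ipZr a u v : ip u (a *: v) = a^* * ip u v.
Proof. exact: linearZr_LR. Qed.

Lemma ip0l v : ip 0 v = 0. Proof. exact: linear0l. Qed.
Lemma ip0r v : ip v 0 = 0. Proof. exact: linear0r. Qed.

Lemma ip_suml (I : Type) (s : seq I) (f : I -> H) v :
  ip (\sum_(i <- s) f i) v = \sum_(i <- s) ip (f i) v.
Proof. exact: linear_sumlz. Qed.

Lemma ip_sumr (I : Type) (s : seq I) (f : I -> H) v :
  ip v (\sum_(i <- s) f i) = \sum_(i <- s) ip v (f i).
Proof. exact: linear_sumr. Qed.

Lemma ip_total u : (forall v, ip u v = 0) -> u = 0.
Proof.
move=> /(_ u); rewrite ip_nrm => /complexI /eqP.
by rewrite sqrf_eq0 => /eqP /nrm_eq0.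
Qed.

Lemma ip_inj u v : (forall w, ip u w = ip v w) -> u = v.
Proof.
move=> h; apply/eqP; rewrite -subr_eq0; apply/eqP; apply: ip_total => w.
by rewrite ipBl h subrr.
Qed.

Lemma nrm_sqrB u v :
  nrm (u - v) ^+ 2 = nrm u ^+ 2 - 2 * complex.Re (ip u v) + nrm v ^+ 2.
Proof.
have := ip_nrm (u - v); rewrite ipBl !ipBr (ipC v u) !ip_nrm => /eqP.
case: (ip u v) => a b; rewrite eq_complex /= => /andP[/eqP <- _]; ring.
Qed.

(** Pythagoras for the component of [u] orthogonal to [v]; both Cauchy-Schwarz and the minimization
    in [projection] rest on it. *)
Lemma nrm_sqr_proj u v : nrm v != 0 ->
  nrm (u - (ip u v / (nrm v ^+ 2)%:C) *: v) ^+ 2 =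
  nrm u ^+ 2 - normc (ip u v) ^+ 2 / nrm v ^+ 2.
Proof.
move=> v0.
rewrite nrm_sqrB nrmZ ipZr invcR conjcMr mulrAC [_^* * _]mulrC.
rewrite normc_sqr -rmorphM /= normcM normc_real ger0_norm ?invr_ge0 ?sqr_ge0//.
by field.
Qed.

Lemma cauchy_schwarz u v : normc (ip u v) <= nrm u * nrm v.
Proof.
have [v0|v0] := eqVneq (nrm v) 0.
  by rewrite (nrm_eq0 v0) ip0r normc0 nrm0 mulr0.
have vp : 0 < nrm v by rewrite lt_def v0 nrm_ge0.
have := sqr_ge0 (nrm (u - (ip u v / (nrm v ^+ 2)%:C) *: v)).
rewrite nrm_sqr_proj// subr_ge0 -expr_div_n => e.
rewrite -ler_pdivrMr// -(ler_pXn2r (n := 2))// ?nnegrE ?nrm_ge0//.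
by rewrite divr_ge0 ?normc_ge0 ?nrm_ge0.
Qed.


Lemma bounded_nrm (T : H -> H) (c : R) :
  (forall v, `|T v| <= c%:C * `|v|) <-> (forall v, nrm (T v) <= c * nrm v).
Proof. by split=> h v; have := h v; rewrite !nrmE -rmorphM lecR. Qed.

Lemma bounded_pos (T : H -> H) : bounded_operator T ->
  exists2 c : R, 0 < c & forall v, nrm (T v) <= c * nrm v.
Proof.
move=> [_ [c /bounded_nrm h]]; exists (`|c| + 1); first by rewrite ltr_wpDl.
move=> v; apply: (le_trans (h v)); apply: ler_wpM2r; first exact: nrm_ge0.
by rewrite ler_wpDr// ler_norm.
Qed.

Definition ulim (x : nat -> H) (l : H) : Prop :=
  forall e : R, 0 < e -> exists N, forall n, (N <= n)%N -> nrm (x n - l) <= e.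

Definition ucauchy (x : nat -> H) : Prop :=
  forall e : R, 0 < e ->
    exists N, forall m n, (N <= m)%N -> (N <= n)%N -> nrm (x m - x n) <= e.

Lemma pos_complex (e : R[i]) : 0 < e -> exists2 r : R, 0 < r & e = r%:C.
Proof.
case: e => a b; rewrite ltcE /= => /andP[/eqP -> h].
by exists a.
Qed.

Lemma ucauchy_cvg x : ucauchy x -> exists l, ulim x l.
Proof.
move=> hx; have hc : cvgn x.
  apply/cauchy_cvgP/cauchy_exP => _ /pos_complex[r r0 ->].
  have r20 : 0 < r / 2 by rewrite divr_gt0.
  have [N hN] := hx _ r20.
  exists (x N); exists N => // n /= Nn; rewrite -ball_normE /= nrmE ltcR.
  by apply: (le_lt_trans (hN _ _ (leqnn N) Nn)); lra.
exists (lim (x @ \oo)) => e e0.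
have /cvgrPdist_le := hc; move/(_ e%:C); rewrite ltcR => /(_ e0)[N _ hN].
by exists N => n Nn; have := hN n Nn; rewrite /= nrmE lecR nrmB.
Qed.

End HilbertBasics.


(** * Orthogonal projection, Riesz representation, adjoints *)

Section Projection.
Context (R : realType) (H : hilbertSpace R).
Implicit Types (u v w : H) (a : R[i]).
Local Notation ip := (inner H).

Definition eps (n : nat) : R := n.+1%:R^-1.

Lemma eps_gt0 n : 0 < eps n. Proof. by rewrite invr_gt0. Qed.

Lemma eps_le m n : (m <= n)%N -> eps n <= eps m.
Proof. by move=> mn; rewrite lef_pV2 ?posrE// ler_nat. Qed.

Lemma eps_small (e : R) : 0 < e -> exists N, eps N <= e.
Proof.
move=> e0; exists (Num.truncn e^-1).
rewrite -[leRHS]invrK lef_pV2 ?posrE ?invr_gt0//.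
exact/ltW/truncnS_gt.
Qed.

(** The end of most limiting arguments below, where an estimate is known up to an error proportional
    to [e]. *)
Lemma le0_eps (x c : R) : 0 <= c -> (forall e, 0 < e -> x <= c * e) -> x <= 0.
Proof.
move=> c0 h; apply/ler_addgt0Pr => e e0; rewrite add0r.
have c1 : 0 < c + 1 by rewrite ltr_wpDl.
apply: (le_trans (h (e / (c + 1)) (divr_gt0 e0 c1))).
rewrite mulrCA ger_pMr// ler_pdivrMr// mul1r lerDl ler01//.
Qed.

(** [S] need not be closed, so [p] is only a limit of elements of [S], namely of a minimizing
    sequence for the distance to [x]. *)
Lemma projection (S : set H) (x : H) : subspace S ->
  exists p, (forall e : R, 0 < e -> exists2 s, S s & nrm (s - p) <= e) /\
    forall s, S s -> ip (x - p) s = 0.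
Proof.
move=> [S0 SL].
pose A := [set nrm (x - s) ^+ 2 | s in S].
have A0 : A !=set0 by exists (nrm (x - 0) ^+ 2); exists 0.
have lA : has_lbound A by exists 0 => _ [s _ <-]; exact: sqr_ge0.
have hA : has_inf A by [].
(* If [s] is within d^2 of the infimum, removing from x - s its component along s' cannot go below
   the infimum, so this component has length at most [d]. *)
have near_min (d : R) s s' : 0 <= d -> S s -> S s' ->
    nrm (x - s) ^+ 2 <= inf A + d ^+ 2 -> normc (ip (x - s) s') <= d * nrm s'.
  move=> d0 Ss Ss' hs.
  have [s'0|s'0] := eqVneq (nrm s') 0.
    by rewrite (nrm_eq0 s'0) ip0r normc0 nrm0 mulr0.
  have sp : 0 < nrm s' by rewrite lt_def s'0 nrm_ge0.
  have : inf A <= nrm ((x - s) - (ip (x - s) s' / (nrm s' ^+ 2)%:C) *: s') ^+ 2.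
    apply: ge_inf => //.
    exists ((ip (x - s) s' / (nrm s' ^+ 2)%:C) *: s' + s); first exact: SL.
    by rewrite opprD addrA addrAC.
  rewrite nrm_sqr_proj// => h.
  have e : (normc (ip (x - s) s') / nrm s') ^+ 2 <= d ^+ 2.
    by rewrite expr_div_n; move: h hs; lra.
  rewrite -ler_pdivrMr// -(ler_pXn2r (n := 2))// ?nnegrE//.
  by rewrite divr_ge0 ?normc_ge0 ?nrm_ge0.
have ex n : exists s, S s /\ nrm (x - s) ^+ 2 <= inf A + (eps n) ^+ 2.
  have [_ [s Ss <-] h] := @inf_adherent R A (eps n ^+ 2) (exprn_gt0 2 (eps_gt0 n)) hA.
  by exists s; split => //; exact: ltW.
have [s hs] := choice ex.
have Ss n : S (s n) by have [] := hs n.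
have SB u v : S u -> S v -> S (u - v).
  by move=> Su Sv; rewrite addrC -scaleN1r; exact: SL.
have near n t : S t -> normc (ip (x - s n) t) <= eps n * nrm t.
  by move=> St; apply: near_min => //; [exact/ltW/eps_gt0 | have [] := hs n].
(* s m - s n is the difference of x - s n and x - s m, both nearly orthogonal to it; this replaces
   the parallelogram law. *)
have dist m n : nrm (s m - s n) <= eps m + eps n.
  have [->|t0] := eqVneq (nrm (s m - s n)) 0.
    by rewrite addr_ge0// ltW ?eps_gt0.
  have tp : 0 < nrm (s m - s n) by rewrite lt_def t0 nrm_ge0.
  rewrite -(ler_pM2r tp) -expr2.
  have -> : nrm (s m - s n) ^+ 2 = normc (ip (s m - s n) (s m - s n)).
    by rewrite ip_nrm normc_real ger0_norm ?sqr_ge0.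
  have {1}-> : s m - s n = (x - s n) - (x - s m).
    by rewrite opprB [RHS]addrC addrA subrK.
  rewrite ipBl mulrDl addrC; apply: (le_trans (le_normcD _ _)).
  by rewrite normcN lerD// near//; exact: SB.
have [p hp] : exists p, ulim s p.
  apply: ucauchy_cvg => e e0.
  have [N hN] : exists N, eps N <= e / 2 by apply: eps_small; rewrite divr_gt0.
  exists N => m n Nm Nn; apply: (le_trans (dist m n)).
  have := eps_le Nm; have := eps_le Nn; lra.
exists p; split=> [e e0|t St].
  by have [N hN] := hp e e0; exists (s N) => //; exact: hN.
apply: eq0_normc; apply/eqP; rewrite eq_le normc_ge0 andbT.
apply: (@le0_eps _ (2 * nrm t)) => [|e e0]; first by rewrite mulr_ge0 ?nrm_ge0.
have [N hN] := hp e e0.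
have [N' hN'] := eps_small e0.
pose n := maxn N N'.
have -> : x - p = (x - s n) + (s n - p) by rewrite addrA subrK.
rewrite ipDl; apply: (le_trans (le_normcD _ _)).
have h1 := near n t St; have h2 := cauchy_schwarz (s n - p) t.
have h3 := hN n (leq_maxl _ _); have h4 := eps_le (leq_maxr N N').
have t0 := nrm_ge0 t; rewrite -/n in h4.
have := ler_wpM2r t0 h3; have := ler_wpM2r t0 (le_trans h4 hN'); lra.
Qed.

(** Take [x] with phi x = 1 and subtract its projection on the kernel. The remainder [y] is
    orthogonal to the kernel and phi y = 1, so y / |y|^2 represents [phi]. *)
Lemma riesz (phi : H -> R[i]) (c : R) :
  (forall a u v, phi (a *: u + v) = a * phi u + phi v) ->
  (forall v, normc (phi v) <= c * nrm v) ->
  exists u, forall v, phi v = ip v u.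
Proof.
move=> pL pc.
have p0 : phi 0 = 0 by have := pL (-1) 0 0; rewrite scaler0 addr0 mulN1r addNr.
have pD u v : phi (u + v) = phi u + phi v by rewrite -[u]scale1r pL mul1r scale1r.
have pZ a u : phi (a *: u) = a * phi u by rewrite -[a *: u]addr0 pL p0 addr0.
have pB u v : phi (u - v) = phi u - phi v by rewrite pD -scaleN1r pZ mulN1r.
have [/existsNP[x0 hx]|h0] := pselect (~ forall v, phi v = 0); last first.
  by exists 0 => v; rewrite ip0r; apply: contrapT => h; apply: h0 => /(_ v).
pose x := (phi x0)^-1 *: x0.
have px : phi x = 1 by rewrite pZ mulVf//; apply/eqP.
have sS : subspace [set v | phi v = 0].
  by split=> //= a u v hu hv; rewrite pL hu hv mulr0 addr0.
have [p [hp1 hp2]] := projection x sS.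
have pp : phi p = 0.
  apply: eq0_normc; apply/eqP; rewrite eq_le normc_ge0 andbT.
  apply: (@le0_eps _ `|c|) => // e e0.
  have [s /= s0 hs] := hp1 _ e0.
  have -> : phi p = - phi (s - p) by rewrite pB s0 sub0r opprK.
  rewrite normcN; apply: (le_trans (pc _)).
  apply: (le_trans (ler_wpM2r (nrm_ge0 _) (ler_norm c))).
  exact: ler_wpM2l.
pose y := x - p.
have py : phi y = 1 by rewrite pB px pp subr0.
have y0 : nrm y != 0.
  by apply/eqP => /nrm_eq0 y0; move: py; rewrite y0 p0 => /eqP; rewrite eq_sym oner_eq0.
exists ((nrm y ^+ 2)^-1%:C *: y) => v.
have h : ip y (v - phi v *: y) = 0.
  by apply: hp2; rewrite /= pB pZ py mulr1 subrr.
have -> : v = (v - phi v *: y) + phi v *: y by rewrite subrK.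
rewrite ipZr ipDl ipZl [ip (v - _) _]ipC h rmorph0 add0r ip_nrm conjR.
rewrite pD pB !pZ py mulr1 subrr add0r mulrCA -rmorphM mulVf ?mulr1//.
by rewrite sqrf_eq0.
Qed.

Lemma adjoint_exists (T : H -> H) : bounded_operator T ->
  exists2 S, bounded_operator S & adjoint_of T S.
Proof.
move=> bT; have [c c0 hc] := bounded_pos bT; have [lT _] := bT.
have ex w : exists u, forall v, ip (T v) w = ip v u.
  apply: (@riesz _ (c * nrm w)) => [a u v|v].
    by rewrite lT ipDl ipZl.
  apply: (le_trans (cauchy_schwarz _ _)); rewrite mulrAC.
  by apply: ler_wpM2r (hc v); exact: nrm_ge0.
have [S hS] := choice ex.
exists S; last by move=> v w; exact: hS.
split=> [a u v|].
  apply/eqP; rewrite -subr_eq0; apply/eqP; apply: ip_total => w.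
  rewrite ipBl ipDl ipZl ![ip (S _) _]ipC -!hS ipDr ipZr conjcD conjcM.
  by rewrite conjCK subrr.
exists c; apply/bounded_nrm => w.
have [->|S0] := eqVneq (nrm (S w)) 0.
  by rewrite mulr_ge0 ?nrm_ge0// ltW.
have Sp : 0 < nrm (S w) by rewrite lt_def S0 nrm_ge0.
rewrite -(ler_pM2r Sp) -expr2.
have -> : nrm (S w) ^+ 2 = normc (ip (S w) (S w)).
  by rewrite ip_nrm normc_real ger0_norm ?sqr_ge0.
rewrite -hS; apply: (le_trans (cauchy_schwarz _ _)).
by rewrite mulrAC; apply: ler_wpM2r (hc _); exact: nrm_ge0.
Qed.

End Projection.


(** * Completeness of the eigenvectors of [D] *)

Section Compactness.
Context (R : realType) (H : hilbertSpace R).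

(** A point approached at arbitrarily late times is all that the maximization in [eig_total]
    requires, so no subsequence is extracted. *)
Lemma compact_cluster (K : set H) (x : nat -> H) : compact K ->
  (forall n, K (x n)) ->
  exists y, forall (e : R) N, 0 < e -> exists2 n, (N <= n)%N & nrm (x n - y) <= e.
Proof.
move=> cK Kx.
have [|y [_ hy]] := cK (x @ \oo) _; first by exists 0%N => // n _; exact: Kx.
exists y => e N e0.
have /hy h : (x @ \oo) [set x n | n in [set n | (N <= n)%N]].
  by exists N => // n /= Nn; exists n.
have [_ [[n /= Nn <-]]] := h _ (nbhsx_ballx y _ (let e1 := (ltcR 0 e) in etrans e1 e0)).
rewrite -ball_normE /= nrmE ltcR nrmB => /ltW hn.
by exists n.
Qed.

End Compactness.

Section Spectral.
Context (R : realType) (H : hilbertSpace R) (D : partial_operator H).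
Context (linD : linear_operator D) (saD : self_adjoint D)
  (crD : has_compact_resolvent D).
Implicit Types (u v w e : H) (a z : R[i]) (t : R).
Local Notation ip := (inner H).

(** e = 0 is allowed, which makes each [eig t] stable under all scalars. *)
Definition eig t e : Prop := dom D e /\ D e = t%:C *: e.

Lemma dom0 : dom D 0. Proof. by have [[]] := linD. Qed.

Lemma dom_lin a u v : dom D u -> dom D v -> dom D (a *: u + v).
Proof. by have [[_ h] _] := linD; exact: h. Qed.

Lemma D_lin a u v : dom D u -> dom D v -> D (a *: u + v) = a *: D u + D v.
Proof. by have [_ h] := linD; exact: h. Qed.

Lemma D0 : D 0 = 0.
Proof.
by have := D_lin (-1) dom0 dom0; rewrite scaler0 addr0 scaleN1r addNr.
Qed.

Lemma domZ a u : dom D u -> dom D (a *: u).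
Proof. by move=> h; rewrite -[_ *: _]addr0; apply: dom_lin h dom0. Qed.

Lemma DZ a u : dom D u -> D (a *: u) = a *: D u.
Proof. by move=> h; rewrite -[X in D X]addr0 D_lin ?D0 ?addr0//; exact: dom0. Qed.

Lemma domD u v : dom D u -> dom D v -> dom D (u + v).
Proof. by move=> hu hv; rewrite -[u]scale1r; exact: dom_lin. Qed.

Lemma DD u v : dom D u -> dom D v -> D (u + v) = D u + D v.
Proof. by move=> hu hv; rewrite -{1}[u]scale1r D_lin ?scale1r. Qed.

Lemma D_sym u v : dom D u -> dom D v -> ip (D u) v = ip u (D v).
Proof. by move=> hu hv; have [_ h] := saD; apply: (h v (D v)).1. Qed.

Lemma D_adj v w : (forall u, dom D u -> ip (D u) v = ip u w) ->
  dom D v /\ D v = w.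
Proof. by move=> h; have [_ k] := saD; apply: (k v w).2. Qed.

Lemma eigZ t a e : eig t e -> eig t (a *: e).
Proof.
by move=> [h1 h2]; split; [exact: domZ|rewrite DZ// h2 !scalerA mulrC].
Qed.

Lemma eig_orth s t e f : eig s e -> eig t f -> s != t -> ip e f = 0.
Proof.
move=> [de De] [df Df] st; have := D_sym de df.
rewrite De Df ipZl ipZr conjR => /eqP.
rewrite -subr_eq0 -mulrBl mulf_eq0 => /orP[|/eqP//].
rewrite -rmorphB /= => /eqP /complexI /eqP; rewrite subr_eq0.
by rewrite (negbTE st).
Qed.

(* K is the compact resolvent and L its adjoint. If M, the orthogonal of all
   eigenvectors, is not 0 then L K, restricted to M, has an eigenvector v for
   zeta^2, zeta being the norm of K on M, and D preserves the span of v and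
   K v: it has an eigenvector there. *)
Theorem eig_total v : (forall t e, eig t e -> ip v e = 0) -> v = 0.
Proof.
have [z [K [[bK cK] K1 K2]]] := crD.
have [lK _] := bK.
have [c c0 Kc] := bounded_pos bK.
have [L bL KL] := adjoint_exists bK.
have [lL _] := bL.
have [c' c'0 Lc] := bounded_pos bL.
have K0 : K 0 = 0 by have := lK (-1) 0 0; rewrite scaler0 addr0 scaleN1r addNr.
have L0 : L 0 = 0 by have := lL (-1) 0 0; rewrite scaler0 addr0 scaleN1r addNr.
have KZ a u : K (a *: u) = a *: K u by rewrite -[X in K X]addr0 lK K0 addr0.
have L_scale a u : L (a *: u) = a *: L u by rewrite -[X in L X]addr0 lL L0 addr0.
have LB u w : L (u - w) = L u - L w by rewrite addrC -scaleN1r lL scaleN1r addrC.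
have KB u w : K (u - w) = K u - K w by rewrite addrC -scaleN1r lK scaleN1r addrC.
pose M := [set v | forall t e, eig t e -> ip v e = 0].
have MZ a u : M u -> M (a *: u).
  by move=> h t e /h h'; rewrite ipZl h' mulr0.
have MD u w : M u -> M w -> M (u + w).
  by move=> hu hw t e te; rewrite ipDl (hu _ _ te) (hw _ _ te) addr0.
have MK u : M u -> M (K u).
  move=> Mu t e te; have [de De] := te; have [dK DK] := K1 u.
  have := Mu _ _ te; rewrite -{1}DK ipBl D_sym// De ipZr conjR ipZl -mulrBl.
  move=> /eqP; rewrite mulf_eq0 => /orP[tz|/eqP//].
  (* If [z] equals the eigenvalue [t], then e = K 0 = 0. *)
  have := K2 _ de; rewrite De -scalerBl.
  by move/eqP: tz => ->; rewrite scale0r K0 => <-; rewrite ip0r.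
have Ke t e : eig t e -> K e = (t%:C - z)^-1 *: e.
  move=> [de De]; have := K2 _ de; rewrite De -scalerBl KZ => h.
  have [tz|tz] := eqVneq (t%:C - z) 0.
    by move: h; rewrite tz scale0r => <-; rewrite K0 scaler0.
  by rewrite -{2}h scalerA mulVf// scale1r.
have ML u : M u -> M (L u).
  move=> Mu t e te; rewrite ipC -KL (Ke _ _ te) ipZl [ip e u]ipC.
  by rewrite (Mu _ _ te) rmorph0 mulr0 rmorph0.
(* [L] is the resolvent at the conjugate of [z]. That [L w] lies in the domain uses self-adjointness
   and not just symmetry. *)
have domL w : dom D (L w) /\ D (L w) = w + z^* *: L w.
  apply: D_adj => u du; rewrite ipDr ipZr conjCK.
  have h : ip (D u - z *: u) (L w) = ip u w by rewrite -KL K2.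
  by rewrite -h ipBl ipZl subrK.
move=> Mv; apply: contrapT => v0.
have vp : 0 < nrm v.
  by rewrite lt_def nrm_ge0 andbT; apply/eqP => /nrm_eq0.
pose A := [set nrm (K u) | u in [set u | M u /\ nrm u <= 1]].
have MM0 : M 0 by move=> t e _; rewrite ip0l.
have hA : has_sup A.
  split; first by exists (nrm (K 0)); exists 0 => //=; rewrite nrm0.
  exists c => _ [u [_ u1] <-]; apply: (le_trans (Kc u)).
  by rewrite ger_pMr.
pose ze := sup A.
have Kze u : M u -> nrm (K u) <= ze * nrm u.
  move=> Mu; have [u0|u0] := eqVneq (nrm u) 0.
    by rewrite (nrm_eq0 u0) K0 nrm0 mulr0.
  have up : 0 < nrm u by rewrite lt_def u0 nrm_ge0.
  have : nrm (K ((nrm u)^-1%:C *: u)) <= ze.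
    apply: sup_upper_bound => //; exists ((nrm u)^-1%:C *: u) => //; split.
      exact: MZ.
    by rewrite nrmZ normc_real ger0_norm ?invr_ge0 ?nrm_ge0// mulVf.
  rewrite KZ nrmZ normc_real ger0_norm ?invr_ge0 ?nrm_ge0// mulrC.
  by rewrite ler_pdivrMr.
have zp : 0 < ze.
  have : 0 < nrm (K v).
    rewrite lt_def nrm_ge0 andbT; apply/eqP => /nrm_eq0 Kv0.
    by have [_] := K1 v; rewrite Kv0 D0 scaler0 subrr => /esym.
  by move=> /lt_le_trans/(_ (Kze _ Mv)); rewrite pmulr_lgt0.
have z2p : 0 < ze ^+ 2 by rewrite exprn_gt0.
have Lze u : M u -> nrm (L u) <= ze * nrm u.
  move=> Mu; have [u0|u0] := eqVneq (nrm (L u)) 0.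
    by rewrite u0 mulr_ge0 ?nrm_ge0// ltW.
  have up : 0 < nrm (L u) by rewrite lt_def u0 nrm_ge0.
  rewrite -(ler_pM2r up) -expr2.
  have -> : nrm (L u) ^+ 2 = normc (ip (L u) (L u)).
    by rewrite ip_nrm normc_real ger0_norm ?sqr_ge0.
  rewrite -KL; apply: (le_trans (cauchy_schwarz _ _)); rewrite mulrAC.
  by apply: ler_wpM2r (Kze _ (ML _ Mu)); exact: nrm_ge0.
have ex n : exists u, [/\ M u, nrm u <= 1 & ze - eps R n <= nrm (K u)].
  have [_ [u [Mu u1] <-] h] := sup_adherent (eps_gt0 R n) hA.
  by exists u; split => //; exact: ltW.
have [x hx] := choice ex.
have Mx n : M (x n) by have [] := hx n.
have x1 n : nrm (x n) <= 1 by have [] := hx n.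
have Kx n : ze - eps R n <= nrm (K (x n)) by have [] := hx n.
have [y hy] : exists y, forall (e : R) N, 0 < e ->
    exists2 n, (N <= n)%N & nrm (K (x n) - y) <= e.
  apply: (compact_cluster cK) => n; apply: subset_closure; exists (x n) => //=.
  by rewrite nrmE -[1]/(1%:C) lecR.
pose w := (ze ^+ 2)^-1%:C *: L y.
(* Expanding the square leaves at most ze^2 (ze^2 - |K x_n|^2), which is small because x_n nearly
   attains the norm [ze]. *)
have LKx n : nrm (L (K (x n)) - (ze ^+ 2)%:C *: x n) ^+ 2 <= 2 * ze ^+ 3 * eps R n.
  have Kz : nrm (K (x n)) <= ze.
    by apply: (le_trans (Kze _ (Mx n))); rewrite ger_pMr.
  rewrite nrm_sqrB nrmZ ipZr conjR normc_real ger0_norm ?sqr_ge0//.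
  have -> : ip (L (K (x n))) (x n) = (nrm (K (x n)) ^+ 2)%:C.
    by rewrite ipC -KL ip_nrm conjR.
  rewrite -rmorphM /=.
  have h1 : nrm (L (K (x n))) ^+ 2 <= (ze * nrm (K (x n))) ^+ 2.
    by rewrite ler_pXn2r ?nnegrE ?nrm_ge0 ?mulr_ge0 ?nrm_ge0 ?(ltW zp)// Lze//; exact: MK.
  have h2 : (ze ^+ 2 * nrm (x n)) ^+ 2 <= ze ^+ 4.
    rewrite exprMn -exprM ger_pMr ?exprn_gt0//.
    by rewrite exprn_ile1 ?nrm_ge0.
  have h3 : ze ^+ 2 - nrm (K (x n)) ^+ 2 <= 2 * ze * eps R n.
    have -> : ze ^+ 2 - nrm (K (x n)) ^+ 2 =
      (ze - nrm (K (x n))) * (ze + nrm (K (x n))) by ring.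
    have : (ze - nrm (K (x n))) * (ze + nrm (K (x n))) <=
           eps R n * (ze + nrm (K (x n))).
      apply: ler_wpM2r; first by rewrite addr_ge0 ?nrm_ge0// ltW.
      by move: (Kx n); lra.
    have := ler_wpM2l (ltW (eps_gt0 R n)) Kz; lra.
  have := ler_wpM2l (ltW z2p) h3.
  have e3 : ze ^+ 3 = ze * ze ^+ 2 by ring.
  have e4 : ze ^+ 4 = ze ^+ 2 * ze ^+ 2 by ring.
  move: h1 h2; rewrite exprMn e3 e4; set k := nrm (K _) ^+ 2.
  set q := ze ^+ 2; set E := eps R n; nra.
(* ze^2 x_n is close to L (K x_n), and the latter clusters at L y, so the maximizing sequence itself
   clusters at [w]. *)
have xw (e : R) N : 0 < e -> exists2 n, (N <= n)%N & nrm (x n - w) <= e /\ nrm (K (x n) - y) <= e.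
  move=> e0.
  pose d := Num.min e (ze ^+ 2 * e / 2 / c').
  have d0 : 0 < d by rewrite lt_min e0 !divr_gt0// mulr_gt0.
  pose g := (ze ^+ 2 * e / 2) ^+ 2.
  have g0 : 0 < g by rewrite exprn_gt0// divr_gt0// mulr_gt0.
  have z3 : 0 < 2 * ze ^+ 3 by rewrite mulr_gt0// exprn_gt0.
  have [N' hN'] := eps_small (divr_gt0 g0 z3).
  have [n nN hn] := hy _ (maxn N N') d0.
  exists n; first exact: leq_trans (leq_maxl _ _) nN.
  split; last by apply: (le_trans hn); rewrite /d ge_min lexx.
  have h1 : nrm (L (K (x n)) - (ze ^+ 2)%:C *: x n) <= ze ^+ 2 * e / 2.
    rewrite -(ler_pXn2r (n := 2))// ?nnegrE ?nrm_ge0//; last first.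
      by rewrite divr_ge0// mulr_ge0// ltW.
    apply: (le_trans (LKx n)).
    have := eps_le R (leq_trans (leq_maxr N N') nN).
    move=> /le_trans/(_ hN') /(ler_wpM2l (ltW z3)).
    by rewrite [X in _ <= X]mulrC divfK// lt0r_neq0.
  have h2 : nrm (L (K (x n)) - L y) <= ze ^+ 2 * e / 2.
    rewrite -LB; apply: (le_trans (Lc _)).
    rewrite mulrC -ler_pdivlMr//; apply: (le_trans hn).
    by rewrite /d ge_min lexx orbT.
  have -> : x n - w = (ze ^+ 2)^-1%:C *:
      (- (L (K (x n)) - (ze ^+ 2)%:C *: x n) + (L (K (x n)) - L y)).
    rewrite opprB addrA subrK scalerBr scalerA -rmorphM /= mulVf ?scale1r//.
    exact: lt0r_neq0.
  rewrite nrmZ normc_real ger0_norm ?invr_ge0 ?(ltW z2p)// mulrC ler_pdivrMr//.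
  apply: (le_trans (nrmD _ _)); rewrite nrmN; move: h1 h2; lra.
have Mw : M w.
  move=> t e te; apply: eq0_normc; apply/eqP; rewrite eq_le normc_ge0 andbT.
  apply: (@le0_eps _ _ (nrm e)) => [|d d0]; first exact: nrm_ge0.
  have [n _ [hn _]] := xw d 0%N d0.
  have -> : ip w e = - ip (x n - w) e by rewrite ipBl (Mx n _ _ te) sub0r opprK.
  rewrite normcN; apply: (le_trans (cauchy_schwarz _ _)); rewrite mulrC.
  by apply: ler_wpM2l hn; exact: nrm_ge0.
have Kw : K w = y.
  apply/eqP; rewrite -subr_eq0; apply/eqP; apply: nrm_eq0.
  apply/eqP; rewrite eq_le nrm_ge0 andbT.
  apply: (@le0_eps _ _ (c + 1)) => [|d d0]; first by rewrite addr_ge0// ltW.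
  have [n _ [h1 h2]] := xw d 0%N d0.
  have -> : K w - y = - K (x n - w) + (K (x n) - y) by rewrite KB opprB addrA subrK.
  apply: (le_trans (nrmD _ _)); rewrite nrmN.
  have := le_trans (Kc _) (ler_wpM2l (ltW c0) h1); move: h2; lra.
have LKw : L (K w) = (ze ^+ 2)%:C *: w.
  by rewrite Kw /w scalerA -rmorphM /= divff ?scale1r// lt0r_neq0.
have w0 : w <> 0.
  move=> w0; have y0 : y = 0 by rewrite -Kw w0 K0.
  have h4 : 0 < ze / 4 by rewrite divr_gt0.
  have [N hN] := eps_small h4.
  have [n nN] := hy _ N h4; rewrite y0 subr0.
  have := Kx n; have := le_trans (eps_le R nN) hN; lra.
clearbody w.
(* With z = a + i b, D - a maps w to X and X to r w, where r = q - b^2; symmetry gives r |w|^2 =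
   |X|^2, so r has a square root s. Then X + s w and X - s w satisfy the eigenvector equation for a
   + s and a - s; lying in [M], they vanish. *)
pose q := (ze ^+ 2)^-1; pose a := complex.Re z; pose b := complex.Im z.
pose u := K w.
have [dw Dw] : dom D w /\ D w = q%:C *: u + z^* *: w.
  have [d1 d2] := domL (K w); rewrite LKw in d1 d2.
  have e : w = q%:C *: ((ze ^+ 2)%:C *: w).
    by rewrite scalerA -rmorphM /= mulVf ?scale1r// lt0r_neq0.
  split; first by rewrite e; exact: domZ.
  by rewrite {1}e DZ// d2 scalerDr scalerA mulrC -scalerA -e.
have [du Du] : dom D u /\ D u = w + z *: u.
  by have [h1 h2] := K1 w; split => //; rewrite -[X in X + _]h2 subrK.
have Mu : M u by exact: MK.
pose zb := z^*.
have zE : z = 2 * a%:C - zb.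
  by rewrite /zb /a; case: (z) => ? ?; apply/eqP; rewrite eq_complex /=;
    apply/andP; split; apply/eqP; ring.
have bE : (b ^+ 2)%:C = - (zb - a%:C) ^+ 2.
  by rewrite /zb /a /b; case: (z) => ? ?; apply/eqP; rewrite eq_complex /=;
    apply/andP; split; apply/eqP; ring.
pose X := q%:C *: u + (zb - a%:C) *: w.
have DwX : D w = a%:C *: w + X.
  by apply: ip_inj => v'; rewrite Dw /X !(ipDl, ipZl) /zb; ring.
have [dX DX] : dom D X /\ D X = a%:C *: X + (q - b ^+ 2)%:C *: w.
  have du' := @domZ q%:C u du; have dw' := @domZ (zb - a%:C) w dw.
  split; first exact: (domD du' dw').
  rewrite /X DD// !DZ//.
  apply: ip_inj => v'; rewrite Du Dw -/zb /X !(ipDl, ipZl) rmorphB /= bE zE.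
  by ring.
pose r := q - b ^+ 2.
have Dw' : D w - a%:C *: w = X by rewrite DwX addrC addKr.
have DX' : D X - a%:C *: X = r%:C *: w by rewrite DX addrC addKr.
have r0 : 0 <= r.
  have : ip X X = (r * nrm w ^+ 2)%:C.
    rewrite -{2}Dw' ipBr ipZr conjR -D_sym// -ipZl -ipBl DX' ipZl ip_nrm.
    by rewrite -rmorphM.
  rewrite ip_nrm => /complexI h.
  have : 0 < nrm w ^+ 2.
    by rewrite exprn_gt0// lt_def nrm_ge0 andbT; apply/eqP => /nrm_eq0.
  by move=> hw; rewrite -(pmulr_lge0 _ hw) -h sqr_ge0.
pose s := Num.sqrt r.
have rs : r = s * s by rewrite -expr2 sqr_sqrtr.
have MX : M X by apply: MD; exact: MZ.
have selfM x' : M x' -> (exists t, eig t x') -> x' = 0.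
  move=> Mx' [t et]; apply: nrm_eq0; have := Mx' _ _ et.
  by rewrite ip_nrm => /complexI /eqP; rewrite sqrf_eq0 => /eqP.
have p0 : X + s%:C *: w = 0.
  apply: selfM; first by apply: MD => //; exact: MZ.
  exists (a + s); split; first exact: (domD dX (domZ _ dw)).
  rewrite (DD dX (domZ _ dw)) (DZ _ dw).
  apply: ip_inj => v'; rewrite DX DwX !(ipDl, ipZl) -/r rs rmorphM rmorphD /=.
  by ring.
have m0 : X + (- s)%:C *: w = 0.
  apply: selfM; first by apply: MD => //; exact: MZ.
  exists (a - s); split; first exact: (domD dX (domZ _ dw)).
  rewrite (DD dX (domZ _ dw)) (DZ _ dw).
  apply: ip_inj => v'; rewrite DX DwX !(ipDl, ipZl) -/r rs rmorphM rmorphB rmorphN /=.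
  by ring.
(* Subtracting the two vanishing combinations gives 2 s w = 0, hence s = 0. Then X = 0, and w is
   itself an eigenvector for a. *)
have sw : (2 * s)%:C *: w = 0.
  have -> : (2 * s)%:C *: w = X + s%:C *: w - (X + (- s)%:C *: w).
    by apply: ip_inj => v'; rewrite !(ipDl, ipNl, ipZl) rmorphN rmorphM /=; ring.
  by rewrite p0 m0 subrr.
move/eqP: sw; rewrite scaler_eq0 => /orP[/eqP/complexI/eqP|/eqP//].
rewrite mulf_eq0 pnatr_eq0 /= => /eqP s0.
apply: w0; apply: selfM => //; exists a; split=> //.
by rewrite DwX; move: p0; rewrite s0 scale0r addr0 => ->; rewrite addr0.
Qed.

End Spectral.


(** * Functional calculus of D *)

Section FunctionalCalculus.
Context (R : realType) (H : hilbertSpace R) (D : partial_operator H).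
Context (linD : linear_operator D) (saD : self_adjoint D)
  (crD : has_compact_resolvent D).
Implicit Types (u v w e : H) (a z : R[i]) (t : R) (f g : R -> R[i])
  (l : seq (R * H)).
Local Notation ip := (inner H).
Local Notation eig := (eig D).

Lemma eig_inj v w : (forall t e, eig t e -> ip v e = ip w e) -> v = w.
Proof.
move=> h; apply/eqP; rewrite -subr_eq0; apply/eqP.
by apply: (eig_total linD saD crD) => t e te; rewrite ipBl (h _ _ te) subrr.
Qed.

Lemma fcP f v w :
  is_fcalc D f v w <-> forall t e, eig t e -> ip w e = f t * ip v e.
Proof. by split=> h t e; [move=> [d De]|move=> d De]; exact: h. Qed.

Lemma fc_uniq f v w w' : is_fcalc D f v w -> is_fcalc D f v w' -> w = w'.
Proof.
move=> /fcP h /fcP h'; apply: eig_inj => t e te.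
by rewrite (h _ _ te) (h' _ _ te).
Qed.

Lemma fc_lin f a v v' w w' : is_fcalc D f v w -> is_fcalc D f v' w' ->
  is_fcalc D f (a *: v + v') (a *: w + w').
Proof.
move=> /fcP h /fcP h'; apply/fcP => t e te.
by rewrite !ipDl !ipZl (h _ _ te) (h' _ _ te) mulrDr mulrCA.
Qed.

Lemma fc_comp f g v w u : is_fcalc D f v w -> is_fcalc D g w u ->
  is_fcalc D (fun t => g t * f t) v u.
Proof.
move=> /fcP h /fcP h'; apply/fcP => t e te.
by rewrite (h' _ _ te) (h _ _ te) mulrA.
Qed.

(** Converse to [fc_comp] on the level of domains: a vector in the domains of f(D) and (g f)(D) is
    sent by f(D) into the domain of g(D). *)
Lemma fc_div f g v w u : is_fcalc D f v w ->
  is_fcalc D (fun t => g t * f t) v u -> is_fcalc D g w u.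
Proof.
move=> /fcP h /fcP h'; apply/fcP => t e te.
by rewrite (h' _ _ te) (h _ _ te) mulrA.
Qed.

Lemma fc_ext f g v w : f =1 g -> is_fcalc D f v w -> is_fcalc D g v w.
Proof. by move=> fg h t e d De; rewrite -fg; exact: h. Qed.

Lemma fc_add f g v w u : is_fcalc D f v w -> is_fcalc D g v u ->
  is_fcalc D (fun t => f t + g t) v (w + u).
Proof.
by move=> h h' t e d De; rewrite ipDl mulrDl (h _ _ d De) (h' _ _ d De).
Qed.

Lemma fc_scale f a v w : is_fcalc D f v w ->
  is_fcalc D (fun t => a * f t) v (a *: w).
Proof. by move=> h t e d De; rewrite ipZl -mulrA (h _ _ d De). Qed.

Lemma fc_one v : is_fcalc D (fun=> 1) v v.
Proof. by move=> t e _ _; rewrite mul1r. Qed.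

Lemma fc_eig f t e : eig t e -> is_fcalc D f e (f t *: e).
Proof.
move=> te; apply/fcP => s e' se; rewrite ipZl.
by have [->//|ts] := eqVneq t s; rewrite (eig_orth saD te se ts) !mulr0.
Qed.

(** f(D) applied to [comb (fun=> 1) l], for a list of eigenvalues paired with eigenvectors.
    Eigenvalues may repeat, and their eigenvectors need not be orthogonal or independent. *)
Definition comb f l : H := \sum_(p <- l) f p.1 *: p.2.

Definition eigs l : Prop := forall p, p \in l -> eig p.1 p.2.

Lemma fc_comb f l : eigs l -> is_fcalc D f (comb (fun=> 1) l) (comb f l).
Proof.
elim: l => [|p l IH] h.
  by rewrite /comb !big_nil => t e _ _; rewrite !ip0l mulr0.
rewrite /comb !big_cons scale1r -[X in is_fcalc _ _ (X + _)]scale1r.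
rewrite -[X in is_fcalc _ _ _ (X + _)]scale1r.
apply: fc_lin; first by apply: fc_eig; apply: h; rewrite mem_head.
by apply: IH => q ql; apply: h; rewrite inE ql orbT.
Qed.

Lemma ip_comb f g l l' : ip (comb f l) (comb g l') =
  \sum_(p <- l) \sum_(p' <- l') f p.1 * (g p'.1)^* * ip p.2 p'.2.
Proof.
rewrite ip_suml; apply: eq_bigr => p _; rewrite ipZl ip_sumr mulr_sumr.
by apply: eq_bigr => p' _; rewrite ipZr mulrA.
Qed.

(* The difference of the squared norms is that of a third combination, with
   coefficients sqrt(C^2 - |f|^2). *)
Lemma nrm_comb f (C : R) l : eigs l -> (forall t, normc (f t) <= C) ->
  nrm (comb f l) <= C * nrm (comb (fun=> 1) l).
Proof.
move=> el fC; have C0 : 0 <= C by apply: le_trans (fC 0); exact: normc_ge0.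
rewrite -(ler_pXn2r (n := 2))// ?nnegrE ?nrm_ge0 ?mulr_ge0 ?nrm_ge0//.
pose g t := (Num.sqrt (C ^+ 2 - normc (f t) ^+ 2))%:C.
have gg t : g t * (g t)^* = (C ^+ 2)%:C - f t * (f t)^*.
  rewrite conjR -rmorphM -expr2 /= sqr_sqrtr.
    by rewrite normc_sqr -rmorphB.
  by rewrite subr_ge0 ler_pXn2r// nnegrE ?normc_ge0.
have E : (C ^+ 2)%:C * ip (comb (fun=> 1) l) (comb (fun=> 1) l) -
    ip (comb f l) (comb f l) = ip (comb g l) (comb g l).
  rewrite !ip_comb mulr_sumr -sumrB; apply: eq_big_seq => p pl.
  rewrite mulr_sumr -sumrB; apply: eq_big_seq => p' pl'.
  have [pp|pp] := eqVneq p.1 p'.1.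
    by rewrite pp gg mulrBl rmorph1 !mul1r.
  by rewrite (eig_orth saD (el _ pl) (el _ pl') pp) !mulr0 subrr.
move: E; rewrite !ip_nrm -rmorphM -rmorphB => /complexI E.
by rewrite -subr_ge0 exprMn E sqr_ge0.
Qed.

Definition scale_comb a l : seq (R * H) := [seq (p.1, a *: p.2) | p <- l].

Lemma comb_lin f a l l' :
  comb f (scale_comb a l ++ l') = a *: comb f l + comb f l'.
Proof.
rewrite /comb big_cat /= big_map scaler_sumr; congr (_ + _).
by apply: eq_bigr => p _ /=; rewrite !scalerA mulrC.
Qed.

Lemma eigs_lin a l l' : eigs l -> eigs l' -> eigs (scale_comb a l ++ l').
Proof.
move=> h h' p; rewrite mem_cat => /orP[/mapP[q ql ->]|/h'//].
by apply: (eigZ linD); exact: h.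
Qed.

(** The projection of [v] on the closed span of the eigenvectors differs from [v] by a vector
    orthogonal to all of them, hence by 0. *)
Lemma comb_dense v (r : R) : 0 < r ->
  exists2 l, eigs l & nrm (v - comb (fun=> 1) l) <= r.
Proof.
move=> r0; pose S := [set x | exists2 l, eigs l & x = comb (fun=> 1) l].
have sS : subspace S.
  split; first by exists [::] => //; rewrite /comb big_nil.
  move=> a _ _ [l hl ->] [l' hl' ->]; exists (scale_comb a l ++ l').
    exact: eigs_lin.
  by rewrite comb_lin.
have [p [hp1 hp2]] := projection v sS.
have vp : v = p.
  apply: eig_inj => t e te; apply/eqP; rewrite -subr_eq0 -ipBl; apply/eqP.
  apply: hp2; exists [:: (t, e)]; first by move=> q; rewrite inE => /eqP ->.
  by rewrite /comb big_seq1 scale1r.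
by have [_ [l hl ->]] := hp1 r r0; rewrite nrmB vp; exists l.
Qed.

(** On finite combinations of eigenvectors f(D) is explicit and bounded by [nrm_comb]; the image,
    its components and the bound pass to the limit. *)
Lemma fc_bounded f (C : R) v : (forall t, normc (f t) <= C) ->
  exists2 w, is_fcalc D f v w & nrm w <= C * nrm v.
Proof.
move=> fC; have C0 : 0 <= C by apply: le_trans (fC 0); exact: normc_ge0.
have ex n : exists l, eigs l /\ nrm (v - comb (fun=> 1) l) <= eps R n.
  by have [l h1 h2] := comb_dense v (eps_gt0 R n); exists l.
have [l hl] := choice ex.
have el n : eigs (l n) by have [] := hl n.
pose x n := comb (fun=> 1) (l n); pose y n := comb f (l n).
have hx n : nrm (v - x n) <= eps R n by have [] := hl n.
have yB m n : nrm (y m - y n) <= C * nrm (x m - x n).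
  have E g : comb g (l m) - comb g (l n) = comb g (scale_comb (-1) (l n) ++ l m).
    by rewrite comb_lin scaleN1r addrC.
  by rewrite /y /x !E nrm_comb//; exact: eigs_lin.
have [w hw] : exists w, ulim y w.
  apply: ucauchy_cvg => d d0.
  have C2 : 0 < 2 * C + 1 by rewrite ltr_wpDl// mulr_ge0.
  have [N hN] := eps_small (divr_gt0 d0 C2).
  exists N => m n Nm Nn; apply: (le_trans (yB _ _)).
  have -> : x m - x n = (v - x n) - (v - x m) by rewrite opprB [RHS]addrC addrA subrK.
  apply: (@le_trans _ _ (C * (eps R n + eps R m))).
    apply: ler_wpM2l => //; apply: (le_trans (nrmD _ _)).
    by rewrite nrmN lerD.
  have := le_trans (eps_le R Nm) hN; have := le_trans (eps_le R Nn) hN.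
  move: hN; rewrite ler_pdivlMr// => hN; set en := eps R n; set em := eps R m.
  set q := d / _ => h1 h2.
  have qq : q * (2 * C + 1) = d by rewrite /q divfK// lt0r_neq0.
  have q0 : 0 <= q by rewrite /q ltW// divr_gt0.
  nra.
exists w.
  apply/fcP => t e te; apply/eqP; rewrite -subr_eq0; apply/eqP; apply: eq0_normc.
  apply/eqP; rewrite eq_le normc_ge0 andbT.
  apply: (@le0_eps _ _ (nrm e + C * nrm e)) => [|d d0].
    by rewrite addr_ge0 ?mulr_ge0 ?nrm_ge0.
  have [N hN] := hw _ d0; have [N' hN'] := eps_small d0.
  pose n := maxn N N'.
  have h1 : nrm (y n - w) <= d by apply: hN; rewrite leq_maxl.
  have h2 : nrm (v - x n) <= d.
    apply: (le_trans (hx n)); apply: le_trans hN'.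
    by apply: eps_le; rewrite leq_maxr.
  have -> : ip w e - f t * ip v e = - ip (y n - w) e - f t * ip (v - x n) e.
    have /fcP/(_ _ _ te) := fc_comb f (el n).
    by rewrite -/(x n) -/(y n) !ipBl => ->; ring.
  apply: (le_trans (le_normcD _ _)); rewrite !normcN normcM mulrDl.
  apply: lerD.
    by apply: (le_trans (cauchy_schwarz _ _)); rewrite mulrC; apply: ler_wpM2l h1; exact: nrm_ge0.
  rewrite -mulrA; apply: ler_pM => //; rewrite ?normc_ge0//.
  by apply: (le_trans (cauchy_schwarz _ _)); rewrite mulrC; apply: ler_wpM2l h2; exact: nrm_ge0.
rewrite -subr_le0; apply: (@le0_eps _ _ (1 + C)) => [|d d0].
  by rewrite addr_ge0.
have [N hN] := hw _ d0; have [N' hN'] := eps_small d0.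
pose n := maxn N N'.
have h1 : nrm (y n - w) <= d by apply: hN; rewrite leq_maxl.
have h2 : nrm (v - x n) <= d.
  apply: (le_trans (hx n)); apply: le_trans hN'.
  by apply: eps_le; rewrite leq_maxr.
have h3 : nrm w <= nrm (y n - w) + nrm (y n).
  by have := nrmD (- (y n - w)) (y n); rewrite nrmN opprB subrK.
have h4 : nrm (x n) <= nrm (v - x n) + nrm v.
  by have := nrmD (- (v - x n)) v; rewrite nrmN opprB subrK.
have := nrm_comb (el n) fC; rewrite -/(x n) -/(y n).
have := ler_wpM2l C0 (le_trans h4 (lerD h2 (lexx (nrm v)))); lra.
Qed.

(** The point is the domain: comparing components shows v = K (w - z v), so [v] is in the range of
    the resolvent. *)
Lemma fc_D v w : is_fcalc D (fun t => t%:C) v w <-> dom D v /\ D v = w.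
Proof.
split=> [/fcP h|[dv Dv]]; last first.
  apply/fcP => t e [de De].
  by rewrite -Dv (D_sym saD)// De ipZr conjR.
have [z [K [[bK _] K1 K2]]] := crD.
have [lK _] := bK.
have K0 : K 0 = 0 by have := lK (-1) 0 0; rewrite scaler0 addr0 scaleN1r addNr.
have [dK DK] := K1 (w - z *: v).
have vK : v = K (w - z *: v).
  apply: eig_inj => t e te; have [de De] := te.
  have E : ip (w - z *: v) e = (t%:C - z) * ip (K (w - z *: v)) e.
    by rewrite -{1}DK ipBl (D_sym saD)// De ipZr conjR ipZl mulrBl.
  have [tz|tz] := eqVneq (t%:C - z) 0.
    by have := K2 _ de; rewrite De -scalerBl tz scale0r K0 => <-; rewrite !ip0r.
  by apply: (mulfI tz); rewrite -E ipBl ipZl (h _ _ te) mulrBl.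
by split; [rewrite vK|rewrite {1}vK -[LHS](subrK (z *: v)) {2}vK DK subrK].
Qed.

(** f(D) is everywhere defined and bounded, and its adjoint is identified with the conjugate
    function by its components along eigenvectors. *)
Lemma fc_adjoint_bounded f (C : R) v w x y : (forall t, normc (f t) <= C) ->
  is_fcalc D f v w -> is_fcalc D (fun t => (f t)^*) x y -> ip w x = ip v y.
Proof.
move=> fC fvw fxy.
have ex u : exists u', is_fcalc D f u u' /\ nrm u' <= C * nrm u.
  by have [u' h1 h2] := fc_bounded u fC; exists u'.
have [G hG] := choice ex.
have bG : bounded_operator G.
  split=> [a u u'|].
    by apply: fc_uniq (hG _).1 _; apply: fc_lin; apply: (hG _).1.
  by exists C; apply/bounded_nrm => u; exact: (hG u).2.
have [G' _ GG] := adjoint_exists bG.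
have -> : w = G v by apply: fc_uniq fvw (hG v).1.
rewrite GG; congr (ip _ _).
apply: fc_uniq fxy; apply/fcP => t e te.
rewrite ipC -GG.
have -> : G e = f t *: e by apply: fc_uniq (hG e).1 _; exact: fc_eig.
by rewrite ipZl conjcM -ipC.
Qed.

End FunctionalCalculus.


(** * Complex powers and smooth vectors *)

Section ComplexPowers.
Context (R : realType).
Implicit Types (x t : R) (z w : R[i]).

Lemma inv2C : (2 : R[i])^-1 = (2^-1)%:C.
Proof. by rewrite fmorphV rmorph_nat. Qed.

Lemma cpowD x z w : cpow x (z + w) = cpow x z * cpow x w.
Proof.
case: z w => a b [c d]; rewrite /cpow /= !mulrDl expRD cosD sinD.
by apply/eqP; rewrite eq_complex /=; apply/andP; split; apply/eqP; ring.
Qed.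

Lemma cpow0 x : cpow x 0 = 1.
Proof.
rewrite /cpow /= !mul0r expR0 cos0 sin0.
by apply/eqP; rewrite eq_complex /= !mul1r !mul0r subr0 addr0 !eqxx.
Qed.

Lemma cpow_real x s : cpow x s%:C = (expR (s * ln x))%:C.
Proof.
rewrite /cpow /= mul0r cos0 sin0.
by apply/eqP; rewrite eq_complex /= !mulr0 !mul0r mulr1 subr0 addr0 !eqxx.
Qed.

Lemma cpow1 x : 0 < x -> cpow x 1 = x%:C.
Proof. by move=> x0; rewrite -[1]/(1%:C) cpow_real mul1r lnK. Qed.

Lemma normc_cpow x z : normc (cpow x z) = expR (complex.Re z * ln x).
Proof.
rewrite /cpow normcM normc_real ger0_norm ?expR_ge0//.
by rewrite /normc cos2Dsin2 sqrtr1 mulr1.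
Qed.

Lemma conj_cpow x z : (cpow x z)^* = cpow x z^*.
Proof.
case: z => a b; rewrite /cpow /= mulNr cosN sinN.
by apply/eqP; rewrite eq_complex /=; apply/andP; split; apply/eqP; ring.
Qed.

End ComplexPowers.

Section SmoothVectors.
Context (R : realType) (T : twistedSpectralTriple R).
Local Notation H := (tst_H T).
Local Notation V := (Hinf T).
Local Notation D := (tst_D T).
Local Notation F := (is_fcalc D).
Let linD := tst_D_linear T.
Let saD := tst_D_self_adjoint T.
Let crD := tst_D_compact_resolvent T.
Implicit Types (u v w e : H) (z : R[i]) (s t : R) (f g : R -> R[i]).

Lemma weight_gt0 t : 0 < 1 + t ^+ 2.
Proof. by rewrite ltr_wpDr// sqr_ge0. Qed.

Lemma weight_ge1 t : 1 <= 1 + t ^+ 2.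
Proof. by rewrite lerDl sqr_ge0. Qed.

(** The bounded function f / g is applied to [w]. Where [g] vanishes so does [f], so the convention
    x / 0 = 0 gives the right value. Domain inclusions and norm comparisons both come from here. *)
Lemma fc_dominated f g (C : R) v w : 0 <= C ->
  (forall t, normc (f t) <= C * normc (g t)) -> F g v w ->
  exists2 u, F f v u & nrm u <= C * nrm w.
Proof.
move=> C0 fg hv.
have [|u h1 h2] := fc_bounded linD saD crD (f := fun t => f t / g t) (C := C) w.
  move=> t; rewrite normcM normcV.
  have [->|g0] := eqVneq (g t) 0; first by rewrite normc0 invr0 mulr0.
  rewrite ler_pdivrMr// lt_def normc_ge0 andbT.
  by apply: contra g0 => /eqP /eq0_normc ->.
exists u => //; apply: fc_ext (fc_comp hv h1) => t /=.
have [g0|g0] := eqVneq (g t) 0; last by rewrite divfK.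
rewrite g0 mulr0; apply/esym/eq0_normc/eqP; rewrite eq_le normc_ge0 andbT.
by apply: (le_trans (fg t)); rewrite g0 normc0 mulr0.
Qed.

(** |t| <= 1 + t^2 puts [v] in the domain of [D]; since t * t is the symbol of Delta minus 1,
    [fc_div] then puts [D v] there. *)
Lemma fc_Delta v w :
  F (fun t => (1 + t ^+ 2)%:C) v w <-> dom (Delta T) v /\ Delta T v = w.
Proof.
split=> [h|[[[dv dDv] _] <-]].
  have [||u hu _] := fc_dominated (f := fun t => t%:C) (C := 1) _ _ h => //.
    move=> t; rewrite !normc_real mul1r (ger0_norm (ltW (weight_gt0 t))).
    by rewrite ler_norml; apply/andP; split; nra.
  have [dv Dv] := (fc_D linD saD crD _ _).1 hu.
  have h2 : F (fun t => t%:C * t%:C) v (w - v).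
    have /(fc_add h) := fc_scale (-1) (@fc_one _ _ D v); rewrite scaleN1r.
    by apply: fc_ext => t; rewrite mulN1r rmorphD rmorph1 rmorphXn /=; ring.
  have [du Du] := (fc_D linD saD crD _ _).1 (fc_div hu h2).
  by rewrite /= Dv Du subrK.
have h1 := (fc_D linD saD crD _ _).2 (conj dv erefl).
have h2 := (fc_D linD saD crD _ _).2 (conj dDv erefl).
apply: fc_ext (fc_add (fc_comp h1 h2) (@fc_one _ _ D v)) => t.
by rewrite rmorphD rmorph1 rmorphXn /=; ring.
Qed.

Lemma fc_ppow n v w : F (fun t => ((1 + t ^+ 2) ^+ n)%:C) v w <->
  dom (ppow (Delta T) n) v /\ ppow (Delta T) n v = w.
Proof.
elim: n v w => [|n IH] v w.
  split=> [h|[_ <-]]; last exact: fc_one.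
  split=> //=; apply: (fc_uniq linD saD crD) h.
  exact: (@fc_one _ _ D v).
(* [ppow] composes on the right, so the additional factor acts first. *)
have E : (fun t => ((1 + t ^+ 2) ^+ n.+1)%:C : R[i]) =
    (fun t => ((1 + t ^+ 2) ^+ n)%:C * (1 + t ^+ 2)%:C).
  by apply/funext => t; rewrite exprSr rmorphM.
rewrite E; split=> [h|[[h1 h2] h3]]; last first.
  have k1 := (fc_Delta _ _).2 (conj h1 erefl).
  exact: fc_comp k1 ((IH _ _).2 (conj h2 h3)).
have [||u hu _] := fc_dominated (f := fun t => (1 + t ^+ 2)%:C) (C := 1) _ _ h => //.
  move=> t; rewrite -rmorphM !normc_real mul1r /= normrM.
  rewrite ler_peMl// ger0_norm ?exprn_ge0 ?(ltW (weight_gt0 t))//.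
  by rewrite exprn_ege1// weight_ge1.
have [du Du] := (fc_Delta _ _).1 hu.
have [k1 k2] := (IH _ _).1 (fc_div hu h).
rewrite -Du in k1 k2; by split=> //; split.
Qed.

Lemma smoothP v : v \in smooth (T := T) <->
  forall n, exists w, F (fun t => ((1 + t ^+ 2) ^+ n)%:C) v w.
Proof.
split=> [/asboolP h n|h]; last first.
  by apply/asboolP => n; have [w /fc_ppow[]] := h n.
by exists (ppow (Delta T) n v); apply/fc_ppow.
Qed.

(** Polynomial growth in t, the class for which f(D) preserves the smooth vectors by [fc_smooth]. *)
Definition pbounded f : Prop :=
  exists n (C : R), forall t, normc (f t) <= C * (1 + t ^+ 2) ^+ n.

Lemma pboundedP f : pbounded f -> exists n (C : R), 0 <= C /\
  forall t, normc (f t) <= C * normc ((1 + t ^+ 2) ^+ n)%:C.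
Proof.
move=> [n [C h]]; exists n, `|C|; split=> // t.
rewrite normc_real (ger0_norm (exprn_ge0 n (ltW (weight_gt0 t)))).
apply: (le_trans (h t)); apply: ler_wpM2r; last exact: ler_norm.
by rewrite exprn_ge0 ?(ltW (weight_gt0 t)).
Qed.

Lemma pbounded_mul f g : pbounded f -> pbounded g ->
  pbounded (fun t => f t * g t).
Proof.
move=> [n [C h]] [m [C' h']]; exists (n + m)%N, (C * C') => t.
rewrite normcM exprD mulrACA.
by apply: ler_pM; rewrite ?normc_ge0.
Qed.

Lemma pbounded_conj f : pbounded f -> pbounded (fun t => (f t)^*).
Proof. by move=> [n [C h]]; exists n, C => t; rewrite normc_conj. Qed.

Lemma pbounded_bounded f (C : R) : (forall t, normc (f t) <= C) -> pbounded f.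
Proof. by move=> h; exists 0%N, C => t; rewrite expr0 mulr1. Qed.

Lemma pbounded_weight n : pbounded (fun t => ((1 + t ^+ 2) ^+ n)%:C).
Proof.
exists n, 1 => t.
by rewrite mul1r normc_real ger0_norm ?exprn_ge0 ?(ltW (weight_gt0 t)).
Qed.

Lemma fc_smooth f (v : V) : pbounded f ->
  exists w : V, F f (hval v) (hval w).
Proof.
move=> pf; have sv : hval v \in smooth (T := T) by case: v.
have ex g : pbounded g -> exists w, F g (hval v) w.
  move=> /pboundedP[n [C [C0 h]]].
  have [w hw] := (smoothP _).1 sv n.
  by have [u hu _] := fc_dominated C0 h hw; exists u.
have [w hw] := ex _ pf.
have sw : w \in smooth (T := T).
  apply/smoothP => n.
  have [u hu] := ex _ (pbounded_mul (pbounded_weight n) pf).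
  by exists u; apply: fc_div hw hu.
by exists (MkHinf sw).
Qed.

End SmoothVectors.

(** * Functional calculus and Sobolev norms on smooth vectors *)

Section SmoothCalculus.
Context (R : realType) (T : twistedSpectralTriple R).
Local Notation H := (tst_H T).
Local Notation V := (Hinf T).
Local Notation ip := (inner H).
Local Notation D := (tst_D T).
Local Notation F := (is_fcalc D).
Let linD := tst_D_linear T.
Let saD := tst_D_self_adjoint T.
Let crD := tst_D_compact_resolvent T.
Implicit Types (u e : H) (v w : V) (z : R[i]) (s t : R) (f g : R -> R[i]).

(* f(D) on the smooth vectors, for f polynomially bounded; otherwise possibly 0. *)
Definition fop f (v : V) : V := xget 0 [set w : V | F f (hval v) (hval w)].

Lemma fopP f v : pbounded f -> F f (hval v) (hval (fop f v)).
Proof.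
move=> pf; rewrite /fop; case: xgetP => [w -> //|h].
by have [w hw] := fc_smooth v pf; case: (h w).
Qed.

Lemma hval_inj : injective (@hval R T).
Proof. exact: val_inj. Qed.

Lemma fopE f v w : pbounded f -> F f (hval v) (hval w) -> fop f v = w.
Proof.
move=> pf h; apply: hval_inj.
by apply: (fc_uniq linD saD crD) h; exact: fopP.
Qed.

Lemma fopE_H f v u : pbounded f -> F f (hval v) u -> hval (fop f v) = u.
Proof. by move=> pf; apply: (fc_uniq linD saD crD); exact: fopP. Qed.

Lemma fop_linear f : pbounded f -> linear (fop f).
Proof. by move=> pf a v w; apply: fopE => //; apply: fc_lin; exact: fopP. Qed.

Lemma fop_comp f g v : pbounded f -> pbounded g ->
  fop f (fop g v) = fop (fun t => f t * g t) v.
Proof.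
move=> pf pg; apply/esym/fopE; first exact: pbounded_mul.
exact: fc_comp (fopP _ pg) (fopP _ pf).
Qed.

Lemma fop_one v : fop (fun=> 1) v = v.
Proof.
apply: fopE; last exact: fc_one.
by apply: (pbounded_bounded (C := 1)) => t; rewrite normc1.
Qed.

Lemma eig_smooth t e : eig D t e -> exists e' : V, hval e' = e.
Proof.
move=> te; have se : e \in smooth (T := T).
  by apply/smoothP => n; exists (((1 + t ^+ 2) ^+ n)%:C *: e); exact: (fc_eig saD).
by exists (MkHinf se).
Qed.

Definition ipV (v w : V) : R[i] := ip (hval v) (hval w).
Definition nV (v : V) : R := nrm (hval v).

(** Only [y] is smooth. Writing y = r(D) y' with [r] an inverse power of 1 + t^2 puts the growth of
    [f] on y': both [r] and r f are bounded, and the bounded case applies twice. *)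
Lemma fc_adjoint f (v w : H) (y : V) : pbounded f -> F f v w ->
  ip w (hval y) = ip v (hval (fop (fun t => (f t)^*) y)).
Proof.
move=> pf hv; have [n [C h]] := pf.
pose r t : R[i] := (((1 + t ^+ 2) ^+ n)^-1)%:C.
have w0 t : 0 < (1 + t ^+ 2) ^+ n by rewrite exprn_gt0// weight_gt0.
have r1 t : normc (r t) <= 1.
  rewrite normc_real ger0_norm ?invr_ge0 ?(ltW (w0 t))// invf_le1//.
  by rewrite exprn_ege1// weight_ge1.
pose y' := fop (fun t => ((1 + t ^+ 2) ^+ n)%:C) y.
have y'P : F r (hval y') (hval y).
  have h1 := fopP y (pbounded_weight R n); apply: (fc_div h1).
  apply: fc_ext (@fc_one _ _ D _) => t; rewrite /r -rmorphM /= mulVf//.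
  exact: lt0r_neq0.
have [u hu _] := fc_bounded linD saD crD w r1.
have -> : ip w (hval y) = ip u (hval y').
  apply/esym/(fc_adjoint_bounded linD saD crD r1 hu).
  by apply: fc_ext y'P => t; rewrite conjR.
have rf t : normc (r t * f t) <= C.
  rewrite normcM mulrC normc_real ger0_norm ?invr_ge0 ?(ltW (w0 t))//.
  by rewrite ler_pdivrMr.
apply: (fc_adjoint_bounded linD saD crD rf (fc_comp hv hu)).
apply: fc_ext (fc_comp y'P (fopP y (pbounded_conj pf))) => t.
by rewrite conjcM conjR mulrC.
Qed.

Lemma ipV_fop f v w : pbounded f -> ipV (fop f v) w = ipV v (fop (fun t => (f t)^*) w).
Proof. by move=> pf; apply: fc_adjoint => //; exact: fopP. Qed.

Lemma nV_fop_le f g (C : R) v : pbounded f -> pbounded g -> 0 <= C ->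
  (forall t, normc (f t) <= C * normc (g t)) -> nV (fop f v) <= C * nV (fop g v).
Proof.
move=> pf pg C0 h; have [u hu] := fc_dominated C0 h (fopP v pg).
by rewrite /nV (fopE_H pf hu).
Qed.

(** An eigenvector of Delta may mix the eigenvalues s and -s of [D]. It is fixed by the spectral
    projection c(D) on the s with 1 + s^2 = t, where the function f (1 + s^2) is the constant f
    t. *)
Lemma fc_Delta_calc f (v w : H) :
  is_fcalc (Delta T) f v w <-> F (fun t => f (1 + t ^+ 2)) v w.
Proof.
split=> h t e de De.
  have /fc_Delta[d1 d2] := fc_eig saD (fun t => (1 + t ^+ 2)%:C) (conj de De).
  exact: h d1 d2.
pose c s : R[i] := (1 + s ^+ 2 == t)%:R.
have c1 s : normc (c s) <= 1 by rewrite /c; case: eqP => _; rewrite ?normc1 ?normc0.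
have [w' hw _] := fc_bounded linD saD crD w c1.
have [v' hv _] := fc_bounded linD saD crD v c1.
have ce : F (fun s => (c s)^*) e e.
  have /fc_Delta k := conj de De.
  move=> s e' ds Ds; have := k _ _ ds Ds; rewrite ipZl /c => /eqP.
  rewrite -subr_eq0 -mulrBl mulf_eq0 => /orP[|/eqP ->]; last by rewrite mulr0.
  rewrite -rmorphB /= => /eqP /complexI /eqP; rewrite subr_eq0 eq_sym => /eqP ->.
  by rewrite eqxx rmorph1 mul1r.
rewrite -(fc_adjoint_bounded linD saD crD c1 hw ce).
rewrite -(fc_adjoint_bounded linD saD crD c1 hv ce) -ipZl; congr (ip _ _).
apply: (fc_uniq linD saD crD (fc_comp h hw)).
apply: fc_ext (fc_scale (f t) hv) => s.
by rewrite /c; case: eqP => [->|_]; rewrite ?mulr0 ?mul0r// mulr1 mul1r.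
Qed.

(* The symbol of L z = (1 + D^2)^(z/2); N s below is the norm of H^s. *)
Definition wt z t : R[i] := cpow (1 + t ^+ 2) (z / 2).

Definition L z : V -> V := fop (wt z).

Lemma normc_wt z t : normc (wt z t) = expR (complex.Re z / 2 * ln (1 + t ^+ 2)).
Proof.
rewrite /wt normc_cpow.
have -> // : complex.Re (z / 2) = complex.Re z / 2.
by case: z => a b; rewrite inv2C /= mulr0 subr0.
Qed.

Lemma ln_weight_ge0 t : 0 <= ln (1 + t ^+ 2).
Proof. by rewrite ln_ge0// weight_ge1. Qed.

Lemma pbounded_wt z : pbounded (wt z).
Proof.
pose n := (Num.truncn `|complex.Re z / 2|).+1.
exists n, 1 => t; rewrite normc_wt mul1r -[in leRHS](lnK (weight_gt0 t)).
rewrite -expRM_natl ler_expR; apply: ler_wpM2r; first exact: ln_weight_ge0.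
by apply: (le_trans (ler_norm _)); exact/ltW/truncnS_gt.
Qed.

Lemma wtD z z' t : wt z t * wt z' t = wt (z + z') t.
Proof. by rewrite /wt mulrDl cpowD. Qed.

Lemma wt_zero t : wt 0 t = 1.
Proof. by rewrite /wt mul0r cpow0. Qed.

Lemma L_comp z z' v : L z (L z' v) = L (z + z') v.
Proof.
rewrite /L fop_comp; [|exact: pbounded_wt|exact: pbounded_wt].
by congr (fop _ _); apply/funext => t; rewrite wtD.
Qed.

Lemma L_id v : L 0 v = v.
Proof. by rewrite /L -[RHS]fop_one; congr (fop _ _); apply/funext => t; rewrite wt_zero. Qed.

Lemma L_linear z : linear (L z).
Proof. exact/fop_linear/pbounded_wt. Qed.

Lemma L_fop f z v : pbounded f -> L z (fop f v) = fop f (L z v).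
Proof.
move=> pf; rewrite /L !fop_comp//; try exact: pbounded_wt.
by congr (fop _ _); apply/funext => t; rewrite mulrC.
Qed.

Definition N s v : R := nV (L s%:C v).

(** Norms only see the modulus of the symbol: imaginary powers of Delta are isometric. *)
Lemma nV_L z v : nV (L z v) = N (complex.Re z) v.
Proof.
have pz := pbounded_wt z; have pr := pbounded_wt (complex.Re z)%:C.
apply/eqP; rewrite eq_le; apply/andP; split; rewrite -[leRHS]mul1r;
  by apply: nV_fop_le => // t; rewrite !normc_wt mul1r.
Qed.

Lemma N_L s z v : N s (L z v) = N (s + complex.Re z) v.
Proof. by rewrite /N L_comp nV_L; congr (N _ _); case: z. Qed.

Lemma N_id v : N 0 v = nV v.
Proof. by rewrite /N L_id. Qed.

Lemma N_le s t v : s <= t -> N s v <= N t v.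
Proof.
move=> st; rewrite -[leRHS]mul1r; apply: nV_fop_le => //; try exact: pbounded_wt.
move=> x; rewrite !normc_wt mul1r ler_expR; apply: ler_wpM2r => /=.
  exact: ln_weight_ge0.
by rewrite ler_pM2r// invr_gt0.
Qed.

Lemma N_ge0 s v : 0 <= N s v. Proof. exact: nrm_ge0. Qed.

Lemma L_zero z : L z 0 = 0.
Proof. by have := L_linear z (-1) 0 0; rewrite scaler0 addr0 scaleN1r addNr. Qed.

Lemma L_scale z a v : L z (a *: v) = a *: L z v.
Proof. by rewrite -[a *: v]addr0 L_linear L_zero addr0. Qed.

Lemma L_add z v w : L z (v + w) = L z v + L z w.
Proof. by rewrite -[v]scale1r L_linear !scale1r. Qed.

Lemma N_add s v w : N s (v + w) <= N s v + N s w.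
Proof. by rewrite /N L_add; exact: nrmD. Qed.

Lemma N_scale s a v : N s (a *: v) = normc a * N s v.
Proof. by rewrite /N L_scale; exact: nrmZ. Qed.

Lemma N_opp s v : N s (- v) = N s v.
Proof. by rewrite -scaleN1r N_scale normcN normc1 mul1r. Qed.

Lemma ipV_L s v w : ipV (L s%:C v) w = ipV v (L s%:C w).
Proof.
rewrite /L ipV_fop; last exact: pbounded_wt.
congr (ipV _ (fop _ _)); apply/funext => t.
by rewrite /wt inv2C -rmorphM /= conj_cpow conjR.
Qed.

Lemma hval_powop z (v : V) : powop (Delta T) z (hval v) = hval (L (z * 2) v).
Proof.
rewrite /powop /fcalc /=; case: xgetP => [w -> /fc_Delta_calc h|h].
  by apply/esym/fopE_H; [exact: pbounded_wt|rewrite /wt mulfK ?pnatr_eq0].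
case: (h (hval (L (z * 2) v))); apply/fc_Delta_calc.
have := fopP v (pbounded_wt (z * 2)); rewrite {1}/wt mulfK ?pnatr_eq0//.
Qed.

Lemma sobolev_normE s v : sobolev_norm s v = (N s v)%:C.
Proof.
rewrite /sobolev_norm hval_powop nrmE /N /nV; congr (nrm (hval (L _ _)))%:C.
by rewrite rmorphM /= -inv2C divfK// pnatr_eq0.
Qed.

Lemma Delta_powE z : Delta_pow (T := T) (z / 2) = L z.
Proof.
apply/funext => v; rewrite /Delta_pow /restr hval_powop divfK ?pnatr_eq0//.
exact: valKd.
Qed.

Lemma restr_Delta : restr (Delta T) = L 2.
Proof.
apply/funext => v; rewrite /restr.
have -> : Delta T (hval v) = hval (L 2 v); last exact: valKd.
apply/esym/fopE_H; first exact: pbounded_wt.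
have sv : hval v \in smooth (T := T) by case: v.
have dv : dom (Delta T) (hval v).
  have /asboolP/(_ 1%N) := sv; by move=> [].
apply: fc_ext ((fc_Delta _ _).2 (conj dv erefl)) => t.
by rewrite /wt mulfV ?pnatr_eq0// cpow1 ?weight_gt0.
Qed.

End SmoothCalculus.


(** * Operators of finite order *)

Section LogConvex.
Context (R : realType).

Lemma bernoulli_ineq (x : R) n : 0 <= x -> 1 + n%:R * x <= (1 + x) ^+ n.
Proof.
move=> x0; elim: n => [|n IH]; first by rewrite mul0r addr0 expr0.
rewrite exprS; apply: (@le_trans _ _ ((1 + x) * (1 + n%:R * x))).
  have : 0 <= n%:R * (x * x) by rewrite !mulr_ge0.
  rewrite -natr1; lra.
by apply: ler_wpM2l IH; rewrite addr_ge0.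
Qed.

(** Log-convexity makes the ratios of consecutive terms nondecreasing, so a first ratio r > q would
    force growth like r^n, against the bound K q^n. *)
Lemma log_convex_le (y : nat -> R) (K q : R) : 0 <= q -> (forall n, 0 <= y n) ->
  (forall n, y n.+1 ^+ 2 <= y n * y n.+2) -> (forall n, y n <= K * q ^+ n) ->
  y 1%N <= q * y 0%N.
Proof.
move=> q0 y0 yc yK; rewrite leNgt; apply/negP => h.
have p1 : 0 < y 1%N by apply: le_lt_trans h; rewrite mulr_ge0.
have p0 : 0 < y 0%N.
  rewrite lt_def y0 andbT; apply/eqP => e0; have := yc 0%N.
  by rewrite e0 mul0r leNgt exprn_gt0.
pose r := y 1%N / y 0%N.
have qr : q < r by rewrite ltr_pdivlMr.
have r0 : 0 < r by rewrite divr_gt0.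
have st n : 0 < y n /\ r * y n <= y n.+1.
  elim: n => [|n [yn IH]]; first by rewrite /r divfK// lt0r_neq0.
  have yn1 : 0 < y n.+1 by apply: lt_le_trans IH; rewrite mulr_gt0.
  split=> //; rewrite -(ler_pM2l yn); apply: le_trans (yc n).
  rewrite mulrA [y n * r]mulrC expr2.
  by apply: ler_wpM2r => //; exact: ltW.
have ge n : r ^+ n * y 0%N <= y n.
  elim: n => [|n IH]; first by rewrite expr0 mul1r.
  rewrite exprS -mulrA; apply: le_trans (st n).2.
  by apply: ler_wpM2l IH; exact: ltW.
have qp : 0 < q.
  rewrite lt_def q0 andbT; apply/eqP => e0.
  by have := yK 1%N; rewrite e0 expr1 mulr0 leNgt p1.
pose x := r / q - 1.
have x0 : 0 < x by rewrite subr_gt0 ltr_pdivlMr// mul1r.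
(* (r / q)^n = (1 + x)^n exceeds n x by Bernoulli, so [K] would bound all multiples of a positive
   number. *)
have bd n : n%:R * x * y 0%N <= K.
  have qn : 0 < q ^+ n by rewrite exprn_gt0.
  have := le_trans (ge n) (yK n).
  have -> : r ^+ n = (1 + x) ^+ n * q ^+ n.
    by rewrite /x addrC subrK [X in _ = X * _]expr_div_n divfK// lt0r_neq0.
  rewrite mulrAC ler_pM2r// => /(le_trans _); apply.
  apply: ler_wpM2r; first exact: ltW.
  by apply: le_trans (bernoulli_ineq n (ltW x0)); rewrite lerDr.
have xy : 0 < x * y 0%N by rewrite mulr_gt0.
have := bd (Num.truncn (K / (x * y 0%N))).+1.
by rewrite -mulrA -ler_pdivlMr// leNgt truncnS_gt.
Qed.

End LogConvex.

(** * Extension of operators from smooth vectors to H *)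

Section BoundedExtension.
Context (R : realType) (T : twistedSpectralTriple R).
Local Notation H := (tst_H T).
Local Notation V := (Hinf T).
Local Notation ip := (inner H).
Let linD := tst_D_linear T.
Let saD := tst_D_self_adjoint T.
Let crD := tst_D_compact_resolvent T.

Lemma smooth_dense (x : H) (e : R) : 0 < e ->
  exists v : V, nrm (x - hval v) <= e.
Proof.
move=> e0; have [l hl h] := comb_dense linD saD crD x e0.
suff [v hv] : exists v : V, hval v = comb (fun=> 1) l by exists v; rewrite hv.
elim: l hl {h} => [|p l IH] hl; first by exists 0; rewrite /comb big_nil.
have [w hw] := IH (fun q (ql : q \in l) => hl q (mem_behead (s := p :: l) ql)).
have [e' he] := eig_smooth (hl p (mem_head p l)).
by exists (e' + w); rewrite /comb big_cons scale1r -he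
  -[X in _ = _ + X]/(comb (fun=> 1) l) -hw.
Qed.

Lemma extend_bounded (X : V -> V) (c : R) : linear X ->
  (forall v, nV (X v) <= c * nV v) ->
  exists2 b, bounded_operator b & is_restriction b X.
Proof.
move=> lX hc.
have XB v w : hval (X v) - hval (X w) = hval (X (v - w)).
  have -> : v - w = (-1) *: w + v by rewrite scaleN1r addrC.
  by rewrite lX scaleN1r addrC.
have {}hc v : nV (X v) <= `|c| * nV v.
  apply: (le_trans (hc v)); apply: ler_wpM2r; [exact: nrm_ge0|exact: ler_norm].
have hB v w : nrm (hval (X v) - hval (X w)) <= `|c| * nrm (hval v - hval w).
  by rewrite XB; exact: hc.
move: `|c| (normr_ge0 c) hc hB => {}c c0 hc hB.
(* [P x y] says that [y] is the value of the extension at [x]. It mentions no approximating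
   sequence: existence comes from completeness, uniqueness and linearity from density. *)
pose P x y := forall v, nrm (y - hval (X v)) <= c * nrm (x - hval v).
have ex x : exists y, P x y.
  have ex n : exists v : V, nrm (x - hval v) <= eps R n.
    exact/smooth_dense/eps_gt0.
  have [s hs] := choice ex.
  have [y hy] : exists y, ulim (fun n => hval (X (s n))) y.
    apply: ucauchy_cvg => e e0.
    have C2 : 0 < 2 * c + 1 by rewrite ltr_wpDl// mulr_ge0.
    have [N hN] := eps_small (divr_gt0 e0 C2).
    exists N => m n Nm Nn; apply: (le_trans (hB _ _)).
    have -> : hval (s m) - hval (s n) = (x - hval (s n)) - (x - hval (s m)).
      by rewrite opprB [RHS]addrC addrA subrK.
    apply: (@le_trans _ _ (c * (eps R n + eps R m))).
      apply: ler_wpM2l => //; apply: (le_trans (nrmD _ _)).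
      by rewrite nrmN lerD.
    have h1 := le_trans (eps_le R Nm) hN; have h2 := le_trans (eps_le R Nn) hN.
    have q0 : 0 <= e / (2 * c + 1) by rewrite ltW// divr_gt0.
    apply: (@le_trans _ _ (c * (e / (2 * c + 1) + e / (2 * c + 1)))).
      by apply: ler_wpM2l => //; exact: lerD.
    have qq : e / (2 * c + 1) * (2 * c + 1) = e by rewrite divfK// lt0r_neq0.
    lra.
  exists y => v; rewrite -subr_le0.
  apply: (@le0_eps _ _ (1 + c)) => [|e e0]; first by rewrite addr_ge0.
  have [N hN] := hy _ e0; have [N' hN'] := eps_small e0.
  pose n := maxn N N'.
  have h1 : nrm (hval (X (s n)) - y) <= e by apply: hN; rewrite leq_maxl.
  have h2 : nrm (x - hval (s n)) <= e.
    apply: (le_trans (hs n)); apply: le_trans hN'.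
    by apply: eps_le; rewrite leq_maxr.
  have h3 : nrm (y - hval (X v)) <=
      nrm (hval (X (s n)) - y) + nrm (hval (X (s n)) - hval (X v)).
    have := nrmD (- (hval (X (s n)) - y)) (hval (X (s n)) - hval (X v)).
    by rewrite nrmN opprB addrA subrK.
  have h4 : nrm (hval (s n) - hval v) <= nrm (x - hval (s n)) + nrm (x - hval v).
    have := nrmD (- (x - hval (s n))) (x - hval v).
    by rewrite nrmN opprB addrA subrK.
  have := le_trans (hB (s n) v) (ler_wpM2l c0 (le_trans h4 (lerD h2 (lexx _)))).
  lra.
have [b hb] := choice ex.
have uniq x y y' : P x y -> P x y' -> y = y'.
  move=> h h'; apply/eqP; rewrite -subr_eq0; apply/eqP; apply: nrm_eq0.
  apply/eqP; rewrite eq_le nrm_ge0 andbT.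
  apply: (@le0_eps _ _ (2 * c)) => [|e e0]; first by rewrite mulr_ge0.
  have [v hv] := smooth_dense x e0.
  have := nrmD (y - hval (X v)) (- (y' - hval (X v))).
  rewrite nrmN opprB addrA subrK.
  have := ler_wpM2l c0 hv; have := h v; have := h' v; lra.
exists b; last first.
  by move=> v; apply: (uniq (hval v)) (hb _) => w; exact: hB.
split=> [a x x'|].
  apply: (uniq (a *: x + x')); first exact: hb.
  move=> w; rewrite -subr_le0.
  apply: (@le0_eps _ _ (2 * c * (normc a + 1))) => [|e e0].
    by rewrite !mulr_ge0 ?addr_ge0 ?normc_ge0.
  have [v hv] := smooth_dense x e0; have [v' hv'] := smooth_dense x' e0.
  have h1 : nrm (a *: b x + b x' - hval (X w)) <=
      normc a * (c * e) + c * e + nrm (hval (X (a *: v + v')) - hval (X w)).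
    have -> : a *: b x + b x' - hval (X w) =
        a *: (b x - hval (X v)) + (b x' - hval (X v')) +
        (hval (X (a *: v + v')) - hval (X w)).
      by rewrite lX; apply: ip_inj => u; rewrite !(ipDl, ipNl, ipZl); ring.
    apply: (le_trans (nrmD _ _)); apply: lerD => //.
    apply: (le_trans (nrmD _ _)); rewrite nrmZ; apply: lerD.
      apply: ler_wpM2l; first exact: normc_ge0.
      by apply: (le_trans (hb _ _)); exact: ler_wpM2l.
    by apply: (le_trans (hb _ _)); exact: ler_wpM2l.
  have h2 : nrm (hval (a *: v + v') - hval w) <=
      normc a * e + e + nrm (a *: x + x' - hval w).
    have -> : hval (a *: v + v') - hval w =
        - (a *: (x - hval v) + (x' - hval v')) + (a *: x + x' - hval w).
      by apply: ip_inj => u; rewrite !(ipDl, ipNl, ipZl); ring.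
    apply: (le_trans (nrmD _ _)); apply: lerD => //; rewrite nrmN.
    apply: (le_trans (nrmD _ _)); rewrite nrmZ; apply: lerD => //.
    by apply: ler_wpM2l => //; exact: normc_ge0.
  have := ler_wpM2l c0 h2; have := hB (a *: v + v') w; move: h1.
  set n1 := nrm _; set n2 := nrm _; set n3 := nrm _; set n4 := nrm _.
  lra.
exists c; apply/bounded_nrm => x; rewrite -subr_le0.
apply: (@le0_eps _ _ (2 * c)) => [|e e0]; first by rewrite mulr_ge0.
have [v hv] := smooth_dense x e0.
have := nrmD (b x - hval (X v)) (hval (X v)); rewrite subrK.
have := nrmD (- (x - hval v)) x; rewrite nrmN opprB subrK => h1.
have := ler_wpM2l c0 hv; have := hb x v; have := hc v; rewrite /nV.
have := ler_wpM2l c0 h1; lra.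
Qed.

Lemma smooth_total (x y : H) :
  (forall v : V, ip x (hval v) = ip y (hval v)) -> x = y.
Proof.
move=> h; apply: (eig_inj linD saD crD) => t e te.
by have [e' <-] := eig_smooth te.
Qed.

Lemma restriction_inj (b b' : H -> H) (X : V -> V) :
  bounded_operator b -> bounded_operator b' ->
  is_restriction b X -> is_restriction b' X -> b = b'.
Proof.
move=> bb bb' rb rb'; apply/funext => x.
have [B _ hB] := adjoint_exists bb; have [B' _ hB'] := adjoint_exists bb'.
apply: ip_inj => w; rewrite hB hB'; congr (ip _ _); apply: smooth_total => v.
by rewrite ipC -hB -rb rb' hB' -ipC.
Qed.

End BoundedExtension.


(** * Duality and Heinz interpolation on the Sobolev scale *)

Section Duality.
Context (R : realType) (T : twistedSpectralTriple R).
Local Notation H := (tst_H T).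
Local Notation V := (Hinf T).
Local Notation ip := (inner H).
Local Notation D := (tst_D T).
Local Notation Ls s := (L (T := T) s%:C).
Let saD := tst_D_self_adjoint T.
Implicit Types (X Y : V -> V) (v w : V) (s t : R).

Definition adjV X Y : Prop := forall v w, ipV (X v) w = ipV v (Y w).

Definition sob_bounded t X s : Prop :=
  exists2 c : R, 0 <= c & forall v, N s (X v) <= c * N (s + t) v.

Lemma ipVC v w : ipV v w = (ipV w v)^*.
Proof. exact: ipC. Qed.

Lemma ipV_nV v : ipV v v = (nV v ^+ 2)%:C.
Proof. exact: ip_nrm. Qed.

Lemma Ls_comp s t v : Ls s (Ls t v) = Ls (s + t) v.
Proof. by rewrite L_comp rmorphD. Qed.

Lemma Ls_id v : Ls 0 v = v.
Proof. exact: L_id. Qed.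

Lemma N_Ls s t v : N s (Ls t v) = N (s + t) v.
Proof. exact: N_L. Qed.

Lemma L_even n t : wt (2 * n%:R)%:C t = ((1 + t ^+ 2) ^+ n)%:C :> R[i].
Proof.
rewrite /wt inv2C -rmorphM cpow_real /=.
have -> : 2 * n%:R * 2^-1 = n%:R :> R by field.
by rewrite expRM_natl lnK// posrE weight_gt0.
Qed.

Lemma L_eigen n t (v : V) : eig D t (hval v) ->
  Ls (2 * n%:R) v = ((1 + t ^+ 2) ^+ n)%:C *: v.
Proof.
move=> tv; apply: fopE; first exact: pbounded_wt.
by rewrite -L_even; exact: (fc_eig saD).
Qed.

(* The adjoint b of the extension of X to H preserves the smooth vectors, since
   (1 + D^2)^n b w = b_n (1 + D^2)^n w, where b_n is the adjoint of the
   extension of (1 + D^2)^-n X (1 + D^2)^n. *)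
Lemma dual_exists X : linear X ->
  (forall n : nat, sob_bounded 0 X (- (2 * n%:R))) ->
  exists2 Y, linear Y & adjV X Y.
Proof.
move=> lX bX.
have ext n : exists2 b, bounded_operator b &
    is_restriction b (fun v => Ls (- (2 * n%:R)) (X (Ls (2 * n%:R) v))).
  have [c c0 hc] := bX n; apply: (@extend_bounded _ _ _ c).
    by move=> a v w; rewrite L_linear lX L_linear.
  move=> v; rewrite -/(N (- (2 * n%:R)) _); apply: (le_trans (hc _)).
  by rewrite N_Ls addr0 addNr N_id.
have [b bb rb] := ext 0%N.
have {}rb v : hval (X v) = b (hval v).
  by rewrite -rb mulr0 oppr0 !Ls_id.
have [b' bb' bA] := adjoint_exists bb.
have sm (w : V) : b' (hval w) \in smooth (T := T).
  apply/smoothP => n; have [bn bbn rbn] := ext n.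
  have [bn' _ bnA] := adjoint_exists bbn.
  exists (bn' (hval (Ls (2 * n%:R) w))); apply/fcP => t e te.
  have [e' he] := eig_smooth te; rewrite -he in te *.
  rewrite ipC -bnA -rbn [ip (b' _) _]ipC -bA -rb -/(ipV _ _) -/(ipV _ _).
  rewrite ipV_L Ls_comp addNr Ls_id (L_eigen n te).
  have XZ a v : X (a *: v) = a *: X v.
    have X0 : X 0 = 0 by have := lX (-1) 0 0; rewrite scaler0 addr0 scaleN1r addNr.
    by rewrite -[a *: v]addr0 lX X0 addr0.
  rewrite XZ -[ipV (_ *: _) _]/(ip (_ *: hval (X e')) (hval w)) ipZl.
  by rewrite conjcM conjR.
pose Y w := MkHinf (sm w).
exists Y; last by move=> v w; rewrite /ipV rb bA.
move=> a v w; apply: hval_inj; rewrite /=.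
have [lb' _] := bb'; exact: lb'.
Qed.

(** [ipV] puts H^s and H^-s in duality, so [Y] inherits on H^s the constant of [X] on H^-s. *)
Lemma adjoint_bound X Y s (c : R) : adjV X Y -> 0 <= c ->
  (forall v, N (- s) (X v) <= c * N (- s) v) ->
  forall w, N s (Y w) <= c * N s w.
Proof.
move=> h c0 hc w; have [y0|y0] := eqVneq (N s (Y w)) 0.
  by rewrite y0 mulr_ge0 ?N_ge0.
have yp : 0 < N s (Y w) by rewrite lt_def y0 N_ge0.
rewrite -(ler_pM2r yp) -expr2.
set y := Ls s (Y w).
have -> : N s (Y w) ^+ 2 = normc (ipV y y).
  by rewrite ipV_nV normc_real ger0_norm ?sqr_ge0.
have -> : ipV y y = (ipV (Ls (- s) (X (Ls s y))) (Ls s w))^*.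
  by rewrite ipV_L Ls_comp addNr Ls_id h -ipVC -ipV_L.
rewrite normc_conj; apply: (le_trans (cauchy_schwarz _ _)); rewrite -!/(nV _).
rewrite -/(N (- s) (X (Ls s y))) -/(N s w) mulrAC; apply: ler_wpM2r.
  exact: N_ge0.
by apply: (le_trans (hc _)); rewrite N_Ls addNr N_id.
Qed.

(* Heinz: Q = Delta^-m Y Delta^m X is symmetric for the inner product of H^m and
   bounded by C^2 on H^b, so n |-> |Q^n v|_m is log-convex and |Q v|_m is at most
   C^2 |v|_m. *)
Lemma interpolation_midpoint X Y a b (C : R) : adjV X Y -> 0 <= C -> a <= b ->
  (forall v, N a (X v) <= C * N a v) -> (forall v, N b (X v) <= C * N b v) ->
  forall v, N ((a + b) / 2) (X v) <= C * N ((a + b) / 2) v.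
Proof.
move=> h C0 ab hXa hXb v; set m := (a + b) / 2.
have m2 : 2 * m = a + b by rewrite /m mulrC divfK ?pnatr_eq0.
have mb : m <= b by lra.
pose Q w := Ls (- (2 * m)) (Y (Ls (2 * m) (X w))).
pose q u w := ipV (Ls m u) (Ls m w).
have qC u w : q u w = (q w u)^* by exact: ipVC.
have qE u w : q (Q u) w = q (X u) (X w).
  rewrite /q -ipV_L Ls_comp /Q Ls_comp.
  have -> : m + m + - (2 * m) = 0 by ring.
  rewrite Ls_id ipVC -h -ipVC.
  have -> : 2 * m = m + m by ring.
  by rewrite -Ls_comp ipV_L.
have qS u w : q (Q u) w = q u (Q w) by rewrite qE [RHS]qC qE -qC.
have qN u : q u u = (N m u ^+ 2)%:C by exact: ipV_nV.
have qCS u w : normc (q u w) <= N m u * N m w by exact: cauchy_schwarz.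
have hY w : N (- a) (Y w) <= C * N (- a) w.
  by apply: (adjoint_bound h C0) => u; rewrite opprK.
(* [Y] is bounded on H^-a by duality with [X] on H^a, and the shift by 2 m = a + b carries -a to
   b. *)
have QB w : N b (Q w) <= C ^+ 2 * N b w.
  rewrite /Q N_Ls; have -> : b + - (2 * m) = - a by lra.
  apply: (le_trans (hY _)); rewrite N_Ls; have -> : - a + 2 * m = b by lra.
  by rewrite expr2 -mulrA; apply: ler_wpM2l.
pose y n := N m (iter n Q v).
have y1 : y 1%N <= C ^+ 2 * y 0%N.
  apply: (@log_convex_le _ y (N b v)) => [|n|n|n].
  - exact: sqr_ge0.
  - exact: N_ge0.
  - have -> : y n.+1 ^+ 2 = normc (q (iter n.+1 Q v) (iter n.+1 Q v)).
      by rewrite qN normc_real ger0_norm ?sqr_ge0.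
    by rewrite /= qS; exact: qCS.
  - apply: (le_trans (N_le _ mb)); rewrite mulrC; elim: n => [|n IH] /=.
      by rewrite expr0 mul1r.
    apply: (le_trans (QB _)); rewrite [(C ^+ 2) ^+ _]exprS -[leRHS]mulrA.
    by apply: ler_wpM2l => //; exact: sqr_ge0.
rewrite -(ler_pXn2r (n := 2))// ?nnegrE ?N_ge0 ?mulr_ge0 ?N_ge0//.
have -> : N m (X v) ^+ 2 = normc (q (Q v) v).
  by rewrite qE qN normc_real ger0_norm ?sqr_ge0.
apply: (le_trans (qCS _ _)); rewrite exprMn [N m v ^+ 2]expr2 mulrA.
by apply: ler_wpM2r y1; exact: N_ge0.
Qed.

(** The norm is Lipschitz in its exponent at the price of one more order, since l / 2 <= exp (l / 2)
    for l = ln (1 + x^2). This continuity takes interpolation beyond dyadic exponents. *)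
Lemma N_lipschitz s t k v : s <= t -> t <= k ->
  N t v <= N s v + (t - s) * N (k + 1) v.
Proof.
move=> st tk.
pose f x := (expR (t / 2 * ln (1 + x ^+ 2)) - expR (s / 2 * ln (1 + x ^+ 2)))%:C : R[i].
have fE x : f x = wt t%:C x - wt s%:C x.
  by rewrite /wt inv2C -!rmorphM !cpow_real /f rmorphB.
have fb x : normc (f x) <= (t - s) * normc (wt (k + 1)%:C x).
  rewrite normc_real normc_wt; set l := ln _.
  have l0 : 0 <= l by exact: ln_weight_ge0.
  have e1 : expR (s / 2 * l) = expR (t / 2 * l) * expR (- ((t - s) / 2 * l)).
    by rewrite -expRD; congr expR; ring.
  have st2 : expR (s / 2 * l) <= expR (t / 2 * l).
    by rewrite ler_expR; apply: ler_wpM2r => //; rewrite ler_pM2r// invr_gt0.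
  rewrite ger0_norm ?subr_ge0// e1 -[X in X - _]mulr1 -mulrBr.
  have h1 : 1 - expR (- ((t - s) / 2 * l)) <= (t - s) * (l / 2).
    by have := expR_ge1Dx (- ((t - s) / 2 * l)); lra.
  have h2 : l / 2 <= expR (l / 2) by have := expR_ge1Dx (l / 2); lra.
  have h3 : expR (t / 2 * l) <= expR (k / 2 * l).
    by rewrite ler_expR; apply: ler_wpM2r => //; rewrite ler_pM2r// invr_gt0.
  have -> : expR (complex.Re (k + 1)%:C / 2 * l) = expR (k / 2 * l) * expR (l / 2).
    by rewrite -expRD; congr expR; rewrite /=; ring.
  rewrite mulrCA; apply: ler_pM => //.
    by rewrite subr_ge0 -[leRHS]expR0 ler_expR oppr_le0 !mulr_ge0// subr_ge0.
  by apply: (le_trans h1); apply: ler_wpM2l => //; rewrite subr_ge0.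
have pf : pbounded f.
  have [n [c hc]] := pbounded_wt (k + 1)%:C; exists n, ((t - s) * c) => x.
  apply: (le_trans (fb x)); rewrite -mulrA; apply: ler_wpM2l => //.
  by rewrite subr_ge0.
have fv : fop f v = Ls t v - Ls s v.
  apply: fopE => //; rewrite -[hval (_ - _)]/(hval (Ls t v) - hval (Ls s v)).
  rewrite -scaleN1r; have h1 := fopP v (pbounded_wt t%:C).
  have h2 := fc_scale (-1) (fopP v (pbounded_wt s%:C)).
  by apply: fc_ext (fc_add h1 h2) => x; rewrite fE mulN1r.
have ts0 : 0 <= t - s by rewrite subr_ge0.
have := nV_fop_le v pf (pbounded_wt (k + 1)%:C) ts0 fb.
rewrite fv -/(L _ v) -/(N _ v) => h.
have := nrmD (hval (Ls t v) - hval (Ls s v)) (hval (Ls s v)).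
by rewrite subrK addrC => /le_trans; apply; rewrite lerD2l.
Qed.

(** Bisection: the midpoint inequality keeps the constant [C], so the estimate holds with the same
    [C] at exponents below [s] and as close to it as desired. *)
Lemma interpolation X Y a b (C : R) : adjV X Y -> 0 <= C -> a <= b ->
  (forall v, N a (X v) <= C * N a v) -> (forall v, N b (X v) <= C * N b v) ->
  forall s v, a <= s -> s <= b -> N s (X v) <= C * N s v.
Proof.
move=> h C0 ab ha hb s v as_ sb.
pose P s := forall v, N s (X v) <= C * N s v.
have ex n : exists a' b', [/\ P a', P b', a' <= s, s <= b' &
    (b' - a') * 2 ^+ n = b - a].
  elim: n => [|n [a' [b' [Pa Pb h1 h2 h3]]]].
    by exists a, b; split => //; rewrite expr0 mulr1.
  have ab' : a' <= b' by lra.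
  have Pm := interpolation_midpoint h C0 ab' Pa Pb.
  have [hs|hs] := leP s ((a' + b') / 2).
    exists a', ((a' + b') / 2); split => //; rewrite exprS mulrA -h3.
    by congr (_ * _); field.
  exists ((a' + b') / 2), b'; split => //; first exact: ltW.
  by rewrite exprS mulrA -h3; congr (_ * _); field.
rewrite -subr_le0; apply: (@le0_eps _ _ (N (b + 1) (X v))) => [|e e0].
  exact: N_ge0.
pose n := (Num.truncn ((b - a) / e)).+1.
have [a' [b' [Pa Pb h1 h2 h3]]] := ex n.
have de : b' - a' <= e.
  have n2 : (b - a) / e <= 2 ^+ n.
    apply: (le_trans (ltW (truncnS_gt _))).
    by rewrite -natrX ler_nat ltnW// ltn_expl.
  have p2 : 0 < 2 ^+ n :> R by rewrite exprn_gt0.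
  by rewrite -(ler_pM2r p2) h3 mulrC -ler_pdivrMr.
have := N_lipschitz (X v) h1 sb; have := Pa v.
have := ler_wpM2l C0 (N_le v h1).
have := ler_wpM2r (N_ge0 (b + 1) (X v)) (_ : s - a' <= e).
have /[swap] /[apply] : s - a' <= e by lra.
lra.
Qed.

End Duality.


(** * The filtered algebra of operators of finite order *)

Section OpCalculus.
Context (R : realType) (T : twistedSpectralTriple R).
Local Notation V := (Hinf T).
Local Notation Ls s := (L (T := T) s%:C).
Implicit Types (X Y Z : V -> V) (v w : V) (s t r : R).

Lemma OpE t X : Op t X <-> linear X /\ forall s, sob_bounded t X s.
Proof.
split=> -[lX h]; split=> // s; have := h s.
  move=> [c hc]; exists `|c| => // v; have := hc v.
  rewrite !sobolev_normE -rmorphM lecR => /le_trans; apply.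
  by apply: ler_wpM2r; [exact: N_ge0|exact: ler_norm].
by move=> [c _ hc]; exists c => v; rewrite !sobolev_normE -rmorphM lecR.
Qed.

Lemma Op_linear t X : Op t X -> linear X.
Proof. by case. Qed.

Lemma Op_lin t a X Y : Op t X -> Op t Y -> Op t (a *: X + Y).
Proof.
move=> /OpE[lX hX] /OpE[lY hY]; apply/OpE; split=> [b v w|s].
  rewrite -[(a *: X + Y) _]/(a *: X (b *: v + w) + Y (b *: v + w)).
  rewrite -[(a *: X + Y) v]/(a *: X v + Y v) -[(a *: X + Y) w]/(a *: X w + Y w).
  by apply: hval_inj; apply: ip_inj => u; rewrite lX lY !(ipDl, ipZl); ring.
have [c c0 hc] := hX s; have [d d0 hd] := hY s.
exists (normc a * c + d) => [|v]; first by rewrite addr_ge0 ?mulr_ge0 ?normc_ge0.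
apply: (le_trans (N_add _ _ _)); rewrite N_scale mulrDl -mulrA; apply: lerD => //.
by apply: ler_wpM2l => //; exact: normc_ge0.
Qed.

Lemma Op_zero t : Op t (0 : V -> V).
Proof.
apply/OpE; split=> [b v w|s].
  by rewrite -[(0 : V -> V) _]/(0 : V) -[X in _ + X]/(0 : V) scaler0 addr0.
exists 0 => // v; rewrite mul0r -[(0 : V -> V) _]/(0 : V) -(scale0r (0 : V)) N_scale.
by rewrite normc0 mul0r.
Qed.

Lemma Op_subspace t : subspace (Op (T := T) t).
Proof. by split; [exact: Op_zero|exact: Op_lin]. Qed.

Lemma OpD t X Y : Op t X -> Op t Y -> Op t (X + Y).
Proof. by move=> hX hY; rewrite -[X]scale1r; exact: Op_lin. Qed.

Lemma OpZ t a X : Op t X -> Op t (a *: X).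
Proof. by move=> hX; rewrite -[_ *: X]addr0; apply: Op_lin hX (Op_zero t). Qed.

Lemma OpN t X : Op t X -> Op t (- X).
Proof. by move=> hX; rewrite -scaleN1r; exact: OpZ. Qed.

Lemma OpB t X Y : Op t X -> Op t Y -> Op t (X - Y).
Proof. by move=> hX hY; apply: OpD => //; exact: OpN. Qed.

Lemma Op_comp s t X Y : Op s X -> Op t Y -> Op (s + t) (X \o Y).
Proof.
move=> /OpE[lX hX] /OpE[lY hY]; apply/OpE; split=> [a v w|r] /=.
  by rewrite lY lX.
have [c c0 hc] := hX r; have [d d0 hd] := hY (r + s).
exists (c * d) => [|v]; first exact: mulr_ge0.
apply: (le_trans (hc _)); rewrite -mulrA; apply: ler_wpM2l => //.
by rewrite addrA.
Qed.

Lemma Op_le s t X : s <= t -> Op s X -> Op t X.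
Proof.
move=> st /OpE[lX hX]; apply/OpE; split=> // r; have [c c0 hc] := hX r.
exists c => // v; apply: (le_trans (hc v)); apply: ler_wpM2l => //.
by apply: N_le; rewrite lerD2l.
Qed.

Lemma Op_fop f t (C : R) : 0 <= C ->
  (forall x, normc (f x) <= C * normc (wt t%:C x)) -> Op t (fop (T := T) f).
Proof.
move=> C0 hf.
have pf : pbounded f.
  have [n [c hc]] := pbounded_wt (t%:C); exists n, (C * c) => x.
  by apply: (le_trans (hf x)); rewrite -mulrA; apply: ler_wpM2l.
apply/OpE; split; first exact: fop_linear.
move=> s; exists C => // v.
rewrite -N_Ls {1}/N L_fop//.
have -> : N s (Ls t v) = nV (fop (wt t%:C) (Ls s v)).
  by rewrite -/(L _ _) Ls_comp addrC -Ls_comp.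
by apply: nV_fop_le => //; exact: pbounded_wt.
Qed.

Lemma Op_L z : Op (complex.Re z) (L (T := T) z).
Proof.
apply: (@Op_fop _ _ 1) => // x.
by rewrite !normc_wt mul1r.
Qed.

Lemma Op_Ls s : Op s (Ls s). Proof. exact: Op_L. Qed.

(** Integral powers of Delta give estimates at even exponents only. After reduction to order 0 by X
    L (-t), the negative ones provide the adjoint that [interpolation] requires between -2n and
    2n. *)
Lemma Op_of_even_orders t X : linear X ->
  (forall n : nat, sob_bounded t X (2 * n%:R)) ->
  (forall n : nat, sob_bounded t X (- (2 * n%:R))) -> Op t X.
Proof.
move=> lX h1 h2; pose X' := X \o Ls (- t).
have lX' : linear X' by move=> a v w; rewrite /X' /= L_linear lX.
have to0 s : sob_bounded t X s -> sob_bounded 0 X' s.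
  move=> [c c0 hc]; exists c => // v; apply: (le_trans (hc _)).
  by rewrite N_Ls addr0 addrK.
have [Y _ hY] := dual_exists lX' (fun n => to0 _ (h2 n)).
have XX' : X = X' \o Ls t.
  by apply/funext => v; rewrite /X' /= Ls_comp addNr Ls_id.
rewrite XX' -[t]add0r; apply: Op_comp; last by rewrite add0r; exact: Op_Ls.
apply/OpE; split=> // s; rewrite /sob_bounded addr0.
pose n := (Num.truncn `|s|).+1.
have sn : `|s| <= 2 * n%:R.
  by apply: (le_trans (ltW (truncnS_gt _))); rewrite ler_peMl// ler1n.
have [c c0 hc] := to0 _ (h1 n); have [d d0 hd] := to0 _ (h2 n).
have m0 : 0 <= Num.max c d by rewrite le_max c0.
exists (Num.max c d) => // v.
move: sn; rewrite ler_norml => /andP[s1 s2].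
apply: (@interpolation _ _ _ _ (- (2 * n%:R)) (2 * n%:R) _ hY m0) => // [|w|w].
- by rewrite (le_trans s1).
- apply: (le_trans (hd w)); rewrite addr0; apply: ler_wpM2r.
    exact: N_ge0.
  by rewrite le_max lexx orbT.
- apply: (le_trans (hc w)); rewrite addr0; apply: ler_wpM2r.
    exact: N_ge0.
  by rewrite le_max lexx.
Qed.

Lemma Op_adjoint t X : Op t X -> exists2 Y, Op t Y & adjV X Y.
Proof.
move=> oX; have oX' := Op_comp oX (Op_Ls (- t)); rewrite subrr in oX'.
have /OpE[lX' hX'] := oX'.
have [Y lY hY] := dual_exists lX' (fun n => hX' _).
exists (Ls t \o Y).
  rewrite -[t in Op t _]addr0; apply: Op_comp; first exact: Op_Ls.
  apply/OpE; split=> // s; have [c c0 hc] := hX' (- s); exists c => // w.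
  rewrite addr0; apply: (adjoint_bound hY) => // v.
  by have := hc v; rewrite addr0.
move=> v w /=; rewrite -ipV_L -hY /= Ls_comp addNr Ls_id//.
Qed.

End OpCalculus.

(** * The Sylvester equation L 1 Z + mu Z L 1 = Y *)

Section Sylvester.
Context (R : realType) (T : twistedSpectralTriple R).
Local Notation V := (Hinf T).
Local Notation Ls s := (L (T := T) s%:C).
Implicit Types (W X Y Z : V -> V) (v w : V) (s t : R).

(** |p^2 + mu q^2|^2 = (p^2 - |mu| q^2)^2 + 2 (|mu| + Re mu) p^2 q^2, and the first square is
    dropped. *)
Lemma normc_add_ge (mu : R[i]) (p q : R) : 0 <= p -> 0 <= q ->
  Num.sqrt (2 * (normc mu + complex.Re mu)) * (p * q) <=
  normc ((p ^+ 2)%:C + mu * (q ^+ 2)%:C).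
Proof.
move=> p0 q0; have k0 : 0 <= 2 * (normc mu + complex.Re mu).
  rewrite mulr_ge0//; have := Re_le_normc (- mu); rewrite normcN raddfN /=.
  by rewrite -subr_ge0 opprK.
rewrite -(ler_pXn2r (n := 2)) ?nnegrE ?normc_ge0 ?mulr_ge0 ?sqrtr_ge0//.
have := sqr_ge0 (p ^+ 2 - normc mu * q ^+ 2).
have mE : normc mu ^+ 2 = complex.Re mu ^+ 2 + complex.Im mu ^+ 2.
  by case: (mu) => a b; rewrite /normc sqr_sqrtr// addr_ge0 ?sqr_ge0.
rewrite exprMn sqr_sqrtr//.
have -> : normc ((p ^+ 2)%:C + mu * (q ^+ 2)%:C) ^+ 2 =
    (p ^+ 2) ^+ 2 + 2 * complex.Re mu * p ^+ 2 * q ^+ 2 + normc mu ^+ 2 * (q ^+ 2) ^+ 2.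
  rewrite mE; case: (mu) => a b.
  by rewrite /normc /= sqr_sqrtr ?addr_ge0 ?sqr_ge0//; ring.
by rewrite -subr_ge0 => h; rewrite -subr_ge0; move: h; congr (_ <= _); ring.
Qed.

(** Symbol of the spectral projection on (1 + D^2)^(1/2) <= M. On its range L 1 is bounded by [M],
    so that the truncation of an operator of order 1 has a finite norm. *)
Definition chi (M : R) (t : R) : R[i] := if normc (wt 1%:C t) <= M then 1 else 0.

Lemma chi_le1 M t : normc (chi M t) <= 1.
Proof. by rewrite /chi; case: ifP => _; rewrite ?normc1 ?normc0. Qed.

Lemma pbounded_chi M : pbounded (chi M).
Proof. exact/pbounded_bounded/chi_le1. Qed.

Local Notation P M := (fop (T := T) (chi M)).

Lemma P_idem M v : P M (P M v) = P M v.
Proof.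
rewrite fop_comp; try exact: pbounded_chi.
congr (fop _ _); apply/funext => t; rewrite /chi.
by case: ifP => _; rewrite ?mulr1 ?mulr0.
Qed.

Lemma ipV_P M v w : ipV (P M v) w = ipV v (P M w).
Proof.
rewrite ipV_fop; last exact: pbounded_chi.
congr (ipV _ (fop _ _)); apply/funext => t; rewrite /chi.
by case: ifP => _; rewrite ?rmorph1 ?rmorph0.
Qed.

Lemma nV_P M v : nV (P M v) <= nV v.
Proof.
rewrite -[leRHS]mul1r -[v in leRHS]fop_one.
apply: nV_fop_le => //; first exact: pbounded_chi.
  by apply: (pbounded_bounded (C := 1)) => t; rewrite normc1.
by move=> t; rewrite normc1 mulr1 chi_le1.
Qed.

Lemma N1_P M v : 0 <= M -> N 1 (P M v) <= M * nV v.
Proof.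
move=> M0; rewrite /N /L fop_comp; [|exact: pbounded_wt|exact: pbounded_chi].
rewrite -[v in leRHS]fop_one; apply: nV_fop_le => //.
- by apply: pbounded_mul; [exact: pbounded_wt|exact: pbounded_chi].
- by apply: (pbounded_bounded (C := 1)) => t; rewrite normc1.
move=> t; rewrite normc1 mulr1 normcM /chi.
by case: (leP (normc (wt 1%:C t)) M) => h; rewrite ?normc1 ?mulr1// normc0 mulr0.
Qed.

Lemma nV_subP M s v : 0 < M -> N s (v - P M v) <= M^-1 * N (s + 1) v.
Proof.
move=> M0.
pose f t := 1 - chi M t.
have pf : pbounded f.
  apply: (pbounded_bounded (C := 1)) => t; rewrite /f /chi.
  by case: ifP => _; rewrite ?subrr ?subr0 ?normc1 ?normc0.
have -> : v - P M v = fop f v.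
  apply/esym/fopE => //; rewrite -[hval (_ - _)]/(hval v - hval (P M v)).
  rewrite -scaleN1r; have h := fc_scale (-1) (fopP v (pbounded_chi M)).
  apply: fc_ext (fc_add (fc_one (hval v)) h) => t.
  by rewrite mulN1r.
rewrite {1}/N L_fop//.
have -> : N (s + 1) v = nV (fop (wt 1%:C) (Ls s v)).
  by rewrite -/(L _ _) Ls_comp addrC.
apply: nV_fop_le => //; [exact: pbounded_wt|by rewrite invr_ge0 ltW|].
move=> t; rewrite /f /chi; case: (leP (normc (wt 1%:C t)) M) => h.
  by rewrite subrr normc0 mulr_ge0 ?normc_ge0// invr_ge0 ltW.
by rewrite subr0 normc1 ler_pdivlMl// mulr1 ltW.
Qed.

(* Evaluating the equation on a near-maximal vector v of PZP, with image w, gives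
   |p + mu zeta^2 q| <= C sqrt p sqrt q up to a small error, where zeta is the norm
   of PZP, p = <|D| w, w> and q = <|D| v, v>; and zeta is controlled by
   |p + mu zeta^2 q| >= k zeta sqrt p sqrt q. *)
Lemma sylvester_truncated Z W Y (mu : R[i]) (c C M : R) :
  linear Z -> linear W -> adjV Z W -> 0 < M -> 0 <= C -> 0 <= c ->
  (forall v, nV (Z v) <= c * N 1 v) ->
  (forall v w, normc (ipV (Y v) w) <= C * (N 2^-1 v * N 2^-1 w)) ->
  (forall v, Ls 1 (Z v) + mu *: Z (Ls 1 v) = Y v) ->
  forall v, Num.sqrt (2 * (normc mu + complex.Re mu)) * nV (P M (Z (P M v))) <=
    C * nV v.
Proof.
move=> lZ lW ZW M0 C0 c0 hZ hY ZY.
set k := Num.sqrt _.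
have k0 : 0 <= k by exact: sqrtr_ge0.
pose Zn := P M \o Z \o P M; pose Wn := P M \o W \o P M.
have lP := fop_linear (T := T) (pbounded_chi M).
have lZn : linear Zn by move=> a v w; rewrite /Zn /= lP lZ lP.
have ZWn v w : ipV (Zn v) w = ipV v (Wn w) by rewrite /Zn /Wn /= ipV_P ZW ipV_P.
have Zn0 : Zn 0 = 0 by have := lZn (-1) 0 0; rewrite scaler0 addr0 scaleN1r addNr.
have ZnZ a v : Zn (a *: v) = a *: Zn v by rewrite -[a *: v]addr0 lZn Zn0 addr0.
have nV0 : nV (0 : V) = 0 by exact: nrm0.
have nVZ a v : nV (a *: v) = normc a * nV v by exact: nrmZ.
have nV_ge0 v : 0 <= nV v by exact: nrm_ge0.
have nV_eq0 v : nV v = 0 -> v = 0 by move=> /nrm_eq0 h; exact: hval_inj.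
(* This bound makes the supremum [ze] finite; its dependence on [M] disappears from the final
   estimate. *)
have bZn v : nV (Zn v) <= c * (M * nV v).
  apply: (le_trans (nV_P _ _)); apply: (le_trans (hZ _)).
  by apply: ler_wpM2l => //; apply: N1_P; exact: ltW.
pose A := [set nV (Zn u) | u in [set u | nV u <= 1]].
have hA : has_sup A.
  split; first by exists (nV (Zn 0)); exists 0 => //=; rewrite nV0.
  exists (c * M) => _ [u /= u1 <-]; apply: (le_trans (bZn u)).
  by rewrite mulrA; apply: ler_piMr => //; rewrite mulr_ge0// ltW.
pose ze := sup A.
have z0 : 0 <= ze.
  by apply: (sup_upper_bound hA); exists 0 => /=; rewrite ?Zn0 nV0.
have Zze v : nV (Zn v) <= ze * nV v.
  have [u0|u0] := eqVneq (nV v) 0.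
    by rewrite (nV_eq0 _ u0) Zn0 nV0 mulr0.
  have up : 0 < nV v by rewrite lt_def u0 nV_ge0.
  have : nV (Zn ((nV v)^-1%:C *: v)) <= ze.
    apply: sup_upper_bound => //; exists ((nV v)^-1%:C *: v) => //=.
    by rewrite nVZ normc_real ger0_norm ?invr_ge0// mulVf.
  by rewrite ZnZ nVZ normc_real ger0_norm ?invr_ge0// mulrC ler_pdivrMr.
have Wze v : nV (Wn v) <= ze * nV v.
  rewrite -[v in leRHS]Ls_id -[Wn v]Ls_id; apply: (adjoint_bound ZWn) => // u.
  by rewrite oppr0 !N_id.
suff kz : k * ze <= C.
  move=> v; apply: (@le_trans _ _ (k * (ze * nV v))).
    by apply: ler_wpM2l => //; exact: Zze.
  by rewrite mulrA; apply: ler_wpM2r.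
have [->|zn0] := eqVneq ze 0; first by rewrite mulr0.
have zp : 0 < ze by rewrite lt_def zn0.
rewrite -subr_le0; apply: (@le0_eps _ _ (4 * (normc mu * M))) => [|e e0].
  by rewrite !mulr_ge0 ?normc_ge0// ltW.
pose d := Num.min e (ze / 2).
have d0 : 0 < d by rewrite lt_min e0 divr_gt0.
have de : d <= e by rewrite /d ge_min lexx.
have dz : d <= ze / 2 by rewrite /d ge_min lexx orbT.
(* A defect of d^2 / (2 ze) below the supremum becomes at most d^2 after squaring; the near-maximal
   vector is then replaced by its truncation. *)
have [v [vP v1 hv]] : exists v, [/\ P M v = v, nV v <= 1 &
    ze ^+ 2 - d ^+ 2 <= nV (Zn v) ^+ 2].
  have e1 : 0 < d ^+ 2 / (2 * ze) by rewrite divr_gt0 ?exprn_gt0// mulr_gt0.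
  have [_ [u /= u1 <-] h] := sup_adherent e1 hA; rewrite -/ze in h.
  exists (P M u); split; first exact: P_idem.
    exact: le_trans (nV_P _ _) u1.
  have -> : Zn (P M u) = Zn u by rewrite /Zn /= P_idem.
  have hd : d ^+ 2 / (2 * ze) * (2 * ze) = d ^+ 2.
    by rewrite divfK// mulf_neq0// pnatr_eq0.
  move: h e1 hd; set q := _ / _ => h e1 hd.
  have dd : d ^+ 2 <= ze ^+ 2.
    by rewrite ler_pXn2r ?nnegrE ?(ltW d0)//; move: dz z0; lra.
  have qz : q <= ze.
    rewrite -(ler_pM2r (_ : 0 < 2 * ze)) ?mulr_gt0// hd.
    by apply: (le_trans dd); rewrite expr2; apply: ler_wpM2l => //; lra.
  have : (ze - q) ^+ 2 <= nV (Zn u) ^+ 2.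
    by rewrite ler_pXn2r ?nnegrE ?subr_ge0// ltW.
  have := sqr_ge0 q; move: hd; rewrite !expr2; lra.
set w := Zn v in hv.
have w2 : ze ^+ 2 / 2 <= nV w ^+ 2 by nra.
have wP : P M w = w by rewrite /w /Zn /= P_idem.
have zw : nV w <= ze.
  by apply: (le_trans (Zze v)); exact: ler_piMr.
(* [v] is nearly an eigenvector of Wn Zn for ze^2; expanding the square bounds the defect [a] by ze
   d. *)
pose a := Wn w - (ze ^+ 2)%:C *: v.
have ha : nV a <= ze * d.
  rewrite -(ler_pXn2r (n := 2))// ?nnegrE ?nV_ge0 ?mulr_ge0 ?(ltW d0)//.
  have -> : nV a ^+ 2 = nV (Wn w) ^+ 2 - 2 * (ze ^+ 2 * nV w ^+ 2) +
      (ze ^+ 2 * nV v) ^+ 2.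
    rewrite /nV (nrm_sqrB (hval (Wn w)) ((ze ^+ 2)%:C *: hval v)) nrmZ normc_real.
    rewrite ger0_norm ?sqr_ge0// ipZr conjR.
    have -> : inner (tst_H T) (hval (Wn w)) (hval v) = (nV w ^+ 2)%:C.
      by rewrite -/(ipV _ _) ipVC -ZWn ipV_nV conjR.
    by rewrite -rmorphM.
  have h1 : nV (Wn w) ^+ 2 <= (ze * nV w) ^+ 2.
    by rewrite ler_pXn2r ?nnegrE ?mulr_ge0.
  have h2 : (ze ^+ 2 * nV v) ^+ 2 <= ze ^+ 4.
    rewrite exprMn -exprM; apply: ler_piMr; first exact: exprn_ge0.
    exact: exprn_ile1.
  have := ler_wpM2l (sqr_ge0 ze) hv.
  have e4 : ze ^+ 4 = ze ^+ 2 * ze ^+ 2 by ring.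
  move: h1 h2; rewrite !exprMn e4.
  set x1 := nV (Wn w) ^+ 2; set x2 := ze ^+ 2; set x3 := nV w ^+ 2.
  set x4 := nV v ^+ 2; set x5 := d ^+ 2; lra.
pose p := N 2^-1 w; pose q := N 2^-1 v.
have half u : ipV (Ls 1 u) u = (N 2^-1 u ^+ 2)%:C.
  have -> : Ls 1 u = Ls 2^-1 (Ls 2^-1 u).
    by rewrite Ls_comp; congr (L _%:C _); field.
  by rewrite ipV_L ipV_nV.
(* [P M] fixes [v] and [w] and commutes with L 1. So, paired with [w], the first term is p^2, and
   the second involves Wn w = ze^2 v + a. *)
have E : (p ^+ 2)%:C + mu * ((ze * q) ^+ 2)%:C =
    ipV (Y v) w - mu * ipV (Ls 1 v) a.
  have lip u1 u2 u3 b : ipV (u2 + b *: u1) u3 = ipV u2 u3 + b * ipV u1 u3.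
    by rewrite -[LHS]/(inner _ (hval u2 + b *: hval u1) (hval u3)) ipDl ipZl.
  have e1 : ipV (Ls 1 (Z v)) w = (p ^+ 2)%:C.
    rewrite -{1}wP -ipV_P /L -(L_fop 1%:C _ (pbounded_chi M)) -{1}vP.
    exact: half.
  have e2 : ipV (Z (Ls 1 v)) w = ipV (Ls 1 v) (Wn w).
    rewrite -ZWn /Zn /= ipV_P wP; congr (ipV (Z _) _).
    by rewrite -(L_fop 1%:C v (pbounded_chi M)) vP.
  have e3 : ipV (Ls 1 v) a = ipV (Ls 1 v) (Wn w) - (ze ^+ 2)%:C * (q ^+ 2)%:C.
    rewrite -half -[LHS]/(inner _ _ (hval (Wn w) - (ze ^+ 2)%:C *: hval v)).
    by rewrite ipBr ipZr conjR.
  rewrite -ZY lip e1 e2 e3 exprMn rmorphM /=; ring.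
have key : k * (p * (ze * q)) <= C * (q * p) + normc mu * (M * (ze * d)).
  have q0 : 0 <= ze * q by rewrite mulr_ge0 ?N_ge0.
  apply: (le_trans (normc_add_ge mu (N_ge0 _ _) q0)); rewrite E.
  apply: (le_trans (le_normcD _ _)); rewrite normcN normcM.
  apply: lerD; first exact: hY.
  apply: ler_wpM2l; first exact: normc_ge0.
  apply: (le_trans (cauchy_schwarz _ _)); apply: ler_pM => //; try exact: nrm_ge0.
  rewrite -vP; apply: (le_trans (N1_P _ (ltW M0))).
  by apply: ler_piMr => //; exact: ltW.
have pq : ze / 4 <= p * q.
  have pw : nV w <= p by rewrite -N_id; apply: N_le; rewrite invr_ge0.
  have qv : nV v <= q by rewrite -N_id; apply: N_le; rewrite invr_ge0.
  have zv := Zze v; rewrite -/w in zv.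
  have w0 := nV_ge0 w; have v0 := nV_ge0 v.
  apply: (@le_trans _ _ (nV w * nV v)); last exact: ler_pM.
  rewrite -(ler_pM2l zp); nra.
(* If k ze > C, the lower bound [pq] replaces the factor p q by ze / 4, and [ze] cancels against the
   right-hand side of [key]. *)
have [h|h] := leP (k * ze - C) 0.
  by apply: (le_trans h); rewrite !mulr_ge0 ?normc_ge0// ltW.
have k1 : (k * ze - C) * (p * q) <= normc mu * (M * (ze * d)) by nra.
have k2 := le_trans (ler_wpM2l (ltW h) pq) k1.
have k3 : (k * ze - C) / 4 <= normc mu * (M * d).
  by rewrite -(ler_pM2l zp); move: k2; nra.
have k4 : normc mu * (M * d) <= normc mu * (M * e).
  by apply: ler_wpM2l; [exact: normc_ge0|apply: ler_wpM2l => //; exact: ltW].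
lra.
Qed.

(** The truncated bound is uniform in [M]. For a fixed smooth [v] and M = 1 / e, cutting off on
    either side of [Z] changes Z v by O(e). *)
Lemma sylvester_bounded Z W Y (mu : R[i]) (c C : R) :
  linear Z -> linear W -> adjV Z W -> 0 <= C -> 0 <= c ->
  (forall s, s = 0 \/ s = 1 -> forall v, N s (Z v) <= c * N (s + 1) v) ->
  (forall v w, normc (ipV (Y v) w) <= C * (N 2^-1 v * N 2^-1 w)) ->
  (forall v, Ls 1 (Z v) + mu *: Z (Ls 1 v) = Y v) ->
  forall v, Num.sqrt (2 * (normc mu + complex.Re mu)) * nV (Z v) <= C * nV v.
Proof.
move=> lZ lW ZW C0 c0 hZ hY ZY v.
set k := Num.sqrt _.
have k0 : 0 <= k by exact: sqrtr_ge0.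
have hZ0 u : nV (Z u) <= c * N 1 u.
  by have := hZ 0 (or_introl erefl) u; rewrite N_id add0r.
rewrite -subr_le0; apply: (@le0_eps _ _ (k * (N 1 (Z v) + c * N 2 v))) => [|e e0].
  by rewrite mulr_ge0// addr_ge0 ?mulr_ge0 ?N_ge0.
pose M := e^-1; have M0 : 0 < M by rewrite invr_gt0.
have h1 := sylvester_truncated lZ lW ZW M0 C0 c0 hZ0 hY ZY v; rewrite -/k in h1.
have h2 : nV (Z v - P M (Z v)) <= e * N 1 (Z v).
  by have := nV_subP 0 (Z v) M0; rewrite N_id add0r invrK.
have h3 : nV (Z (v - P M v)) <= c * (e * N 2 v).
  apply: (le_trans (hZ0 _)); apply: ler_wpM2l => //.
  by have := nV_subP 1 v M0; rewrite invrK.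
have h4 : nV (Z v) <= nV (P M (Z (P M v))) + (nV (Z v - P M (Z v)) + nV (Z (v - P M v))).
  have lP := fop_linear (T := T) (pbounded_chi M).
  have e1 : Z v = P M (Z (P M v)) + ((Z v - P M (Z v)) + P M (Z (v - P M v))).
    have -> : v - P M v = (-1) *: P M v + v by rewrite scaleN1r addrC.
    by rewrite lZ lP scaleN1r addrACA addNr addr0 [RHS]addrC subrK.
  rewrite {1}e1; apply: (le_trans (nrmD _ _)); rewrite lerD2l.
  apply: (le_trans (nrmD _ _)); rewrite lerD2l; exact: nV_P.
have := ler_wpM2l k0 h4; have := ler_wpM2l k0 h2; have := ler_wpM2l k0 h3.
move: h1; set n1 := nV _; set n2 := nV _; set n3 := nV _; set n4 := nV _.
set n5 := nV _; lra.
Qed.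

(** Powers of Delta commute with L 1, so multiplying by them on both sides preserves the equation.
    At each exponent [s] the claim becomes boundedness on H of an operator Z' known to have order
    1. *)
Theorem sylvester_order Z Y (mu : R[i]) t : 0 < normc mu + complex.Re mu ->
  Op (t + 1) Z -> Op (t + 1) Y ->
  (forall v, Ls 1 (Z v) + mu *: Z (Ls 1 v) = Y v) -> Op t Z.
Proof.
move=> mu0 oZ oY ZY.
pose k := Num.sqrt (2 * (normc mu + complex.Re mu)).
have kp : 0 < k by rewrite sqrtr_gt0 mulr_gt0.
apply/OpE; split=> [|s]; first exact: Op_linear oZ.
pose Z' := Ls s \o Z \o Ls (- s - t); pose Y' := Ls s \o Y \o Ls (- s - t).
have conj1 X : Op (t + 1) X -> Op 1 (Ls s \o X \o Ls (- s - t)).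
  move=> oX; have := Op_comp (Op_comp (Op_Ls T s) oX) (Op_Ls T (- s - t)).
  by congr Op; ring.
have oZ' : Op 1 Z' by exact: conj1.
have oY' : Op 1 Y' by exact: conj1.
have [W oW ZW] := Op_adjoint oZ'.
have /OpE[lZ hZ] := oZ'.
have [c0 c00 hc0] := hZ 0; have [c1 c10 hc1] := hZ 1.
have /OpE[_ hY] := oY'; have [C C0 hC] := hY (- 2^-1).
have ZY' v : Ls 1 (Z' v) + mu *: Z' (Ls 1 v) = Y' v.
  have YE : Y' v = Ls s (Y (Ls (- s - t) v)) by [].
  have ZE u : Z' u = Ls s (Z (Ls (- s - t) u)) by [].
  rewrite YE !ZE -ZY L_add L_scale !Ls_comp addrC [- s - t + 1]addrC.
  by rewrite [1 + s]addrC addrC.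
(* The order 1 of Y' is shared equally by the two arguments. *)
have bY v w : normc (ipV (Y' v) w) <= C * (N 2^-1 v * N 2^-1 w).
  have -> : ipV (Y' v) w = ipV (Ls (- 2^-1) (Y' v)) (Ls 2^-1 w).
    by rewrite [RHS]ipV_L Ls_comp addNr Ls_id.
  apply: (le_trans (cauchy_schwarz _ _)); rewrite mulrA; apply: ler_wpM2r.
    exact: N_ge0.
  have := hC v; have -> : - 2^-1 + 1 = 2^-1 :> R by field.
  exact.
have m0 : 0 <= Num.max c0 c1 by rewrite le_max c00.
have h := sylvester_bounded lZ (Op_linear oW) ZW C0 m0 _ bY ZY'.
exists (k^-1 * C) => [|v]; first by rewrite mulr_ge0// invr_ge0 ltW.
have hh : forall r, r = 0 \/ r = 1 -> forall v, N r (Z' v) <= Num.max c0 c1 * N (r + 1) v.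
  move=> r [->|->] u; [apply: (le_trans (hc0 u))|apply: (le_trans (hc1 u))];
    by apply: ler_wpM2r (N_ge0 _ _) _ _ _; rewrite le_max lexx ?orbT.
have := h hh (Ls (s + t) v); rewrite -/k /Z' /= Ls_comp.
have -> : - s - t + (s + t) = 0 by ring.
by rewrite Ls_id -mulrA ler_pdivlMl.
Qed.

End Sylvester.


(** * Complements and extension of linear bijections *)

Section LinearExtension.
Context (K : fieldType) (M : lmodType K).
Implicit Types (S A E U : set M) (x y : M).

Lemma subspaceD S x y : subspace S -> S x -> S y -> S (x + y).
Proof. by move=> [_ h] hx hy; rewrite -[x]scale1r; exact: h. Qed.

Lemma subspaceZ S (a : K) x : subspace S -> S x -> S (a *: x).
Proof. by move=> [h0 h] hx; rewrite -[_ *: _]addr0; exact: h. Qed.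

Lemma subspaceN S x : subspace S -> S x -> S (- x).
Proof. by move=> sS hx; rewrite -scaleN1r; exact: subspaceZ. Qed.

Lemma subspaceB S x y : subspace S -> S x -> S y -> S (x - y).
Proof. by move=> sS hx hy; apply: subspaceD => //; exact: subspaceN. Qed.

Lemma subspaceI S A : subspace S -> subspace A -> subspace (S `&` A).
Proof.
move=> [s0 sS] [a0 sA]; split=> // a x y [h1 h2] [h3 h4].
by split; [exact: sS|exact: sA].
Qed.

Lemma subspace0 : subspace [set (0 : M)].
Proof. by split=> // a x y /= -> ->; rewrite scaler0 addr0. Qed.

(** [p] is the projection on [S] along a complement containing S'. That complement is A + S', where
    [A] is maximal among the sets closed under combinations whose sum with S' meets [S] only in
    0. *)
Lemma linear_projection S S' : subspace S -> subspace S' ->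
  (forall x, S x -> S' x -> x = 0) ->
  exists p : M -> M, [/\ linear p, forall x, S (p x), forall x, S x -> p x = x
    & forall x, S' x -> p x = 0].
Proof.
move=> sS sS' SS'.
(* Membership of 0 is not imposed because the empty union must qualify for Zorn's lemma; [A0]
   recovers it from maximality. *)
pose P := [set C : set M |
  (forall (a : K) x y, C x -> C y -> C (a *: x + y)) /\
  (forall x y, C x -> S' y -> S (x + y) -> x + y = 0)].
have [F FP Ftot|A [[AL AS] Amax]] := @Zorn_bigcup M P.
  have two x y : (\bigcup_(X in F) X) x -> (\bigcup_(X in F) X) y ->
      exists2 X, F X & X x /\ X y.
    move=> [X FX Xx] [Y FY Yy].
    by have [h|h] := Ftot _ _ FX FY; [exists Y|exists X] => //; split=> //; exact: h.
  split=> [a x y hx hy|x y [X FX Xx] hy hS].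
    have [X FX [Xx Xy]] := two _ _ hx hy.
    by exists X => //; have [h _] := FP _ FX; exact: h.
  by have [_ h] := FP _ FX; exact: h.
have A0 : A 0.
  apply: contrapT => nA0; apply: (Amax [set 0]); last first.
    split=> [a x y -> ->|x y -> hy]; first by rewrite scaler0 addr0.
    by rewrite add0r => hS; exact: SS'.
  split=> [x Ax|/(_ 0 erefl)//].
  by case: nA0; have := AL (-1) _ _ Ax Ax; rewrite scaleN1r addNr.
pose C := [set z | exists x y, [/\ A x, S' y & z = x + y]].
have [s0 sL] := sS; have [s0' sL'] := sS'.
have sC : subspace C.
  split; first by exists 0, 0; rewrite addr0.
  move=> a _ _ [x [y [h1 h2 ->]]] [x' [y' [h3 h4 ->]]].
  exists (a *: x + x'), (a *: y + y'); split; [exact: AL|exact: sL'|].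
  by rewrite scalerDr addrACA.
(* Here the local name [cauchy_schwarz] stands for the trivial intersection of [S] and [C]. *)
have cauchy_schwarz x : S x -> C x -> x = 0.
  by move=> hx [y [z [h1 h2 e]]]; rewrite e in hx *; exact: AS.
have ex x : exists s, S s /\ C (x - s).
  apply: contrapT => nx.
  (* For [x] outside S + C, adjoining it to [A] would keep the sum with S' clear of nonzero elements
     of [S], against maximality. *)
  pose B := [set z | exists y (k : K), A y /\ z = y + k *: x].
  apply: (Amax B); last first.
    split=> [a _ _ [y [k [h1 ->]]] [y' [k' [h2 ->]]]|_ z [y [k [h1 ->]]] hz hS].
      exists (a *: y + y'), (a * k + k'); split; first exact: AL.
      by rewrite scalerDr scalerDl scalerA addrACA.
    have [k0|k0] := eqVneq k 0.
      by move: hS; rewrite k0 scale0r addr0; exact: AS.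
    case: nx; exists (k^-1 *: (y + k *: x + z)); split; first exact: subspaceZ.
    have -> : x - k^-1 *: (y + k *: x + z) = (- k^-1) *: (y + z).
      rewrite -addrA [k *: x + z]addrC addrA [in LHS]scalerDr scalerA mulVf//.
      by rewrite scale1r opprD addrCA subrr addr0 scaleNr.
    by apply: subspaceZ => //; exists y, z.
  split=> [y Ay|h]; first by exists y, 0; rewrite scale0r addr0.
  have Ax : A x by apply: h; exists 0, 1; rewrite add0r scale1r.
  case: nx; exists 0; split=> //; exists x, 0; split=> //.
  by rewrite subr0 addr0.
have [p hp] := choice ex.
have uniq x s : S s -> C (x - s) -> p x = s.
  move=> hs hC; have [h1 h2] := hp x.
  apply/eqP; rewrite -subr_eq0; apply/eqP; apply: cauchy_schwarz; first exact: subspaceB.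
  have -> : p x - s = (x - s) - (x - p x) by rewrite opprB [RHS]addrC addrA subrK.
  exact: subspaceB.
exists p; split=> [a x y|x|x hx|x hx].
- have [h1 h2] := hp x; have [h3 h4] := hp y; apply: uniq; first exact: sL.
  have -> : a *: x + y - (a *: p x + p y) = a *: (x - p x) + (y - p y).
    by rewrite scalerBr opprD addrACA.
  by have [_ h] := sC; exact: h.
- by have [] := hp x.
- by apply: uniq => //; rewrite subrr; have [] := sC.
- by apply: uniq => //; rewrite subr0; exists 0, x; rewrite add0r.
Qed.

(** [A] splits into its intersection with [E], onto which [p] projects, and a complement A'. On A'
    theta is [th]; on [E] it is th p + 1 - p; every correction to [sigma] has values in [E]. As [th]
    agrees with [sigma] modulo [E], it maps the intersection of [A] and [E] bijectively to itself,
    whence bijectivity on [E]. *)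
Lemma extend_twisting E A (sigma th : M -> M) :
  subspace E -> subspace A -> linear sigma -> (forall x, E (sigma x) <-> E x) ->
  twisting A th -> (forall x, A x -> E (th x - sigma x)) ->
  exists theta : M -> M, [/\ linear theta, forall x, E (theta x - sigma x),
    forall x, A x -> theta x = th x & set_bij E E theta].
Proof.
move=> sE sA lsi siE [thL [thA thI thS]] thE.
have EA x : A x -> E x <-> E (th x).
  move=> Ax; have h := thE x Ax; rewrite -siE; split=> h'.
    by rewrite -[th x](subrK (sigma x)); exact: subspaceD.
  have -> : sigma x = th x - (th x - sigma x) by rewrite opprB addrC subrK.
  exact: subspaceB.
have th0 : th 0 = 0.
  have A0 : A 0 by have [] := sA.
  by have := thL (-1) _ _ A0 A0; rewrite scaler0 addr0 scaleN1r addNr.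
have thD x y : A x -> A y -> th (x + y) = th x + th y.
  by move=> h1 h2; rewrite -[x]scale1r thL// !scale1r.
have thB x y : A x -> A y -> th (x - y) = th x - th y.
  by move=> h1 h2; rewrite addrC -scaleN1r thL// scaleN1r addrC.
have AL := sA.2; have EL := sE.2.
have linD (f : M -> M) : linear f -> forall x y, f (x + y) = f x + f y.
  by move=> lf x y; rewrite -[x]scale1r lf !scale1r.
have linB (f : M -> M) : linear f -> forall x y, f (x - y) = f x - f y.
  by move=> lf x y; rewrite addrC -scaleN1r lf scaleN1r addrC.
have [p [lp pS pid _]] :=
  linear_projection (subspaceI sA sE) subspace0 (fun x _ h => h).
have pA x : A (p x) by have [] := pS x.
have pE x : E (p x) by have [] := pS x.
have p0 : p 0 = 0 by rewrite -{1}(subrr (0 : M)) linB// subrr.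
pose A' := [set x | A x /\ p x = 0].
have sA' : subspace A'.
  split; first by split; [exact: sA.1|].
  move=> a x y [h1 h2] [h3 h4]; split; first exact: AL.
  by rewrite lp h2 h4 scaler0 addr0.
have A'E x : A' x -> E x -> x = 0.
  by move=> [h1 h2] h3; rewrite -h2 pid.
have [q [lq qA' qid qE]] := linear_projection sA' sE A'E.
have [r [lr rE rid rA']] := linear_projection sE sA' (fun x h1 h2 => A'E x h2 h1).
have qA x : A (q x) by have [] := qA' x.
pose ka x := (th (q x) - sigma (q x)) + (th (p (r x)) - p (r x) + r x - sigma (r x)).
pose theta x := sigma x + ka x.
have lin_sub (f g : M -> M) : linear f -> linear g -> linear (fun x => f x - g x).
  by move=> lf lg a x y; rewrite lf lg scalerBr opprD addrACA.
have lin_add (f g : M -> M) : linear f -> linear g -> linear (fun x => f x + g x).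
  by move=> lf lg a x y; rewrite lf lg scalerDr addrACA.
have ltheta : linear theta.
  apply: (lin_add) => //; apply: (lin_add).
    by apply: (lin_sub) => a x y; rewrite lq ?lsi// thL.
  apply: (lin_sub); last by move=> a x y; rewrite lr lsi.
  apply: (lin_add) => //; apply: (lin_sub) => a x y; rewrite lr lp// thL//.
have tE x : E (theta x - sigma x).
  have -> : theta x - sigma x = ka x by rewrite /theta addrC addKr.
  apply: subspaceD => //; first exact/thE/qA.
  apply: subspaceB => //; last by apply/siE.
  by apply: (subspaceD sE (subspaceB sE ((EA _ (pA _)).1 (pE _)) (pE _)) (rE _)).
have s0 : sigma 0 = 0 by rewrite -{1}(subrr (0 : M)) linB// subrr.
have thetaE x : E x -> theta x = th (p x) - p x + x.
  move=> Ex; rewrite /theta /ka qE// rid// th0 s0 subrr add0r.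
  by rewrite addrC subrK.
have thetaA x : A x -> theta x = th x.
  move=> Ax; have A'x : A' (x - p x).
    split; first exact: subspaceB.
    by rewrite linB// (pid (p x))// subrr.
  rewrite -[x in LHS](subrK (p x)) linD// (thetaE (p x))// (pid (p x))// subrK.
  rewrite /theta /ka qid// rA'// p0 th0 s0 subrr add0r subrr addr0.
  by rewrite [sigma _ + _]addrC subrK -thD ?subrK//; exact: subspaceB.
exists theta; split=> //; split.
- move=> x /= Ex; rewrite -[theta x](subrK (sigma x)).
  by apply: subspaceD => //; apply/siE.
- move=> x y /set_mem Ex /set_mem Ey /eqP.
  rewrite -subr_eq0 -linB// => /eqP; set z := x - y.
  have Ez : E z by exact: subspaceB.
  move=> tz; apply/eqP; rewrite -subr_eq0 -/z.
  have h1 : th (p z) = p z - z.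
    move: tz; rewrite thetaE// => /eqP; rewrite addr_eq0 => /eqP h.
    by rewrite -[th _](subrK (p z)) h addrC.
  have h2 : th (p z) = 0.
    have E1 : E (th (p z)) by apply: (EA _ (pA z)).1.
    by rewrite -(pid (th (p z))); [rewrite h1 linB// (pid (p z))// subrr|split; [exact: thA|]].
  have pz : p z = 0.
    by apply: thI; [exact/mem_set|exact/mem_set/sA.1|rewrite th0].
  by move: h1; rewrite h2 pz sub0r => /esym/eqP; rewrite oppr_eq0.
- move=> y /= Ey.
  have [a Aa ha] := thS (p y) (pA y).
  have Ea : E a by apply: (EA _ Aa).2; rewrite ha.
  have pa : p a = a by apply: pid.
  exists (a + (y - p y)); first by apply: subspaceD => //; exact: subspaceB.
  rewrite thetaE; last by apply: subspaceD => //; exact: subspaceB.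
  rewrite (linD p lp) (linB p lp) (pid (p y))// subrr addr0 pa ha.
  by rewrite addrA subrK addrC subrK.
Qed.

(** A five lemma: modulo [E] the map theta is [sigma], which is onto on [U] and sends nothing
    outside [E] into [E], while on [E] theta is bijective. *)
Lemma set_bij_above E U (sigma theta : M -> M) :
  subspace E -> subspace U -> E `<=` U -> linear theta ->
  (forall x, E (sigma x) <-> E x) ->
  (forall x, E (theta x - sigma x)) -> set_bij E E theta ->
  (forall x, U x -> U (sigma x)) ->
  (forall y, U y -> exists2 x, U x & sigma x = y) ->
  set_bij U U theta.
Proof.
move=> sE sU EU lt siE tE [_ tI tS] sU1 sU2.
have tD x y : theta (x + y) = theta x + theta y.
  by rewrite -[x]scale1r lt !scale1r.
have tB x y : theta (x - y) = theta x - theta y.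
  by rewrite addrC -scaleN1r lt scaleN1r addrC.
have t0 : theta 0 = 0 by rewrite -{1}(subrr (0 : M)) tB subrr.
split.
- move=> x /= Ux; rewrite -[theta x](subrK (sigma x)).
  by apply: subspaceD => //; [exact/EU|exact: sU1].
- move=> x y _ _ /eqP; rewrite -subr_eq0 -tB => /eqP tz.
  apply/eqP; rewrite -subr_eq0; apply/eqP; apply: tI.
  + apply/mem_set/siE; have := tE (x - y); rewrite tz sub0r => h.
    by rewrite -[sigma _]opprK; exact: subspaceN.
  + exact/mem_set/sE.1.
  + by rewrite tz t0.
- move=> y /= Uy; have [x Ux sx] := sU2 y Uy.
  have [z Ez tz] : (theta @` E) (y - theta x).
    by apply: tS; rewrite -sx -opprB; exact: subspaceN.
  exists (x + z); first by apply: subspaceD => //; exact: EU.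
  by rewrite tD tz addrC subrK.
Qed.

End LinearExtension.


(** * The order condition *)

Section OrderCondition.
Context (R : realType) (T : twistedSpectralTriple R).
Local Notation H := (tst_H T).
Local Notation V := (Hinf T).
Local Notation D := (tst_D T).
Local Notation rep := (@tst_rep R T).
Local Notation theta := (@tst_theta R T).
Implicit Types (X Y Z : V -> V) (v w : V) (s t : R) (z : R[i]) (b : H -> H).

Definition Delta_conj z X : V -> V := L z \o X \o L (- z).

(** [rep] may have a kernel. [oc_ker] makes theta descend to a bijection of the image of [rep],
    without which it could not be extended as a map of operators. *)
Record order_condition : Prop := OrderCondition {
  oc_algebra : contains_restrictions (Op (T := T) 0) (range rep) ;
  oc_commutators : contains_restrictions (Op (T := T) 0) (@D_commutators R T) ;
  oc_theta : forall a X Y, is_restriction (rep a) X ->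
    is_restriction (rep (theta a)) Y -> Op (-1) (Y - Delta_conj 1 X) ;
  oc_ker : forall a, rep (theta a) = 0 <-> rep a = 0
}.

Lemma Delta_conjD z z' X : Delta_conj z (Delta_conj z' X) = Delta_conj (z + z') X.
Proof.
by apply/funext => v; rewrite /Delta_conj /= !L_comp opprD [- z - _]addrC.
Qed.

Lemma Delta_conj0 X : Delta_conj 0 X = X.
Proof. by apply/funext => v; rewrite /Delta_conj /= oppr0 !L_id. Qed.

Lemma Delta_conjK z X : Delta_conj (- z) (Delta_conj z X) = X.
Proof. by rewrite Delta_conjD addNr Delta_conj0. Qed.

Lemma Delta_conjVK z X : Delta_conj z (Delta_conj (- z) X) = X.
Proof. by rewrite Delta_conjD addrN Delta_conj0. Qed.

Lemma Delta_conj_linear z : linear (Delta_conj z).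
Proof.
move=> a X Y; apply/funext => v.
rewrite /Delta_conj /= -[(a *: X + Y) _]/(a *: X (L (- z) v) + Y (L (- z) v)).
by rewrite L_linear.
Qed.

Lemma Op_Delta_conj t z X : Op t X -> Op t (Delta_conj z X).
Proof.
move=> oX; have := Op_comp (Op_comp (Op_L T z) oX) (Op_L T (- z)).
by congr Op; rewrite raddfN /=; ring.
Qed.

Lemma Op_Delta_conjP t z X : Op t (Delta_conj z X) <-> Op t X.
Proof.
split=> h; last exact: Op_Delta_conj.
by rewrite -(Delta_conjK z X); exact: Op_Delta_conj.
Qed.

Lemma Delta_conj_bij z (U : set (V -> V)) :
  (forall z X, U X -> U (Delta_conj z X)) -> set_bij U U (Delta_conj z).
Proof.
move=> hU; split=> [X /=|X Y _ _ h|X /= UX]; first exact: hU.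
  by rewrite -(Delta_conjK z X) h Delta_conjK.
by exists (Delta_conj (- z) X); [exact: hU|exact: Delta_conjVK].
Qed.

Lemma restriction_ex b : (forall v, b (hval v) \in smooth (T := T)) ->
  exists X, is_restriction b X.
Proof. by move=> h; exists (fun v => MkHinf (h v)). Qed.

Lemma restriction_uniq b X Y : is_restriction b X -> is_restriction b Y -> X = Y.
Proof. by move=> hX hY; apply/funext => v; apply: hval_inj; rewrite hX hY. Qed.

Lemma restriction_lin b b' X Y a : is_restriction b X -> is_restriction b' Y ->
  is_restriction (a *: b + b') (a *: X + Y).
Proof.
move=> hX hY v.
by rewrite -[LHS]/(a *: hval (X v) + hval (Y v)) hX hY.
Qed.

Lemma restriction_comp b b' X Y : is_restriction b X -> is_restriction b' Y ->
  is_restriction (b \o b') (X \o Y).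
Proof. by move=> hX hY v /=; rewrite hX hY. Qed.

Lemma restriction_linear b X : bounded_operator b -> is_restriction b X -> linear X.
Proof.
move=> [lb _] hX a v w; apply: hval_inj.
by rewrite hX -[RHS]/(a *: hval (X v) + hval (X w)) !hX -lb.
Qed.

Lemma filtered_Op (I : nmodType) (leI : rel I) (f : I -> R) :
  (forall i j, leI i j -> f i <= f j) -> {morph f : i j / i + j} ->
  filtered_algebra leI (fun i => Op (T := T) (f i)).
Proof.
move=> f_le fD; split=> [i X|i|i j ij X|i j X Y].
- exact: Op_linear.
- exact: Op_subspace.
- by apply: Op_le; exact: f_le.
- by rewrite fD; exact: Op_comp.
Qed.

Theorem order_condition_psido : order_condition ->
  psido_algebra (Op (T := T)) Delta_conj.
Proof.
move=> [oA oC oT _].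
have stab z (U := filt_union (Op (T := T))) X : U X -> U (Delta_conj z X).
  by move=> [t h]; exists t; exact: Op_Delta_conj.
split.
- exact: (filtered_Op (f := id)).
- by move=> t X.
- exact: oA.
- exact: oC.
- move=> z; split; last first.
    by move=> t; apply: Delta_conj_bij => z' X; exact: Op_Delta_conj.
  split; last exact: Delta_conj_bij.
  by move=> a X Y _ _; exact: Delta_conj_linear.
- by move=> X _; exact: Delta_conj0.
- by move=> z z' X _; rewrite Delta_conjD.
- exact: oT.
- move=> z X [t h]; have -> : z = z * 2 / 2 by rewrite mulfK// pnatr_eq0.
  by rewrite Delta_powE; eexists; exact: Op_comp (Op_L T _) h.
- move=> z X [t h]; have -> : z = z * 2 / 2 by rewrite mulfK// pnatr_eq0.
  by rewrite Delta_powE; eexists; exact: Op_comp h (Op_L T _).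
(* L z X equals the conjugate of X times L z, so this twisted commutator vanishes and lies in every
   order. *)
- move=> z s X oX; rewrite Delta_powE.
  have -> : twisted_comm (Delta_conj z) (L z) X = 0; last exact: Op_zero.
  apply/funext => v; rewrite /twisted_comm /Delta_conj.
  rewrite -[LHS]/(L z (X v) - L z (X (L (- z) (L z v)))).
  by rewrite L_comp addNr L_id subrr.
Qed.

(* The extension of theta agrees with the conjugation by (1 + D^2)^(1/2) modulo
   Op^-1. *)
Lemma twisting_extension : order_condition ->
  exists th : (V -> V) -> (V -> V), [/\ linear th,
    forall X, Op (-1) (th X - Delta_conj 1 X),
    forall a X Y, is_restriction (rep a) X ->
      is_restriction (rep (theta a)) Y -> th X = Y
    & forall U, subspace U -> Op (-1) `<=` U ->
        (forall z X, U X -> U (Delta_conj z X)) -> set_bij U U th].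
Proof.
move=> [oA _ oT oK].
have [lth [_ thI thS]] := tst_thetaP T.
have thL (c : R[i]) (a a' : tst_A T) : theta (c *: a + a') = c *: theta a + theta a'.
  by apply: lth.
have lrep := @tst_rep_linear R T.
have rr a : exists X, is_restriction (rep a) X.
  by have [|X _ hX] := oA (rep a); [exists a|exists X].
pose AV := [set X | exists a, is_restriction (rep a) X].
(* Graph of theta on restrictions. Different elements of the algebra may have the same restriction;
   [oc_ker] makes the graph single-valued and injective. *)
pose G X := [set Y | exists a, is_restriction (rep a) X /\ is_restriction (rep (theta a)) Y].
pose thA X := xget 0 (G X).
have repB (a a' : tst_A T) : rep (a - a') = rep a - rep a'.
  by rewrite addrC -scaleN1r lrep scaleN1r addrC.
have thB (a a' : tst_A T) : theta (a - a') = theta a - theta a'.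
  by rewrite addrC -scaleN1r thL scaleN1r addrC.
have repE (a a' : tst_A T) X : is_restriction (rep a) X -> is_restriction (rep a') X -> rep a = rep a'.
  exact: (restriction_inj (tst_rep_bounded a) (tst_rep_bounded a')).
have threp (a a' : tst_A T) : rep a = rep a' <-> rep (theta a) = rep (theta a').
  split=> h; apply/eqP; rewrite -subr_eq0 -repB; apply/eqP.
    by rewrite -thB; apply/oK; rewrite repB h subrr.
  by apply/oK; rewrite thB repB h subrr.
have thAE a X Y : is_restriction (rep a) X -> is_restriction (rep (theta a)) Y ->
    thA X = Y.
  move=> h1 h2; rewrite /thA; case: xgetP => [Z _ [a' [h3 h4]]|h]; last first.
    by case: (h Y); exists a.
  have e : rep (theta a) = rep (theta a') by apply: (threp _ _).1; exact: repE h1 h3.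
  by apply: (restriction_uniq h4); rewrite -e.
have sAV : subspace AV.
  split.
    exists 0 => v; have -> : rep 0 = 0 by rewrite -(subrr 0) repB subrr.
    by [].
  move=> c X Y [a ha] [b hb]; exists (c *: a + b); rewrite lrep.
  exact: restriction_lin.
have twA : twisting AV thA.
  split; last split.
  - move=> c X Y [a ha] [b hb].
    have [X' hX'] := rr (theta a); have [Y' hY'] := rr (theta b).
    rewrite (thAE _ _ _ ha hX') (thAE _ _ _ hb hY').
    apply: (thAE (c *: a + b)); first by rewrite lrep; exact: restriction_lin.
    by rewrite thL lrep; exact: restriction_lin.
  - move=> X [a ha] /=; have [X' hX'] := rr (theta a).
    by rewrite (thAE _ _ _ ha hX'); exists (theta a).
  - move=> X Y /set_mem[a ha] /set_mem[b hb].
    have [X' hX'] := rr (theta a); have [Y' hY'] := rr (theta b).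
    rewrite (thAE _ _ _ ha hX') (thAE _ _ _ hb hY') => e.
    rewrite -e in hY'; have h : rep a = rep b by apply: (threp _ _).2; exact: repE hX' hY'.
    by apply: (restriction_uniq ha); rewrite h.
  - move=> Y [b hb]; have [a _ ab] := thS b I.
    have [X hX] := rr a; exists X; first by exists a.
    by apply: (thAE a) => //; rewrite ab.
have [th [h1 h2 h3 h4]] := extend_twisting (Op_subspace T (-1)) sAV
  (Delta_conj_linear 1) (fun X => Op_Delta_conjP _ _ _) twA
  (fun X (hX : AV X) => let: ex_intro a ha := hX in
     let: ex_intro Y hY := rr (theta a) in
     eq_ind _ (fun Y => Op (-1) (Y - Delta_conj 1 X)) (oT a X Y ha hY) _
       (esym (thAE a X Y ha hY))).
exists th; split=> // [a X Y hX hY|U sU EU hU].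
  by rewrite h3; [exact: (thAE a)|exists a].
apply: (set_bij_above (Op_subspace T (-1)) sU EU h1 _ h2 h4).
- by move=> X; exact: Op_Delta_conjP.
- exact: hU.
- move=> Y UY; exists (Delta_conj (-1) Y); first exact: hU.
  exact: Delta_conjVK.
Qed.

Theorem order_condition_diffop : order_condition ->
  exists (DO : nat -> set (V -> V)) (th : (V -> V) -> (V -> V)),
    diffop_algebra DO th.
Proof.
move=> oc; have [th [lth thE thA thU]] := twisting_extension oc.
have [oA oC _ _] := oc.
exists (fun n => Op n%:R), th.
have fa : filtered_algebra leq (fun n => Op (T := T) n%:R).
  by apply: (filtered_Op (f := fun n => n%:R)) => [i j|i j]; rewrite ?ler_nat ?natrD.
have N1 n : (-1 : R) <= n%:R by apply: (@le_trans _ _ 0); rewrite ?lerN10.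
split.
- exact: fa.
- exact: oA.
- exact: oC.
- split; last first.
    move=> n; apply: thU; [exact: Op_subspace|move=> X; exact: Op_le|].
    by move=> z X; exact: Op_Delta_conj.
  split; first by move=> a X Y _ _; exact: lth.
  apply: thU.
  + split; first by exists 0%N; exact: Op_zero.
    move=> a X Y [m hX] [n hY]; exists (maxn m n).
    by apply: Op_lin; [apply: Op_le hX|apply: Op_le hY];
      rewrite ler_nat ?leq_maxl ?leq_maxr.
  + by move=> X h; exists 0%N; exact: Op_le h.
  + by move=> z X [n h]; exists n; exact: Op_Delta_conj.
- exact: thA.
- move=> n X /OpE[_ /(_ 0)[c c0 hc]]; exists (c + 1); first by rewrite ltr_wpDl.
  move=> v; rewrite nrmE sobolev_normE -rmorphM lecR.
  have := hc v; rewrite N_id add0r => /le_trans; apply.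
  by apply: ler_wpM2r; [exact: N_ge0|rewrite lerDl].
- move=> n X oX; rewrite restr_Delta.
  (* Each of the two applications of [th] contributes an error of order -1, one of them conjugated
     by L 1. *)
  have oE : Op (-1) (th (th X) - Delta_conj 2 X).
    have -> : th (th X) - Delta_conj 2 X = (th (th X) - Delta_conj 1 (th X)) +
        Delta_conj 1 (th X - Delta_conj 1 X).
      have -> : Delta_conj 1 (th X - Delta_conj 1 X) =
          Delta_conj 1 (th X) - Delta_conj 2 X.
        rewrite -[th X - _]addrC -scaleN1r Delta_conj_linear Delta_conjD.
        by rewrite scaleN1r addrC.
      by rewrite addrA subrK.
    by apply: OpD; [exact: thE|exact/Op_Delta_conj/thE].
  (* The error of order -1 is multiplied by Delta, which gives order 1, at most n + 1. *)
  have -> : twisted_comm (th \o th) (L 2) X = - ((th (th X) - Delta_conj 2 X) \o L 2).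
    apply/funext => v; rewrite /twisted_comm.
    rewrite -[LHS]/(L 2 (X v) - th (th X) (L 2 v)).
    rewrite -[RHS]/(- (th (th X) (L 2 v) - L 2 (X (L (- 2) (L 2 v))))).
    by rewrite L_comp addNr L_id opprB.
  apply/OpN; apply: Op_le (Op_comp oE (Op_L T 2)).
  rewrite /= -natr1; have : 0 <= n%:R :> R by []. 
  lra.
Qed.

End OrderCondition.


(** * From the order condition to regularity *)

Section Regularity.
Context (R : realType) (T : twistedSpectralTriple R).
Local Notation H := (tst_H T).
Local Notation V := (Hinf T).
Local Notation ip := (inner H).
Local Notation D := (tst_D T).
Local Notation F := (is_fcalc D).
Local Notation Ls s := (L (T := T) s%:C).
Local Notation rep := (@tst_rep R T).
Local Notation theta := (@tst_theta R T).
Let linD := tst_D_linear T.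
Let saD := tst_D_self_adjoint T.
Let crD := tst_D_compact_resolvent T.
Implicit Types (X Y Z : V -> V) (v w : V) (x y : H) (s t : R) (z : R[i]) (b : H -> H).

Definition absf t : R[i] := `|t|%:C.

Lemma abs_le_weight t : `|t| <= 1 + t ^+ 2.
Proof. by rewrite ler_norml; apply/andP; split; nra. Qed.

Lemma pbounded_abs : pbounded absf.
Proof.
exists 1%N, 1 => t; rewrite mul1r expr1 normc_real ger0_norm//.
exact: abs_le_weight.
Qed.

Local Notation P := (fop (T := T) absf).

Lemma absopE x y : F absf x y -> absop D x = y.
Proof.
move=> h; rewrite /absop /fcalc /=; case: xgetP => [u -> h'|h'].
  exact: (fc_uniq linD saD crD h' h).
by case: (h' y).
Qed.

Lemma absop_fc x : dom (absop D) x -> F absf x (absop D x).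
Proof. by move=> [y hy]; rewrite (absopE hy). Qed.

Lemma absop_smooth v : dom (absop D) (hval v) /\ absop D (hval v) = hval (P v).
Proof.
have h := fopP v pbounded_abs; split; first by exists (hval (P v)).
exact: absopE h.
Qed.

Lemma expR_half_ln (x : R) : 0 < x -> expR (2^-1 * ln x) ^+ 2 = x.
Proof.
move=> x0; rewrite -expRM_natl -[RHS]lnK// mulrA; congr expR.
by rewrite -[RHS]mul1r; congr (_ * _); field.
Qed.

Lemma normc_wt1_sqr t : normc (wt 1%:C t) ^+ 2 = 1 + t ^+ 2.
Proof.
rewrite normc_wt /= mul1r -[RHS]expR_half_ln ?weight_gt0//.
Qed.

Lemma abs_le_wt1 t : `|t| <= normc (wt 1%:C t).
Proof.
rewrite -(ler_pXn2r (n := 2))// ?nnegrE ?normc_ge0//.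
by rewrite normc_wt1_sqr real_normK ?num_real// lerDr.
Qed.

Lemma wt1_le_abs t : normc (wt 1%:C t) <= 1 + `|t|.
Proof.
rewrite -(ler_pXn2r (n := 2))// ?nnegrE ?normc_ge0 ?addr_ge0//.
rewrite normc_wt1_sqr sqrrD expr1n mul1r real_normK ?num_real//.
by have := normr_ge0 t; lra.
Qed.

Lemma wt1_real t : wt 1%:C t = (normc (wt 1%:C t))%:C.
Proof. by rewrite normc_wt /wt inv2C -rmorphM cpow_real. Qed.

(** Regularity speaks of |D| and the order condition of (1 + D^2)^(1/2); their symbols differ by at
    most 1. *)
Lemma Op_L1_sub_abs : Op 0 (Ls 1 - P).
Proof.
pose f t := wt 1%:C t - absf t.
have f1 t : normc (f t) <= 1.
  have -> : f t = (normc (wt 1%:C t) - `|t|)%:C.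
    by rewrite [RHS]rmorphB /f {1}wt1_real.
  rewrite normc_real ger0_norm.
    by have := wt1_le_abs t; lra.
  by rewrite subr_ge0; exact: abs_le_wt1.
have -> : Ls 1 - P = fop (T := T) f.
  apply/funext => v; apply/esym/fopE; first exact: (pbounded_bounded f1).
  rewrite -[hval ((_ - _) v)]/(hval (Ls 1 v) - hval (P v)) -scaleN1r.
  have h := fc_scale (-1) (fopP v pbounded_abs).
  apply: fc_ext (fc_add (fopP v (pbounded_wt 1%:C)) h) => t.
  by rewrite mulN1r.
apply: (@Op_fop _ _ _ _ 1) => // t.
by rewrite mul1r /wt mul0r cpow0 normc1.
Qed.

(** The bridge between regularity and the order condition: replacing |D| by L 1 costs terms of order
    0, and composing with L 1 on the right turns order -1 into order 0. *)
Lemma abs_commutator X Y : Op 0 X -> Op 0 Y ->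
  Op 0 ((P \o X) - (Y \o P)) <-> Op (-1) (Y - Delta_conj 1 X).
Proof.
move=> oX oY; pose G := Ls 1 - P.
have oG : Op 0 G by exact: Op_L1_sub_abs.
have oGX : Op 0 (G \o X) by have := Op_comp oG oX; rewrite addr0.
have oYG : Op 0 (Y \o G) by have := Op_comp oY oG; rewrite addr0.
have lY := Op_linear oY.
have YB u v : Y (u - v) = Y u - Y v by rewrite addrC -scaleN1r lY scaleN1r addrC.
have E v : ((P \o X) - (Y \o P)) v =
    (Ls 1 (X v) - Y (Ls 1 v)) + ((Y \o G) v - (G \o X) v).
  rewrite /G /= -[LHS]/(P (X v) - Y (P v)).
  rewrite -[(Ls 1 - P) v]/(Ls 1 v - P v) -[(Ls 1 - P) (X v)]/(Ls 1 (X v) - P (X v)).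
  rewrite YB opprB; apply: hval_inj; apply: ip_inj => u.
  by rewrite !(ipDl, ipNl); ring.
split=> h.
  have -> : Y - Delta_conj 1 X =
      (- (((P \o X) - (Y \o P)) - ((Y \o G) - (G \o X)))) \o Ls (- 1).
    apply/funext => v /=.
    rewrite -[LHS]/(Y v - L 1 (X (L (- 1) v))).
    rewrite -[RHS]/(- (((P \o X) - (Y \o P)) (Ls (- 1) v) -
      ((Y \o G) (Ls (-1) v) - (G \o X) (Ls (-1) v)))).
    rewrite E addrK opprB Ls_comp subrr Ls_id; congr (_ - L _ (X (L _ v))) => //.
    by rewrite rmorphN.
  rewrite -[X in Op X]add0r; apply: Op_comp; last exact: Op_Ls.
  by apply: OpN; apply: OpB => //; exact: OpB.
have -> : (P \o X) - (Y \o P) = - ((Y - Delta_conj 1 X) \o Ls 1) + ((Y \o G) - (G \o X)).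
  apply/funext => v; rewrite E.
  rewrite -[RHS]/(- (Y (Ls 1 v) - L 1 (X (L (- 1) (L 1 v)))) +
    ((Y \o G) v - (G \o X) v)).
  by rewrite L_comp addNr L_id [X in _ = X + _]opprB.
apply: OpD; last exact: OpB.
by apply: OpN; have := Op_comp h (Op_Ls T 1); rewrite addNr.
Qed.

Lemma restriction_adjoint b X Y : bounded_operator b -> is_restriction b X ->
  adjV X Y -> forall x w, ip (b x) (hval w) = ip x (hval (Y w)).
Proof.
move=> bb rb XY x w; have [S _ hS] := adjoint_exists bb.
rewrite hS; congr (ip _ _); apply: smooth_total => v.
by rewrite ipC -hS -rb -/(ipV _ _) XY -ipC.
Qed.

Lemma Op0_extension X : Op 0 X -> exists2 b, bounded_operator b & is_restriction b X.
Proof.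
move=> /OpE[lX /(_ 0)[c _ hc]]; apply: (extend_bounded lX (c := c)) => v.
by have := hc v; rewrite addr0 !N_id.
Qed.

Theorem order_condition_regular : order_condition T -> regular T.
Proof.
move=> oc; have [th [lth thE thA thU]] := twisting_extension oc.
have [oA oC _ _] := oc.
pose B := [set b : H -> H | bounded_operator b /\ exists2 X : V -> V, Op 0 X & is_restriction b X].
pose G b := [set b' | bounded_operator b' /\
  exists2 X, is_restriction b X & is_restriction b' (th X)].
pose thB b := xget 0 (G b).
have [thO thI thS] : set_bij (Op 0) (Op 0) th.
  apply: thU; [exact: Op_subspace|move=> X; apply: Op_le; lra|].
  by move=> z X; exact: Op_Delta_conj.
have thBE b X : B b -> is_restriction b X ->
    [/\ bounded_operator (thB b), is_restriction (thB b) (th X) & Op 0 X].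
  move=> [bb [X' oX' rX']] rX.
  have e := restriction_uniq rX rX'; rewrite e.
  have [b' bb' rb'] := Op0_extension (thO _ oX').
  rewrite /thB; case: xgetP => [b'' _ [bb'' [X'' r1 r2]]|h].
    by split=> //; rewrite (restriction_uniq rX' r1).
  by case: (h b'); split=> //; exists X'.
have repB a : B (rep a).
  split; first exact: tst_rep_bounded.
  by have [|X oX rX] := oA (rep a); [exists a|exists X].
have sB : subspace B.
  split.
    split; first by split; [move=> a x y; rewrite scaler0 addr0|exists 0 => v;
      rewrite -[(0 : H -> H) v]/(0 : H) normr0 mul0r].
    by exists 0; [exact: Op_zero|].
  move=> a b b' [bb [X oX rX]] [bb' [X' oX' rX']].
  have oXX := Op_lin a oX oX'; have rXX := restriction_lin a rX rX'.
  split; last by exists (a *: X + X').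
  have [lb _] := bb; have [lb' _] := bb'.
  have [c c0 hc] := bounded_pos bb; have [c' c'0 hc'] := bounded_pos bb'.
  split=> [k x y|].
    rewrite -[LHS]/(a *: b (k *: x + y) + b' (k *: x + y)).
    rewrite -[RHS]/(k *: (a *: b x + b' x) + (a *: b y + b' y)).
    by rewrite lb lb'; apply: ip_inj => u; rewrite !(ipDl, ipZl); ring.
  exists (normc a * c + c'); apply/bounded_nrm => x.
  apply: (le_trans (nrmD _ _)); rewrite nrmZ mulrDl -mulrA; apply: lerD => //.
  by apply: ler_wpM2l => //; exact: normc_ge0.
exists B, thB; split=> //.
- split=> // [b []//|b b' [bb [X oX rX]] [bb' [X' oX' rX']]|b [bb [X oX rX]]].
    split; last first.
      exists (X \o X'); last exact: restriction_comp.
      by have := Op_comp oX oX'; rewrite addr0.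
    have [lb _] := bb; have [lb' _] := bb'.
    have [c c0 hc] := bounded_pos bb; have [c' c'0 hc'] := bounded_pos bb'.
    split=> [k x y /=|]; first by rewrite lb' lb.
    exists (c * c'); apply/bounded_nrm => x /=.
    apply: (le_trans (hc _)); rewrite -mulrA; apply: ler_wpM2l => //.
    exact: ltW.
  have [S bS hS] := adjoint_exists bb; exists S => //; split=> //.
  have [Y oY hY] := Op_adjoint oX; exists Y => // w.
  apply: smooth_total => v.
  by rewrite ipC -(restriction_adjoint bb rX hY) hS -ipC.
- by move=> _ [a _ <-].
- move=> c hc; split; last exact: oC.
  by have [a []] := hc.
- split; last first.
    move=> a; have [_ [X oX rX]] := repB a; have [_ [Y oY rY]] := repB (theta a).
    have [h1 h2 _] := thBE _ _ (repB a) rX.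
    rewrite (thA _ _ _ rX rY) in h2.
    exact: (restriction_inj h1 (tst_rep_bounded _) h2 rY).
  split; last split.
  + move=> a b b' hb hb'; have [bb [X oX rX]] := hb; have [bb' [X' oX' rX']] := hb'.
    have [h1 h2 _] := thBE _ _ hb rX; have [h1' h2' _] := thBE _ _ hb' rX'.
    have hbb := sB.2 a _ _ hb hb'.
    have [h3 h4 _] := thBE _ _ hbb (restriction_lin a rX rX').
    have B1 : B (thB b) by split=> //; exists (th X) => //; exact: thO.
    have B2 : B (thB b') by split=> //; exists (th X') => //; exact: thO.
    have [h5 _] := sB.2 a _ _ B1 B2.
    apply: (restriction_inj h3 h5 h4); rewrite lth.
    exact: restriction_lin.
  + move=> b hb; have [bb [X oX rX]] := hb; have [h1 h2 _] := thBE _ _ hb rX.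
    by split=> //; exists (th X) => //; exact: thO.
  + move=> b b' /set_mem hb /set_mem hb' e.
    have [bb [X oX rX]] := hb; have [bb' [X' oX' rX']] := hb'.
    have [h1 h2 _] := thBE _ _ hb rX; have [h1' h2' _] := thBE _ _ hb' rX'.
    rewrite e in h2; have eX := restriction_uniq h2 h2'.
    have XX : X = X' by apply: thI => //; exact: mem_set.
    by apply: (restriction_inj bb bb' rX); rewrite XX.
  + move=> b [bb [Y oY rY]]; have [X oX hX] := thS Y oY.
    have [a ba ra] := Op0_extension oX; have Ba : B a by split=> //; exists X.
    exists a => //; have [h1 h2 _] := thBE _ _ Ba ra.
    by apply: (restriction_inj h1 bb h2); rewrite hX.
- move=> b hb; have [bb [X oX rX]] := hb; have [h1 h2 _] := thBE _ _ hb rX.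
  have oY := thO _ oX; pose Z := (P \o X) - (th X \o P).
  have oZ : Op 0 Z := (abs_commutator oX oY).2 (thE X).
  have [c bc rc] := Op0_extension oZ.
  exists c; first by split=> //; exists Z.
  (* The identity is required on the whole domain of |D|, where [X] cannot be applied. It is tested
     against eigenvectors, which are smooth, after moving the operators to that side by adjoints. *)
  split=> // x /absop_fc hu; set u := absop D x in hu *.
  suff hF : F absf (b x) (thB b u + c x).
    by split; [exists (thB b u + c x)|rewrite (absopE hF) [X in X - _]addrC addrK].
  apply/fcP => t e te; have [e' he] := eig_smooth te; rewrite -he in te *.
  have [X' oX' XX'] := Op_adjoint oX; have [Y' oY' YY'] := Op_adjoint oY.
  have absC v : P v = fop (T := T) (fun t => (absf t)^*) v.
    by congr (fop _ _); apply/funext => s; rewrite /absf conjR.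
  have ZZ' : adjV Z ((X' \o P) - (P \o Y')).
    move=> v w.
    rewrite -[LHS]/(ip (hval (P (X v)) - hval (th X (P v))) (hval w)).
    rewrite -[RHS]/(ip (hval v) (hval (X' (P w)) - hval (P (Y' w)))).
    rewrite ipBl ipBr -!/(ipV _ _) YY' (ipV_fop _ _ pbounded_abs) -absC XX'.
    by rewrite (ipV_fop _ (Y' w) pbounded_abs) -absC.
  rewrite ipDl (restriction_adjoint h1 h2 YY') (restriction_adjoint bc rc ZZ').
  rewrite (fc_adjoint (Y' e') pbounded_abs hu) -absC.
  rewrite -[hval ((_ - _) e')]/(hval (X' (P e')) - hval (P (Y' e'))).
  rewrite ipBr addrC subrK.
  have -> : P e' = absf t *: e'.
    by apply: fopE; [exact: pbounded_abs|exact: (fc_eig saD)].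
  have [lX' _] := oX'.
  have X'0 : X' 0 = 0 by have := lX' (-1) 0 0; rewrite scaler0 addr0 scaleN1r addNr.
  rewrite -[absf t *: e']addr0 lX' X'0 addr0.
  by rewrite -[hval (_ *: _)]/(absf t *: hval (X' e')) ipZr conjR
    (restriction_adjoint bb rX XX').
Qed.

End Regularity.


(** * From regularity to the order condition *)

Section RegularOrder.
Context (R : realType) (T : twistedSpectralTriple R).
Local Notation H := (tst_H T).
Local Notation V := (Hinf T).
Local Notation D := (tst_D T).
Local Notation rep := (@tst_rep R T).
Local Notation F := (is_fcalc D).
Local Notation Ls s := (L (T := T) s%:C).
Local Notation P := (fop (T := T) (absf (R := R))).
Implicit Types (X Y Z : V -> V) (v w : V) (x y : H) (s t : R) (z : R[i]) (b : H -> H).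

(** Domain of |D|^n. Regularity controls commutators with |D| only, so smoothness is reached through
    these domains rather than through powers of Delta. *)
Definition abs_dom n x : Prop := exists y, F (fun t => (`|t| ^+ n)%:C) x y.

Lemma abs_domD n x y : abs_dom n x -> abs_dom n y -> abs_dom n (x + y).
Proof.
move=> [x' hx] [y' hy]; exists (x' + y').
by have := fc_lin 1 hx hy; rewrite !scale1r.
Qed.

Lemma abs_dom_smooth n v : abs_dom n (hval v).
Proof.
have [|w hw] := fc_smooth v (f := fun t => (`|t| ^+ n)%:C); last by exists (hval w).
exists n, 1 => t; rewrite mul1r normc_real ger0_norm ?exprn_ge0//.
by apply: lerXn2r; rewrite ?nnegrE// ?abs_le_weight// ltW// weight_gt0.
Qed.

Lemma abs_dom_le m n x : (m <= n)%N -> abs_dom n x -> abs_dom m x.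
Proof.
move=> mn [y hy]; have h := fc_add (fc_one x) hy.
have [||u hu _] := fc_dominated (f := fun t => (`|t| ^+ m)%:C) (C := 1) _ _ h => //.
  move=> t; rewrite mul1r -(rmorph1 (real_complex R)) -rmorphD !normc_real.
  have tn k : 0 <= `|t| ^+ k by rewrite exprn_ge0.
  rewrite /= (ger0_norm (tn m)) (ger0_norm (addr_ge0 ler01 (tn n))).
  have [t1|/ltW t1] := leP 1 `|t|.
    by rewrite ler_wpDl// ler_weXn2l.
  by rewrite ler_wpDr ?exprn_ge0// exprn_ile1.
by exists u.
Qed.

Lemma abs_domS n x : abs_dom n.+1 x ->
  dom (absop D) x /\ abs_dom n (absop D x).
Proof.
move=> h; have [u hu] := abs_dom_le (leq_ltn_trans (leq0n n) (ltnSn n) : 1 <= n.+1)%N h.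
have [y hy] := h.
have hu' : F (absf (R := R)) x u by apply: fc_ext hu => t; rewrite expr1.
split; first by exists u.
rewrite (absopE hu'); exists y; apply: fc_div hu' _.
by apply: fc_ext hy => t; rewrite exprSr rmorphM.
Qed.

Lemma abs_domS_intro n x : dom (absop D) x -> abs_dom n (absop D x) ->
  abs_dom n.+1 x.
Proof.
move=> /absop_fc h [y hy]; exists y; apply: fc_ext (fc_comp h hy) => t.
by rewrite exprSr rmorphM.
Qed.

(** (1 + t^2)^n <= 2^n (1 + |t|^(2n)), according to whether t^2 or 1 is larger. *)
Lemma smooth_abs_dom x : (forall n, abs_dom n x) -> x \in smooth (T := T).
Proof.
move=> h; apply/smoothP => n; have [y hy] := h (2 * n)%N.
have h' := fc_add (fc_one x) hy.
have [||u hu _] := fc_dominated (f := fun t => ((1 + t ^+ 2) ^+ n)%:C)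
  (C := 2 ^+ n) _ _ h'; [exact: exprn_ge0| |by exists u].
move=> t; rewrite -(rmorph1 (real_complex R)) -rmorphD !normc_real /=.
have w0 := ltW (weight_gt0 t).
have tn : 0 <= `|t| ^+ (2 * n) by rewrite exprn_ge0.
rewrite (ger0_norm (exprn_ge0 n w0)) (ger0_norm (addr_ge0 ler01 tn)).
rewrite exprM real_normK ?num_real//.
have [t1|/ltW t1] := leP 1 (t ^+ 2).
  apply: (@le_trans _ _ (2 ^+ n * (t ^+ 2) ^+ n)).
    rewrite -exprMn; apply: lerXn2r; [exact: w0|by rewrite nnegrE mulr_ge0 ?sqr_ge0|lra].
  by rewrite ler_wpM2l ?exprn_ge0// ler_wpDl.
apply: (@le_trans _ _ (2 ^+ n)).
  by apply: lerXn2r; [exact: w0|rewrite nnegrE|lra].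
by rewrite ler_peMr ?exprn_ge0// lerDl exprn_ge0// sqr_ge0.
Qed.

(** Trades one Sobolev order for one factor |D|, which is the induction step of
    [regular_sobolev]. *)
Lemma N_S_le s v : N (s + 1) v <= N s v + N s (P v).
Proof.
have pf : pbounded (fun t : R => 1 + absf t).
  exists 1%N, 2 => t; apply: (le_trans (le_normcD _ _)); rewrite normc1 expr1.
  by rewrite /absf normc_real normr_id; have := abs_le_weight t; have := weight_ge1 t; lra.
have -> : N (s + 1) v = nV (fop (wt 1%:C) (Ls s v)).
  by rewrite -/(L _ _) Ls_comp addrC.
apply: (@le_trans _ _ (1 * nV (fop (fun t => 1 + absf t) (Ls s v)))).
  apply: nV_fop_le => //; first exact: pbounded_wt.
  move=> t; rewrite mul1r; apply: (le_trans (wt1_le_abs t)).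
  by rewrite /absf -(rmorph1 (real_complex R)) -rmorphD normc_real ler_norm.
rewrite mul1r.
have -> : fop (fun t => 1 + absf t) (Ls s v) = Ls s v + Ls s (P v).
  apply: fopE => //; rewrite (L_fop _ _ (@pbounded_abs R)).
  exact: fc_add (fc_one _) (fopP _ (@pbounded_abs R)).
exact: nrmD.
Qed.

Lemma N_abs_le s v : N s (P v) <= N (s + 1) v.
Proof.
have -> : N (s + 1) v = nV (fop (wt 1%:C) (Ls s v)).
  by rewrite -/(L _ _) Ls_comp addrC.
rewrite /N (L_fop _ _ (@pbounded_abs R)) -[leRHS]mul1r.
apply: nV_fop_le => //; [exact: pbounded_abs|exact: pbounded_wt|].
by move=> t; rewrite mul1r /absf normc_real normr_id; exact: abs_le_wt1.
Qed.

Section RegularAlgebra.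
Context (B : set (H -> H)) (thB : (H -> H) -> (H -> H)).
Context (sB : star_algebra_of_operators B) (tB : twisting B thB)
  (cB : forall b, B b -> exists2 c, B c &
     is_twisted_commutator (absop D) b (thB b) c).

Let thB_B b : B b -> B (thB b).
Proof. by have [_ [h _ _]] := tB; exact: h. Qed.

(** Induction through |D| b = thB(b) |D| + c. It treats all of [B] at once, because thB b and c take
    the place of b at the next stage. *)
Lemma abs_dom_stable n b x : B b -> abs_dom n x -> abs_dom n (b x).
Proof.
elim: n b x => [|n IH] b x Bb hx.
  by exists (b x); apply: fc_ext (fc_one _) => t; rewrite expr0.
have [dx hx'] := abs_domS hx; have [c Bc [_ hc]] := cB Bb.
have [dbx e] := hc x dx; apply: abs_domS_intro => //.
rewrite -[absop D (b x)](subrK (thB b (absop D x))) e; apply: abs_domD.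
  by apply: IH => //; exact: abs_dom_le (leqnSn n) hx.
by apply: IH => //; exact: thB_B.
Qed.

Lemma regular_restriction b : B b -> exists X, is_restriction b X.
Proof.
move=> Bb; apply: restriction_ex => v; apply: smooth_abs_dom => n.
by apply: abs_dom_stable => //; exact: abs_dom_smooth.
Qed.

Lemma regular_commutator b c X Y Z : is_twisted_commutator (absop D) b (thB b) c ->
  is_restriction b X -> is_restriction (thB b) Y -> is_restriction c Z ->
  Z = (P \o X) - (Y \o P).
Proof.
move=> [_ hc] rX rY rZ; apply/funext => v; apply: hval_inj.
have [dv ev] := absop_smooth v; have [_ e] := hc _ dv.
have [_ eX] := absop_smooth (X v).
rewrite rZ -e -rX eX ev -[RHS]/(hval (P (X v)) - hval (Y (P v))).
by rewrite rY.
Qed.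

Lemma regular_sobolev (k : nat) b X : B b -> is_restriction b X ->
  exists2 c : R, 0 <= c & forall v, N k%:R (X v) <= c * N k%:R v.
Proof.
elim: k b X => [|k IH] b X Bb rX.
  have [c c0 hc] := bounded_pos (sao_bounded sB Bb); exists c; first exact: ltW.
  by move=> v; rewrite !N_id /nV rX; exact: hc.
have [c Bc hc] := cB Bb.
have [Y rY] := regular_restriction (thB_B Bb); have [Z rZ] := regular_restriction Bc.
have [c1 c10 h1] := IH _ _ Bb rX; have [c2 c20 h2] := IH _ _ (thB_B Bb) rY.
have [c3 c30 h3] := IH _ _ Bc rZ.
have E := regular_commutator hc rX rY rZ.
exists (c1 + c2 + c3) => [|v]; first by rewrite !addr_ge0.
rewrite -natr1; apply: (le_trans (N_S_le _ _)).
have -> : P (X v) = Z v + Y (P v) by rewrite E -[((_ - _) v)]/(P (X v) - Y (P v)) subrK.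
have := N_add k%:R (Z v) (Y (P v)); have := h1 v; have := h2 (P v); have := h3 v.
have := ler_wpM2l c20 (N_abs_le k%:R v); rewrite natr1.
have := ler_wpM2l c10 (N_le v (_ : k%:R <= k.+1%:R)).
have := ler_wpM2l c30 (N_le v (_ : k%:R <= k.+1%:R)).
rewrite ler_nat leqnSn => /(_ isT) e3 /(_ isT) e1; rewrite !mulrDl; lra.
Qed.

Lemma regular_Op b X : B b -> is_restriction b X -> Op 0 X.
Proof.
move=> Bb rX; have nat2 n : 2 * n%:R = (2 * n)%:R :> R by rewrite natrM.
apply: Op_of_even_orders.
- exact: restriction_linear (sao_bounded sB Bb) rX.
- move=> n; rewrite nat2; have [c c0 hc] := regular_sobolev (2 * n) Bb rX.
  by exists c => // v; rewrite addr0.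
- move=> n; have [S BS hS] := sao_adj sB Bb.
  have [Y rY] := regular_restriction BS.
  have [c c0 hc] := regular_sobolev (2 * n) BS rY.
  exists c => // v; rewrite addr0; apply: (@adjoint_bound _ _ Y X) => // [u w|u].
    by rewrite /ipV rX [RHS]ipC hS -rY -ipC.
  by rewrite opprK nat2.
Qed.

End RegularAlgebra.

Theorem regular_order_condition : regular T -> order_condition T.
Proof.
move=> [B [thB [sB AB CB [tB thE] cB]]].
have repB a : B (rep a) by apply: AB; exists a.
have oc b : B b -> exists2 X, Op 0 X & is_restriction b X.
  move=> Bb; have [X rX] := regular_restriction tB cB Bb; exists X => //.
  exact: (regular_Op sB tB cB Bb rX).
have [lB [BB IB _]] := tB.
have B0 : B 0 by have [] := sao_subspace sB.
have th0 : thB 0 = 0.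
  by have := lB (-1) 0 0 B0 B0; rewrite scaler0 addr0 scaleN1r addNr.
split.
- by move=> _ [a _ <-]; exact: oc.
- by move=> c hc; apply: oc; exact: CB.
- move=> a X Y rX rY.
  have oX := regular_Op sB tB cB (repB a) rX.
  have oY := regular_Op sB tB cB (repB _) rY.
  apply: (abs_commutator oX oY).1.
  have [c Bc hc] := cB _ (repB a); have [Z oZ rZ] := oc _ Bc.
  rewrite -thE in rY.
  by rewrite -(regular_commutator hc rX rY rZ).
(* [thB] extends theta and is injective on [B]. *)
- move=> a; rewrite -thE; split=> [h|->//].
  by apply: IB; rewrite ?th0//; apply: mem_set.
Qed.

End RegularOrder.


(** * Differential operators *)

Section Eigencomponents.
Context (K : fieldType) (M : lmodType K).

Lemma subspace_sum (S : set M) (I : eqType) (s : seq I) (y : I -> M) : subspace S ->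
  (forall i, i \in s -> S (y i)) -> S (\sum_(i <- s) y i).
Proof.
move=> sS; elim: s => [|i s IH] h; first by rewrite big_nil; exact: sS.1.
rewrite big_cons; apply: subspaceD => //; first by apply: h; rewrite mem_head.
by apply: IH => j js; apply: h; rewrite inE js orbT.
Qed.

Lemma linear_on_sum (W : set M) (f : M -> M) (I : eqType) (s : seq I) (y : I -> M) :
  subspace W -> linear_on W f -> (forall i, i \in s -> W (y i)) ->
  f (\sum_(i <- s) y i) = \sum_(i <- s) f (y i).
Proof.
move=> sW lf; have W0 := sW.1.
have f0 : f 0 = 0 by have := lf (-1) _ _ W0 W0; rewrite scaler0 addr0 scaleN1r addNr.
elim: s => [|i s IH] h; first by rewrite !big_nil.
have hs j : j \in s -> W (y j) by move=> js; apply: h; rewrite inE js orbT.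
rewrite !big_cons -IH// -{1}[y i]scale1r lf ?scale1r//.
  by apply: h; rewrite mem_head.
exact: subspace_sum.
Qed.

(** Applying f - m to the sum kills its m-component and multiplies each other mu-component by mu -
    m, which is not 0; induction then removes one eigenvalue at a time. *)
Lemma eigencomponents (S W : set M) (f : M -> M) (s : seq K) (y : K -> M) :
  subspace S -> subspace W -> S `<=` W -> linear_on W f ->
  (forall x, S x -> S (f x)) -> uniq s ->
  (forall mu, mu \in s -> eigenspace_in W f mu (y mu)) ->
  S (\sum_(mu <- s) y mu) -> forall mu, mu \in s -> S (y mu).
Proof.
move=> sS sW SW lf fS; elim: s y => [//|m s IH] y /= /andP[ms us] hy hS.
have hys mu : mu \in s -> eigenspace_in W f mu (y mu).
  by move=> h; apply: hy; rewrite inE h orbT.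
have hs mu : mu \in s -> S (y mu).
  move=> h; have mm : mu - m != 0.
    by rewrite subr_eq0; apply: contraNneq ms => <-.
  rewrite -[y mu](scalerK mm); apply: subspaceZ => //.
  apply: (IH (fun mu => (mu - m) *: y mu)) h => //.
    move=> nu h; have [h1 h2] := hys _ h; split; first exact: subspaceZ.
    have W0 := sW.1.
    have f0 : f 0 = 0 by have := lf (-1) _ _ W0 W0; rewrite scaler0 addr0 scaleN1r addNr.
    by rewrite -[X in f X]addr0 lf// f0 addr0 h2 !scalerA mulrC.
  have -> : \sum_(mu <- s) (mu - m) *: y mu =
      f (\sum_(mu <- m :: s) y mu) - m *: \sum_(mu <- m :: s) y mu.
    rewrite (linear_on_sum (W := W))//; last by move=> nu /hy[].
    rewrite scaler_sumr -sumrB big_cons.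
    have [_ ->] := hy m (mem_head _ _); rewrite subrr add0r.
    apply: eq_big_seq => nu /hys[_ ->]; exact: scalerBl.
  by apply: subspaceB => //; [exact: fS|exact: subspaceZ].
move=> mu; rewrite inE => /orP[/eqP ->|]; last exact: hs.
rewrite big_cons in hS; rewrite -[y m](addrK (\sum_(j <- s) y j)).
by apply: subspaceB => //; exact: subspace_sum.
Qed.

End Eigencomponents.

(** * From diagonalizable differential operators to the order condition *)

Section DifferentialOperators.
Context (R : realType) (T : twistedSpectralTriple R).
Local Notation H := (tst_H T).
Local Notation V := (Hinf T).
Local Notation Ls s := (L (T := T) s%:C).
Local Notation rep := (@tst_rep R T).
Local Notation theta := (@tst_theta R T).
Context (DO : nat -> set (V -> V)) (th : (V -> V) -> (V -> V))
  (hDO : diffop_algebra DO th).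
Implicit Types (X Y Z : V -> V) (v w : V) (s t : R) (mu : R[i]).

Let fDO := do_filtered hDO.
Let W := filt_union DO.

Let sDO n : subspace (DO n). Proof. exact: filt_subspace fDO n. Qed.

Let sW : subspace W.
Proof.
split; first by exists 0%N; exact: (sDO 0).1.
move=> a X Y [m hX] [n hY]; exists (maxn m n); apply: (sDO _).2.
  exact: (filt_le fDO (leq_maxl m n)).
exact: (filt_le fDO (leq_maxr m n)).
Qed.

Let lth : linear_on W th. Proof. by have [[]] := do_twisting hDO. Qed.

Let th_DO n X : DO n X -> DO n (th X).
Proof. by have [_ /(_ n)[h _ _]] := do_twisting hDO; exact: h. Qed.

Let th_surj n X : DO n X -> exists2 Y, DO n Y & th Y = X.
Proof. by have [_ /(_ n)[_ _ h]] := do_twisting hDO; exact: h. Qed.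

Let th_inj X Y : W X -> W Y -> th X = th Y -> X = Y.
Proof.
by move=> hX hY; have [[_ [_ h _]] _] := do_twisting hDO; apply: h; exact: mem_set.
Qed.

Lemma diffop_commutator n X : DO n X -> exists2 Y, DO n.+1 Y &
  forall v, Ls 2 (X v) = th (th X) (Ls 2 v) + Y v.
Proof.
move=> hX; exists (twisted_comm (th \o th) (restr (Delta T)) X).
  exact: (do_Delta hDO).
move=> v; rewrite restr_Delta /twisted_comm.
rewrite -[X in _ = _ + X]/(L 2 (X v) - th (th X) (L 2 v)).
have -> : (2%:C : R[i]) = 2 by rewrite rmorph_nat.
by rewrite addrC subrK.
Qed.

(** The H^(2k+2) norm of X v is the H^(2k) norm of Delta X v. Moving Delta to the right leaves [Y]
    of degree n + 1, within the n + 2 available. *)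
Lemma diffop_positive k n X : DO n X -> sob_bounded n%:R X (2 * k%:R).
Proof.
elim: k n X => [|k IH] n X hX.
  have [c c0 hc] := do_elliptic hDO hX; exists c; first exact: ltW.
  move=> v; have := hc v.
  by rewrite sobolev_normE nrmE -rmorphM lecR mulr0 add0r N_id.
have [Y hY e] := diffop_commutator hX.
have [c c0 hc] := IH _ _ (th_DO (th_DO hX)); have [d d0 hd] := IH _ _ hY.
exists (c + d) => [|v]; first exact: addr_ge0.
have -> : 2 * k.+1%:R = 2 * k%:R + 2 :> R by rewrite -natr1; ring.
rewrite -[N _ (X v)]N_Ls e; apply: (le_trans (N_add _ _ _)); rewrite [leRHS]mulrDl; apply: lerD.
  apply: (le_trans (hc _)); rewrite N_Ls; apply: ler_wpM2l => //.
  by apply: N_le; lra.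
apply: (le_trans (hd _)); apply: ler_wpM2l => //.
by apply: N_le; rewrite -natr1; lra.
Qed.

(* Each use of X = Delta X' Delta^-1 - Y Delta^-1 with Y in DO^(n+1) improves the
   available order by one. *)
Lemma diffop_negative k n X : DO n X -> sob_bounded n%:R X (- (2 * k%:R)).
Proof.
elim: k n X => [|k IH] n X hX.
  by have := diffop_positive 0 hX; rewrite mulr0 oppr0.
(* [g] counts the orders gained: g = 0 is the elliptic estimate, g = 2k + 2 is the claim. *)
have gap g : g%:R <= 2 * k.+1%:R :> R -> forall n X, DO n X ->
    exists2 c : R, 0 <= c &
      forall v, N (- (2 * k.+1%:R)) (X v) <= c * N (n%:R - g%:R) v.
  elim: g => [|g IHg] hg m Z hZ.
    have [c c0 hc] := diffop_positive 0 hZ; exists c => // v.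
    apply: (@le_trans _ _ (N (2 * 0) (Z v))).
      by apply: N_le; rewrite mulr0 oppr_le0 mulr_ge0.
    by have := hc v; rewrite mulr0 add0r subr0.
  (* Surjectivity of theta on each degree, used twice, writes [Z] as theta^2 of Z' without raising
     the degree. *)
  have [Z1 hZ1 e1] := th_surj hZ; have [Z' hZ' e2] := th_surj hZ1.
  have [Y hY e] := diffop_commutator hZ'; rewrite e2 e1 in e.
  have g1 : g%:R <= 2 * k.+1%:R :> R by apply: le_trans hg; rewrite ler_nat.
  have [c c0 hc] := IH _ _ hZ'; have [d d0 hd] := IHg g1 _ _ hY.
  exists (c + d) => [|v]; first exact: addr_ge0.
  have Ze : Z v = Ls 2 (Z' (Ls (-2) v)) - Y (Ls (-2) v).
    by rewrite e Ls_comp subrr Ls_id addrK.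
  rewrite Ze; apply: (le_trans (N_add _ _ _)); rewrite N_opp [leRHS]mulrDl; apply: lerD.
    have -> : - (2 * k.+1%:R) = - (2 * k%:R) - 2 :> R by rewrite -natr1; ring.
    rewrite N_Ls subrK; apply: (le_trans (hc _)); rewrite N_Ls.
    apply: ler_wpM2l => //; apply: N_le.
    by move: hg; rewrite -[k.+1%:R]natr1; lra.
  apply: (le_trans (hd _)); rewrite N_Ls; apply: ler_wpM2l => //.
  by apply: N_le; rewrite -[m.+1%:R]natr1 -[g.+1%:R]natr1; lra.
have g2 : (2 * k.+1)%:R <= 2 * k.+1%:R :> R by rewrite natrM.
have [c c0 hc] := gap _ g2 _ _ hX; exists c => // v.
by apply: (le_trans (hc v)); rewrite natrM addrC.
Qed.

Lemma diffop_Op n X : DO n X -> Op n%:R X.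
Proof.
move=> hX; apply: Op_of_even_orders => [|k|k].
- exact: (filt_linear fDO hX).
- exact: diffop_positive.
- exact: diffop_negative.
Qed.

Lemma diffop_eigen X mu : DO 0%N X -> th X = mu *: X ->
  0 < normc mu + complex.Re mu -> Op 0 ((Ls 1 \o X) - ((mu *: X) \o Ls 1)).
Proof.
move=> hX eX mu0; have oX := diffop_Op hX.
have [Y hY e] := diffop_commutator hX; have oY := diffop_Op hY.
have eXX : th (th X) = mu *: (mu *: X).
  have W0 := sW.1; have WX : W X by exists 0%N.
  have f0 : th 0 = 0 by have := lth (-1) W0 W0; rewrite scaler0 addr0 scaleN1r addNr.
  by rewrite {1}eX -[A in th A]addr0 lth// f0 addr0 eX.
have lX := Op_linear oX.
pose Z := (Ls 1 \o X) - ((mu *: X) \o Ls 1).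
have ZE v : Z v = Ls 1 (X v) - mu *: X (Ls 1 v) by [].
apply: (sylvester_order mu0 (Y := Y)).
- rewrite add0r; apply: OpB.
    by have := Op_comp (Op_Ls T 1) oX; rewrite addr0.
  by have := Op_comp (OpZ mu oX) (Op_Ls T 1); rewrite add0r.
- by rewrite add0r.
- move=> v; rewrite -/Z !ZE.
  have -> : Y v = Ls 2 (X v) - mu *: (mu *: X (Ls 2 v)).
    by rewrite e eXX [A in A - _]addrC -[((mu *: (mu *: X)) _)]/(mu *: (mu *: X (Ls 2 v))) addrK.
  rewrite L_add -scaleN1r !L_scale !Ls_comp scalerBr scaleN1r.
  have -> : 1 + 1 = 2 :> R by [].
  by rewrite addrA subrK.
Qed.

Theorem diffop_order_condition : diagonalizable_on W th ->
  no_negative_eigenvalue W th -> order_condition T.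
Proof.
move=> [diag _] nneg.
have rr a : exists2 X, DO 0%N X & is_restriction (rep a) X.
  by apply: (do_algebra hDO); exists a.
split.
- by move=> b /(do_algebra hDO)[X hX rX]; exists X => //; exact: (diffop_Op hX).
- by move=> b /(do_commutators hDO)[X hX rX]; exists X => //; exact: (diffop_Op hX).
- move=> a X Y rX rY; rewrite -(do_extends hDO rX rY).
  have [X' hX rX'] := rr a; rewrite -(restriction_uniq rX rX') in hX.
  have WX : W X by exists 0%N.
  have [s [y [us hy eX]]] := diag _ WX.
  have DOW : DO 0%N `<=` W by move=> Z hZ; exists 0%N.
  have hsum := hX; rewrite eX in hsum.
  (* Diagonalizability decomposes [X] in the union of the filtration; stability of [DO 0] under
     theta brings the components back to degree 0. *)
  have yDO := eigencomponents (sDO 0) sW DOW lth (@th_DO 0) us hy hsum.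
  have Wy mu : mu \in s -> W (y mu) by move=> h; have [] := hy mu h.
  have oZ mu : mu \in s -> Op 0 ((Ls 1 \o y mu) - ((mu *: y mu) \o Ls 1)).
    move=> h; have [_ e] := hy mu h.
    have [y0|y0] := pselect (y mu = 0).
      rewrite y0 scaler0; have -> : (Ls 1 \o (0 : V -> V)) - ((0 : V -> V) \o Ls 1) = 0.
        by apply/funext => v; rewrite -[LHS]/(Ls 1 (0 : V) - (0 : V)) subr0; exact: L_zero.
      exact: Op_zero.
    apply: diffop_eigen => //; first exact: yDO.
    (* The Sylvester estimate needs |mu| + Re mu > 0, which fails only for real mu <= 0: injectivity
       of theta excludes 0, and [nneg] the negative reals. *)
    have mu0 : mu <> 0.
      move=> mu0; apply: y0; apply: th_inj; [exact: Wy|exact: sW.1|].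
      have W0 := sW.1.
      have f0 : th 0 = 0 by have := lth (-1) W0 W0; rewrite scaler0 addr0 scaleN1r addNr.
      by rewrite e mu0 scale0r f0.
    have := nneg mu _ (hy mu h) y0; rewrite ltcE /= => nn.
    rewrite lt_def; apply/andP; split; last first.
      have := Re_le_normc (- mu); rewrite normcN raddfN /=.
      by rewrite -subr_ge0 opprK.
    apply/eqP => m0; move: nn mu0; case: (mu) m0 => p q /= m0 nn mu0.
    have qq : q ^+ 2 = 0.
      have := sqr_sqrtr (addr_ge0 (sqr_ge0 p) (sqr_ge0 q)).
      by rewrite (_ : Num.sqrt _ = - p) ?sqrrN; lra.
    have q0 : q = 0 by apply/eqP; rewrite -sqrf_eq0 qq.
    have p0 : p <= 0.
      by have := sqrtr_ge0 (p ^+ 2 + q ^+ 2); lra.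
    apply: mu0; rewrite q0; congr (_ +i* _).
    apply/eqP; rewrite eq_le p0 /= leNgt; apply/negP => p1.
    by move/negP: nn; apply; rewrite q0 eqxx.
  have oC : Op 0 ((Ls 1 \o X) - (th X \o Ls 1)).
    have -> : (Ls 1 \o X) - (th X \o Ls 1) =
        \sum_(mu <- s) ((Ls 1 \o y mu) - ((mu *: y mu) \o Ls 1)).
      rewrite eX (linear_on_sum sW lth Wy).
      rewrite sumrB; congr (_ - _).
        apply/funext => v /=; rewrite fct_sumE /= fct_sumE.
        elim: (s) => [|m l IH]; first by rewrite !big_nil L_zero.
        by rewrite !big_cons L_add IH.
      apply/funext => v /=; rewrite !fct_sumE.
      by apply: eq_big_seq => mu /hy[_ ->].
    by apply: subspace_sum => //; exact: Op_subspace.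
  have -> : th X - Delta_conj 1 X = (- ((Ls 1 \o X) - (th X \o Ls 1))) \o Ls (-1).
    apply/funext => v; rewrite -[LHS]/(th X v - L 1 (X (L (-1) v))).
    rewrite -[RHS]/(- (Ls 1 (X (Ls (-1) v)) - th X (Ls 1 (Ls (-1) v)))).
    by rewrite opprB Ls_comp subrr Ls_id; congr (_ - L _ (X (L _ v))); rewrite rmorphN.
  by rewrite -[X in Op X]add0r; apply: Op_comp; [exact: OpN|exact: Op_Ls].
- move=> a; have [X hX rX] := rr a; have [Y hY rY] := rr (theta a).
  have e := do_extends hDO rX rY.
  have WX : W X by exists 0%N.
  have W0 := sW.1.
  have f0 : th 0 = 0 by have := lth (-1) W0 W0; rewrite scaler0 addr0 scaleN1r addNr.
  have b0 : bounded_operator (0 : H -> H).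
    split=> [k x y|]; first by rewrite scaler0 addr0.
    by exists 0 => v; rewrite -[(0 : H -> H) v]/(0 : H) normr0 mul0r.
  have r0 : is_restriction (0 : H -> H) (0 : V -> V) by [].
  split=> h.
    have Y0 : Y = 0 by apply: (restriction_uniq rY); rewrite h.
    have X0 : X = 0 by apply: th_inj => //; rewrite e Y0 f0.
    by apply: (restriction_inj (tst_rep_bounded a) b0 rX); rewrite X0.
  have X0 : X = 0 by apply: (restriction_uniq rX); rewrite h.
  have Y0 : Y = 0 by rewrite -e X0 f0.
  by apply: (restriction_inj (tst_rep_bounded _) b0 rY); rewrite Y0.
Qed.

End DifferentialOperators.

Theorem theorem4p2p5 (R : realType) (T : twistedSpectralTriple R) :
  (regular T ->
     (exists (DO : nat -> set (Hinf T -> Hinf T))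
             (theta : (Hinf T -> Hinf T) -> (Hinf T -> Hinf T)),
        diffop_algebra DO theta) /\
     (exists (Psi : R -> set (Hinf T -> Hinf T))
             (Theta : R[i] -> (Hinf T -> Hinf T) -> (Hinf T -> Hinf T)),
        psido_algebra Psi Theta)) /\
  (forall (DO : nat -> set (Hinf T -> Hinf T))
          (theta : (Hinf T -> Hinf T) -> (Hinf T -> Hinf T)),
     diffop_algebra DO theta ->
     diagonalizable_on (filt_union DO) theta ->
     no_negative_eigenvalue (filt_union DO) theta ->
     regular T).
Proof.
split=> [/regular_order_condition oc|DO theta hDO dg nn].
  split; first exact: order_condition_diffop.
  by exists (Op (T := T)), (@Delta_conj R T); exact: order_condition_psido.
exact: order_condition_regular (diffop_order_condition hDO dg nn).
Qed.
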